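(* Let $T_0>0$, let $(F,\Psi,\mathfrak{P})$ be a Wu solution on $[0,T_0]$ (as defined in the context), and fix a time $t\in[0,T_0]$. Then the function $\left(\frac{1}{\Psi_{z'}}(\partial_{x'}-i\partial_{y'})\mathfrak{P}\right)(\cdot,t)$ on $P_-$ extends to a continuous function on $\overline{P}_-$, with $$\overline{Z_{tt}}(\alpha',t)-i=\left(-\frac{1}{\Psi_{z'}}(\partial_{x'}-i\partial_{y'})\mathfrak{P}\right)(\alpha',t)\quad\text{for all }\alpha'\in\mathbb{R}.$$ In addition, $\overline{Z_{tt}}(\alpha',t)=i$ for all $\alpha'\in S(t)$, where $S(t)=\{\alpha'\in\mathbb{R} : \frac{1}{\Psi_{z'}}(\alpha',t)=0\}$.
   Context: **Notation.** Identify $\mathbb{R}^2$ with $\mathbb{C}$. $P_-=\{z'=x'+iy' : y'<0\}$ is the lower half plane, $\overline{P}_-$ its closure, with boundary $\mathbb{R}$. $\partial_{z'}=\frac12(\partial_{x'}-i\partial_{y'})$; subscripts $t,z',\alpha,\alpha'$ denote partial derivatives (except in the symbols $Z_t,Z_{tt}$, defined below). $\|\cdot\|_p$ is the $L^p(\mathbb{R})$ norm; $\|f\|_{\dot H^{1/2}}=\||\xi|^{1/2}\hat f\|_2$. $K_y(x)=\frac{-y}{\pi(x^2+y^2)}$ for $y<0$ is the Poisson kernel; $*$ is convolution in the real variable. Compositions and inverses are in the spatial variable. $f_\epsilon\Rightarrow f$ on $U$ means uniform convergence on compact subsets of $U$. $C(\cdot)$ denotes finite quantities depending only on the indicated arguments.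 Convention: if a function (or a product such as $\frac{1}{\Psi_{z'}}F_{z'}$) defined on $P_-$ extends continuously to $\overline{P}_-$, its value at a boundary point is that of the continuous extension. **Water wave system in $P_-$.** For $F,\Psi$ complex valued and $\mathfrak P$ real valued: (i) $F_t-\Psi_t\frac{F_{z'}}{\Psi_{z'}}+\overline F\frac{F_{z'}}{\Psi_{z'}}=-\frac{1}{\Psi_{z'}}(\partial_{x'}-i\partial_{y'})\mathfrak P+i$ on $P_-$; (ii) $F(\cdot,t)$ holomorphic and $\Psi(\cdot,t)$ conformal on $P_-$; (iii) $\mathfrak P=0$ on $\partial P_-$; (iv) the trace of $\frac{1}{\Psi_{z'}}(\overline F-\Psi_t)$ on $\partial P_-$ is real valued; with $F\to0$, $(\partial_{x'}-i\partial_{y'})\mathfrak P\to i$, $\Psi_{z'}\to1$, $\Psi_t\to0$ as $z'\to\infty$. **Energy.** All norms are in $x'$ at height $y'$: $\mathcal E_1(t)=\sup_{y'<0}\|F_{z'}\|_{L^2}^2+\sup_{y'<0}\|\frac{1}{\Psi_{z'}}F_{z'}\|_{\dot H^{1/2}}^2+\sup_{y'<0}\|\frac{1}{\Psi_{z'}}\partial_{z'}(\frac{1}{\Psi_{z'}}F_{z'})\|_{L^2}^2+\sup_{y'<0}\|\frac{1}{\Psi_{z'}^2}\partial_{z'}(\frac{1}{\Psi_{z'}}F_{z'})\|_{\dot H^{1/2}}^2+\sup_{y'<0}\|\frac{1}{\Psi_{z'}}\|_{L^\infty}^2+\sup_{y'<0}\|\partial_{z'}(\frac{1}{\Psi_{z'}})\|_{L^2}^2+\sup_{y'<0}\|\frac{1}{\Psi_{z'}}\partial_{z'}(\frac{1}{\Psi_{z'}}\partial_{z'}(\frac{1}{\Psi_{z'}}))\|_{L^2}^2$.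 **Initial data.** $F(\cdot,0),\Psi(\cdot,0)$ are holomorphic on $P_-$, $\Psi(\cdot,0)$ is conformal onto a domain whose boundary is a Jordan curve, $\Psi_{z'}(z',0)\to1$ as $z'\to\infty$; $\mathfrak P(\cdot,0)$ is the unique solution of $\Delta\mathfrak P=-2|F_{z'}|^2$ on $P_-$, $\mathfrak P=0$ on $\partial P_-$, $(\partial_{x'}+i\partial_{y'})\mathfrak P\to-i$ at infinity; and $\mathcal E_1(0)<\infty$, $c_0:=\sup_{y'<0}\|F(\cdot+iy',0)\|_{L^2}+\sup_{y'<0}\|\frac{1}{\Psi_{z'}(\cdot+iy',0)}-1\|_{L^2}<\infty$. **Wu solution on $[0,T_0]$.** This is a solution produced by Wu's existence theorem from such data. Concretely it is a solution $(F,\Psi,\mathfrak P)$ of the system on $[0,T_0]$ with the following properties. (1) $\Psi$ is $C^1$ on $P_-\times[0,T_0]$, each $\Psi(\cdot,t)$ is conformal, and $\Psi,\frac1{\Psi_{z'}},\frac{\Psi_t}{\Psi_{z'}}$ are continuous on $\overline P_-\times[0,T_0]$; $F$ is bounded and continuous on $\overline P_-\times[0,T_0]$, $C^1$ on $P_-\times[0,T_0]$, each $F(\cdot,t)$ holomorphic; $\mathfrak P$ is continuous on $\overline P_-\times[0,T_0]$ and $C^1$ on $P_-\times[0,T_0]$; for all $t$, $\mathcal E_1(t)<\infty$ and $\sup_{y'<0}\|F(\cdot+iy',t)\|_{L^2}+\sup_{y'<0}\|\frac1{\Psi_{z'}(\cdot+iy',t)}-1\|_{L^2}<\infty$. (2)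 Smooth approximations. For each $0<\epsilon\le1$ there is a solution $(F^\epsilon,\Psi^\epsilon,\mathfrak P^\epsilon)$ of the system on $[0,T_0]$, smooth up to the boundary, with $F^\epsilon(z',0)=F(z'-\epsilon i,0)$, $\Psi^\epsilon(z',0)=\Psi(z'-\epsilon i,0)$. Write $Z^\epsilon(\alpha',t)=\Psi^\epsilon(\alpha',t)$, $Z^\epsilon_{,\alpha'}=\partial_{\alpha'}Z^\epsilon$, $Z_t^\epsilon=\overline{F^\epsilon}|_{\mathbb R}$, $Z^\epsilon_{t,\alpha'}=\partial_{\alpha'}Z^\epsilon_t$, $b^\epsilon=\frac{1}{\Psi^\epsilon_{z'}}(\overline{F^\epsilon}-\Psi^\epsilon_t)|_{\mathbb R}$; $h^\epsilon$ is the flow $h^\epsilon_t=b^\epsilon\circ h^\epsilon$, $h^\epsilon(\alpha,0)=\alpha$; $z^\epsilon=Z^\epsilon\circ h^\epsilon$ (so $z^\epsilon_t=Z_t^\epsilon\circ h^\epsilon$), $Z^\epsilon_{tt}=z^\epsilon_{tt}\circ(h^\epsilon)^{-1}$; $A_1^\epsilon(\alpha',t)=1+\frac1{2\pi}\int\frac{|Z_t^\epsilon(\alpha',t)-Z_t^\epsilon(\beta',t)|^2}{(\alpha'-\beta')^2}d\beta'$. On $\mathbb R$: $\frac{1}{\Psi^\epsilon_{z'}}(\partial_{x'}-i\partial_{y'})\mathfrak P^\epsilon=i\frac{A_1^\epsilon}{Z^\epsilon_{,\alpha'}}$ and $\overline{Z^\epsilon_{tt}}-i=-i\frac{A_1^\epsilon}{Z^\epsilon_{,\alpha'}}$.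 Moreover $\mathfrak P^\epsilon=-\frac12|F^\epsilon|^2-y'+\frac12K_{y'}*(|Z_t^\epsilon|^2)$. (3) Uniform bounds for all $0<\epsilon\le1$, $t\in[0,T_0]$: the quantities $\|Z^\epsilon_{t,\alpha'}\|_2$, $\|\partial_{\alpha'}\frac1{Z^\epsilon_{,\alpha'}}\|_2$, $\|A_1^\epsilon\|_\infty$, $\|\frac1{Z^\epsilon_{,\alpha'}}\partial_{\alpha'}A_1^\epsilon\|_2$, $\|b^\epsilon_{\alpha'}\|_\infty$, $\|\frac{h^\epsilon_{t\alpha}}{h^\epsilon_\alpha}\|_\infty$, $\|\frac{z^\epsilon_{t\alpha}}{z^\epsilon_\alpha}\|_\infty$, $\|\partial_{\alpha'}(\frac{1}{(Z^\epsilon_{,\alpha'})^2}Z^\epsilon_{t,\alpha'})\|_2$ (and the same with $\overline{Z^\epsilon_{t,\alpha'}}$ in place of $Z^\epsilon_{t,\alpha'}$) are at most $C(\mathcal E_1(0))$; $\|Z_t^\epsilon\|_\infty+\|\frac1{Z^\epsilon_{,\alpha'}}\|_\infty\le C(c_0,\mathcal E_1(0))$; and there are $0<c_1,c_2<\infty$ depending only on $\mathcal E_1(0)$ with $c_1\le|h^\epsilon_\alpha(\alpha,t)|\le c_2$, $c_1|z^\epsilon_\alpha(\alpha,0)|\le|z^\epsilon_\alpha(\alpha,t)|\le c_2|z^\epsilon_\alpha(\alpha,0)|$, $|z^\epsilon_{t\alpha}(\alpha,t)|\le c_2|z^\epsilon_\alpha(\alpha,0)|$. (4) Convergence along a sequence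 $\epsilon=\epsilon_j\to0$. There is a continuous $h:\mathbb R\times[0,T_0]\to\mathbb R$, each $h(\cdot,t)$ a homeomorphism, $h(\alpha,0)=\alpha$, with $h^\epsilon\Rightarrow h$, $(h^\epsilon)^{-1}\Rightarrow h^{-1}$ on $\mathbb R\times[0,T_0]$, and $0<c_1\le\frac{h(\alpha,t)-h(\beta,t)}{\alpha-\beta}\le c_2<\infty$ for $\alpha\ne\beta$. There is a continuous $z:\mathbb R\times[0,T_0]\to\mathbb C$, twice continuously differentiable in $t$ with $z_t,z_{tt}$ bounded and continuous, and $z^\epsilon\Rightarrow z$, $z^\epsilon_t\Rightarrow z_t$, $z^\epsilon_{tt}\Rightarrow z_{tt}$. Put $Z=z\circ h^{-1}$, $Z_t=z_t\circ h^{-1}$, $Z_{tt}=z_{tt}\circ h^{-1}$; then $Z^\epsilon\Rightarrow Z$, $Z_t^\epsilon\Rightarrow Z_t$, $Z_{tt}^\epsilon\Rightarrow Z_{tt}$ on $\mathbb R\times[0,T_0]$, $Z(\alpha',t)=\Psi(\alpha',t)$ and $\overline{Z_t}(\alpha',t)=F(\alpha',t)$. On $\overline P_-\times[0,T_0]$: $\Psi^\epsilon\Rightarrow\Psi$, $\frac1{\Psi^\epsilon_{z'}}\Rightarrow\frac1{\Psi_{z'}}$, $\frac{\Psi^\epsilon_t}{\Psi^\epsilon_{z'}}\Rightarrow\frac{\Psi_t}{\Psi_{z'}}$, $F^\epsilon\Rightarrow F$, $\mathfrak P^\epsilon\Rightarrow\mathfrak P$. On $P_-\times[0,T_0]$: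 $\Psi^\epsilon_t\Rightarrow\Psi_t$, $\Psi^\epsilon_{z'}\Rightarrow\Psi_{z'}$, $F^\epsilon_{z'}\Rightarrow F_{z'}$, $F^\epsilon_t\Rightarrow F_t$, $(\partial_{x'}-i\partial_{y'})\mathfrak P^\epsilon\Rightarrow(\partial_{x'}-i\partial_{y'})\mathfrak P$. Finally $\mathfrak P=-\frac12|F|^2-y'+\frac12K_{y'}*(|Z_t|^2)$ on $P_-\times[0,T_0]$. *)

(* Defs.v *)
From HB Require Import structures.
From mathcomp Require Import all_boot all_order all_algebra.
From mathcomp Require Import complex.
From mathcomp Require Import all_classical all_reals all_analysis.

Set Implicit Arguments.
Unset Strict Implicit.
Unset Printing Implicit Defensive.
Import Order.TTheory GRing.Theory Num.Theory.
Import numFieldNormedType.Exports.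

Local Open Scope classical_set_scope.
Local Open Scope ring_scope.
Local Open Scope complex_scope.

(* R[i] as a normed space over itself: its topology, and complex
   differentiability through [derivable]. *)
HB.instance Definition _ (R : realType) := NormedModule.copy R[i] R[i]^o.

Section Water_waves.
Context {R : realType}.
Local Notation C := R[i].
Local Notation mu := (@lebesgue_measure R).

(* [`|z|] lives in R[i]; this is the modulus as a real number. *)
Definition cabs (z : C) : R := ComplexField.Normc.normc z.

Definition lower_half_plane : set C := [set z | complex.Im z < 0].
Definition closed_lower_half_plane : set C := [set z | complex.Im z <= 0].
Local Notation P_ := lower_half_plane.
Local Notation Pbar := closed_lower_half_plane.

(* Derivative of a complex-valued function of a real variable at t, the
   increments being restricted to D: D = setT for the space variables, and
   D = `[0, T] for time, which makes it one-sided at t = 0 and t = T. *)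
Definition diff_quotient (f : R -> C) (t s : R) : C :=
  ((s - t)^-1)%:C * (f s - f t).

Definition has_deriv_on (D : set R) (f : R -> C) (t : R) (l : C) : Prop :=
  diff_quotient f t s @[s --> within D t^'] --> l.

Definition derivable_on (D : set R) (f : R -> C) (t : R) : Prop :=
  cvg (diff_quotient f t s @[s --> within D t^']).

Definition deriv_on (D : set R) (f : R -> C) (t : R) : C :=
  lim (diff_quotient f t s @[s --> within D t^']).

Definition xline (f : C -> C) (z : C) : R -> C := fun s => f (z + s%:C).
Definition yline (f : C -> C) (z : C) : R -> C := fun s => f (z + 'i%C * s%:C).

Definition dx (f : C -> C) (z : C) : C := deriv_on setT (xline f z) 0.
Definition dy (f : C -> C) (z : C) : C := deriv_on setT (yline f z) 0.
(* gradm = d_x' - i d_y' and gradp = d_x' + i d_y' *)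
Definition gradm (f : C -> C) (z : C) : C := dx f z - 'i%C * dy f z.
Definition gradp (f : C -> C) (z : C) : C := dx f z + 'i%C * dy f z.
Definition dz (f : C -> C) (z : C) : C := 2^-1 * (dx f z - 'i%C * dy f z).

(* d_t for t in [0, T] *)
Definition dt (T : R) (X : Type) (f : X -> R -> C) (a : X) (t : R) : C :=
  deriv_on `[0, T] (f a) t.
(* d_alpha and d_alpha' *)
Definition da (f : R -> R -> C) (a t : R) : C := deriv_on setT (f^~ t) a.

Definition holomorphic (f : C -> C) : Prop :=
  forall z, P_ z -> derivable f z 1.

(* Conformality is local here: it does not include global injectivity. *)
Definition conformal (f : C -> C) : Prop :=
  holomorphic f /\ forall z, P_ z -> dz f z != 0.

(* The extension of f from P_- to its closure by its limits from inside P_-.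
   It is continuous on the closure exactly when f extends continuously. *)
Definition ext (f : C -> C) (z : C) : C :=
  if z \in P_ then f z else lim (f w @[w --> within P_ (nbhs z)]).

Definition extt (f : C -> R -> C) (z : C) (t : R) : C := ext (f^~ t) z.

Definition cont_on (X : topologicalType) (D : set X) (V : topologicalType)
  (f : X -> V) : Prop := {within D, continuous f}.

Definition bounded_on (X : Type) (D : set X) (f : X -> C) : Prop :=
  exists M : R, forall p, D p -> cabs (f p) <= M.

Definition cvg_loc_unif (X : topologicalType) (U : set X) (V : uniformType)
    (f_ : nat -> X -> V) (f : X -> V) : Prop :=
  forall K : set X, compact K -> K `<=` U -> {uniform K, f_ @ \oo --> f}.

Definition tends_at_infinity (f : C -> C) (l : C) : Prop :=
  forall e : R, 0 < e -> exists M : R,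
    forall z, P_ z -> M < cabs z -> cabs (f z - l) < e.

Definition C1_space (f : C -> C) : Prop :=
  [/\ forall z, P_ z -> derivable_on setT (xline f z) 0,
      forall z, P_ z -> derivable_on setT (yline f z) 0,
      cont_on P_ (dx f) & cont_on P_ (dy f)].

Definition C2_space (f : C -> C) : Prop :=
  [/\ C1_space f, C1_space (dx f) & C1_space (dy f)].

Definition C1_spacetime (T : R) (f : C -> R -> C) : Prop :=
  [/\ forall z t, P_ z -> t \in `[0, T] ->
        [/\ derivable_on setT (xline (f^~ t) z) 0,
            derivable_on setT (yline (f^~ t) z) 0 &
            derivable_on `[0, T] (f z) t],
      cont_on (P_ `*` `[0, T]) (uncurry (fun z t => dx (f^~ t) z)),
      cont_on (P_ `*` `[0, T]) (uncurry (fun z t => dy (f^~ t) z)) &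
      cont_on (P_ `*` `[0, T]) (uncurry (dt T f))].

(* C^oo on P_- x [0, T], all derivatives extending continuously to
   closure(P_-) x [0, T]; G i j k is d_x'^i d_y'^j d_t^k f. *)
Definition smooth_up_to_boundary (T : R) (f : C -> R -> C) : Prop :=
  exists G : nat -> nat -> nat -> C -> R -> C,
    [/\ forall z t, Pbar z -> t \in `[0, T] -> G 0 0 0 z t = f z t,
        forall i j k, cont_on (Pbar `*` `[0, T]) (uncurry (G i j k)) &
        forall i j k z t, P_ z -> t \in `[0, T] ->
          [/\ has_deriv_on setT (xline ((G i j k)^~ t) z) 0 (G i.+1 j k z t),
              has_deriv_on setT (yline ((G i j k)^~ t) z) 0 (G i j.+1 k z t) &
              has_deriv_on `[0, T] (G i j k z) t (G i j k.+1 z t)]].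

(* C^oo on R x [0, T] *)
Definition smooth_line (T : R) (f : R -> R -> C) : Prop :=
  exists G : nat -> nat -> R -> R -> C,
    [/\ forall a t, t \in `[0, T] -> G 0 0 a t = f a t,
        forall i k, cont_on (setT `*` `[0, T]) (uncurry (G i k)) &
        forall i k a t, t \in `[0, T] ->
          has_deriv_on setT ((G i k)^~ t) a (G i.+1 k a t) /\
          has_deriv_on `[0, T] (G i k a) t (G i k.+1 a t)].

Definition L2norm (f : R -> C) : \bar R :=
  Lnorm mu 2%:E (fun x => (cabs (f x))%:E).
Definition Linfnorm (f : R -> C) : \bar R :=
  Lnorm mu +oo%E (fun x => (cabs (f x))%:E).

Definition memL2 (f : R -> C) : Prop :=
  [/\ measurable_fun setT (fun x => complex.Re (f x)),
      measurable_fun setT (fun x => complex.Im (f x)) &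
      (L2norm f < +oo)%E].

Definition cintegral (D : set R) (f : R -> C) : C :=
  (\int[mu]_(x in D) complex.Re (f x)) +i*
  (\int[mu]_(x in D) complex.Im (f x)).

Definition fourier_trunc (n : nat) (f : R -> C) (xi : R) : C :=
  cintegral `[- n%:R, n%:R] (fun x => f x * (cos (x * xi) -i* sin (x * xi))).

(* g is the Fourier-Plancherel transform of f: the L^2 limit of the truncated
   Fourier integrals. *)
Definition fourier_transform (f g : R -> C) : Prop :=
  [/\ memL2 f, memL2 g &
      L2norm (fun xi => fourier_trunc n f xi - g xi) @[n --> \oo] --> 0%E].

(* For f in L^2 the set below is a singleton, since the transform exists and is
   unique a.e.; for f not in L^2 it is empty and the value is +oo. *)
Definition Hhalfnorm (f : R -> C) : \bar R :=
  ereal_inf [set L2norm (fun xi => (Num.sqrt `|xi|)%:C * g xi)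
            | g in fourier_transform f].

Definition sup_heights (N : (R -> C) -> \bar R) (f : C -> C) : \bar R :=
  ereal_sup [set N (fun x => f (x +i* y)) | y in [set y : R | y < 0]].

Definition sqnorm (N : (R -> C) -> \bar R) (f : R -> C) : \bar R :=
  (N f * N f)%E.

Definition energy (F Psi : C -> R -> C) (t : R) : \bar R :=
  let Fz := dz (F^~ t) in
  let W := fun z => (dz (Psi^~ t) z)^-1 in
  let G := fun z => W z * Fz z in
  let DG := fun z => W z * dz G z in
  let D2G := fun z => W z ^+ 2 * dz G z in
  let DW := fun z => W z * dz W z in
  let D2W := fun z => W z * dz DW z in
  (sup_heights (sqnorm L2norm) Fz
   + sup_heights (sqnorm Hhalfnorm) G
   + sup_heights (sqnorm L2norm) DG
   + sup_heights (sqnorm Hhalfnorm) D2G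
   + sup_heights (sqnorm Linfnorm) W
   + sup_heights (sqnorm L2norm) (dz W)
   + sup_heights (sqnorm L2norm) D2W)%E.

Definition lower_norm (F Psi : C -> R -> C) (t : R) : \bar R :=
  (sup_heights L2norm (F^~ t)
   + sup_heights L2norm (fun z => (dz (Psi^~ t) z)^-1 - 1)%R)%E.

Definition poisson (y x : R) : R := - y / (pi * (x ^+ 2 + y ^+ 2)).

(* K_y * g at x, for z = x + i y in P_- *)
Definition poisson_conv (g : R -> R) (z : C) : R :=
  \int[mu]_s (poisson (complex.Im z) (complex.Re z - s) * g s).

Definition pressure_formula (T : R) (F : C -> R -> C) (Pr : C -> R -> R)
    (Zt : R -> R -> C) : Prop :=
  forall z t, P_ z -> t \in `[0, T] ->
    Pr z t = - 2^-1 * cabs (F z t) ^+ 2 - complex.Im z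
             + 2^-1 * poisson_conv (fun a => cabs (Zt a t) ^+ 2) z.

Definition toC (X : Type) (f : X -> R -> R) (a : X) (t : R) : C := (f a t)%:C.

(* The trace on the real line has to be understood through [ext], as Psi_z'
   and Psi_t are only defined in P_-. *)
Definition bdrift (T : R) (F Psi : C -> R -> C) (a t : R) : C :=
  extt (fun z t => (dz (Psi^~ t) z)^-1 * (conjc (F z t) - dt T Psi z t)) a%:C t.

Record water_wave_system (T : R) (F Psi : C -> R -> C) (Pr : C -> R -> R) :
    Prop := WaterWaveSystem {
  ww_eq : forall z t, P_ z -> t \in `[0, T] ->
    dt T F z t - dt T Psi z t * (dz (F^~ t) z / dz (Psi^~ t) z)
      + conjc (F z t) * (dz (F^~ t) z / dz (Psi^~ t) z)
    = - ((dz (Psi^~ t) z)^-1 * gradm ((toC Pr)^~ t) z) + 'i%C;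
  ww_holo : forall t, t \in `[0, T] -> holomorphic (F^~ t);
  ww_conf : forall t, t \in `[0, T] -> conformal (Psi^~ t);
  ww_pressure0 : forall (a t : R), t \in `[0, T] -> Pr a%:C t = 0;
  ww_trace : forall a t, t \in `[0, T] -> complex.Im (bdrift T F Psi a t) = 0;
  ww_infty : forall t, t \in `[0, T] ->
    [/\ tends_at_infinity (F^~ t) 0,
        tends_at_infinity (gradm ((toC Pr)^~ t)) 'i%C,
        tends_at_infinity (dz (Psi^~ t)) 1 &
        tends_at_infinity ((dt T Psi)^~ t) 0] }.

(* A Jordan curve through the point at infinity. *)
Definition unbounded_jordan_curve (S : set C) : Prop :=
  exists gamma : R -> C,
    [/\ continuous gamma, injective gamma, range gamma = S &
        forall M : R, exists A : R, forall s, A < `|s| -> M < cabs (gamma s)].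

Record wu_initial_data (F0 Psi0 : C -> C) (Pr0 : C -> R) : Prop :=
    WuInitialData {
  init_F_holo : holomorphic F0;
  init_Psi_conf : conformal Psi0;
  init_Psi_inj : {in P_ &, injective Psi0};
  init_jordan :
    unbounded_jordan_curve (closure (Psi0 @` P_) `\` (Psi0 @` P_)°);
  init_Psi_infty : tends_at_infinity (dz Psi0) 1;
  init_Pr_C2 : C2_space (fun z => (Pr0 z)%:C);
  init_Pr_cont : cont_on Pbar Pr0;
  init_Pr_laplace : forall z, P_ z ->
    dx (dx (fun z => (Pr0 z)%:C)) z + dy (dy (fun z => (Pr0 z)%:C)) z
    = (- 2 * cabs (dz F0 z) ^+ 2)%:C;
  init_Pr_bdry : forall a : R, Pr0 a%:C = 0;
  init_Pr_infty : tends_at_infinity (gradp (fun z => (Pr0 z)%:C)) (- 'i%C) }.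

(* f o h and f o h^-1, in the spatial variable *)
Definition comph (X : Type) (f : R -> R -> X) (h : R -> R -> R) (a t : R) : X :=
  f (h a t) t.
Definition hinv (h : R -> R -> R) (a t : R) : R :=
  'pinv_(fun=> 0) setT (h^~ t) a.

Definition trace (f : C -> R -> C) (a t : R) : C := f a%:C t.
Definition conj_trace (f : C -> R -> C) (a t : R) : C := conjc (f a%:C t).

Definition A1 (Zt : R -> R -> C) (a t : R) : R :=
  1 + (2 * pi)^-1 *
    \int[mu]_b (cabs (Zt a t - Zt b t) ^+ 2 / (a - b) ^+ 2).

(* The quantities C(.) and the constants c1, c2 of the a priori bounds, as
   functions of E_1(0), resp. of (c_0, E_1(0)), independent of the solution. *)
Record wu_constants := WuConstants {
  CE : R -> R;
  CcE : R -> R -> R;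
  c1 : R -> R;
  c2 : R -> R;
  c1_gt0 : forall E, 0 < c1 E;
  c2_gt0 : forall E, 0 < c2 E }.

Section Approximation.
Variables (T : R) (F Psi : C -> R -> C) (Pr : C -> R -> R) (h : R -> R -> R).

Let Z := trace Psi.
Let Zt := conj_trace F.
Let Za := da Z.
Let z := comph Z h.
Let Ztt := comph (dt T (dt T z)) (hinv h).
Let b := bdrift T F Psi.

(* One approximate solution and its flow h. That h is smooth and that Z_,alpha'
   does not vanish is implicit in the smoothness of the solution and in the
   occurrence of h_alpha and 1/Z_,alpha' in the bounds. *)
Record wu_smooth_solution : Prop := WuSmoothSolution {
  sm_system : water_wave_system T F Psi Pr;
  sm_F : smooth_up_to_boundary T F;
  sm_Psi : smooth_up_to_boundary T Psi;
  sm_Pr : smooth_up_to_boundary T (toC Pr);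
  sm_Za : forall a t, t \in `[0, T] -> Za a t != 0;
  sm_h : smooth_line T (toC h);
  sm_flow : forall a t, t \in `[0, T] -> dt T (toC h) a t = comph b h a t;
  sm_flow0 : forall a, h a 0 = a;
  sm_zt : forall a t, t \in `[0, T] -> dt T z a t = comph Zt h a t;
  sm_gradP : forall a t, t \in `[0, T] ->
    extt (fun w t => (dz (Psi^~ t) w)^-1 * gradm ((toC Pr)^~ t) w) a%:C t
    = 'i%C * ((A1 Zt a t)%:C / Za a t);
  sm_Ztt : forall a t, t \in `[0, T] ->
    conjc (Ztt a t) - 'i%C = - ('i%C * ((A1 Zt a t)%:C / Za a t));
  sm_pressure : pressure_formula T F Pr Zt }.

(* The a priori bounds, with E = E_1(0) and c0 = c_0. *)
Record wu_uniform_bounds (K : wu_constants) (c0 E : R) : Prop :=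
    WuUniformBounds {
  ub_E : forall t, t \in `[0, T] ->
    let bounded N f := (N (fun a : R => f a t) <= (CE K E)%:E)%E in
    bounded L2norm (da Zt) /\
    bounded L2norm (da (fun a t => (Za a t)^-1)) /\
    bounded Linfnorm (toC (A1 Zt)) /\
    bounded L2norm (fun a t => (Za a t)^-1 * da (toC (A1 Zt)) a t) /\
    bounded Linfnorm (da b) /\
    bounded Linfnorm (fun a t => da (dt T (toC h)) a t / da (toC h) a t) /\
    bounded Linfnorm (fun a t => da (dt T z) a t / da z a t) /\
    bounded L2norm (da (fun a t => (Za a t ^+ 2)^-1 * da Zt a t)) /\
    bounded L2norm (da (fun a t => (Za a t ^+ 2)^-1 * conjc (da Zt a t)));
  ub_cE : forall t, t \in `[0, T] ->
    (Linfnorm (Zt^~ t) + Linfnorm (fun a => ((Za a t)^-1)%R)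
       <= (CcE K c0 E)%:E)%E;
  ub_ha : forall a t, t \in `[0, T] ->
    c1 K E <= cabs (da (toC h) a t) <= c2 K E;
  ub_za : forall a t, t \in `[0, T] ->
    c1 K E * cabs (da z a 0) <= cabs (da z a t) <= c2 K E * cabs (da z a 0);
  ub_zta : forall a t, t \in `[0, T] ->
    cabs (da (dt T z) a t) <= c2 K E * cabs (da z a 0) }.

End Approximation.

(* (F, Psi, Pr) is the solution; (Fe e, Psie e, Pre e), 0 < e <= 1, are its
   smooth approximations, he e their flows, eps the sequence of parameters along
   which they converge, and h, z the limits of he and of z^e. *)
Record wu_solution (K : wu_constants) (T : R)
    (F Psi : C -> R -> C) (Pr : C -> R -> R)
    (Fe Psie : R -> C -> R -> C) (Pre : R -> C -> R -> R)
    (he : R -> R -> R -> R) (eps : nat -> R)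
    (h : R -> R -> R) (z : R -> R -> C) : Prop := WuSolution {
  wu_system : water_wave_system T F Psi Pr;
  wu_init : wu_initial_data (F^~ 0) (Psi^~ 0) (Pr^~ 0);

  wu_Psi_C1 : C1_spacetime T Psi;
  wu_Psi_cont : cont_on (Pbar `*` `[0, T]) (uncurry Psi);
  wu_invPsi_cont : cont_on (Pbar `*` `[0, T])
    (uncurry (extt (fun w t => (dz (Psi^~ t) w)^-1)));
  wu_Psit_cont : cont_on (Pbar `*` `[0, T])
    (uncurry (extt (fun w t => dt T Psi w t / dz (Psi^~ t) w)));
  wu_F_bounded : bounded_on (Pbar `*` `[0, T]) (uncurry F);
  wu_F_cont : cont_on (Pbar `*` `[0, T]) (uncurry F);
  wu_F_C1 : C1_spacetime T F;
  wu_Pr_cont : cont_on (Pbar `*` `[0, T]) (uncurry Pr);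
  wu_Pr_C1 : C1_spacetime T (toC Pr);
  wu_energy : forall t, t \in `[0, T] -> (energy F Psi t < +oo)%E;
  wu_lower : forall t, t \in `[0, T] -> (lower_norm F Psi t < +oo)%E;

  wu_approx : forall e : R, 0 < e <= 1 ->
    wu_smooth_solution T (Fe e) (Psie e) (Pre e) (he e);
  wu_approx_init : forall (e : R) w, 0 < e <= 1 -> Pbar w ->
    Fe e w 0 = F (w - e%:C * 'i%C) 0 /\ Psie e w 0 = Psi (w - e%:C * 'i%C) 0;

  wu_bounds : forall e : R, 0 < e <= 1 ->
    wu_uniform_bounds T (Fe e) (Psie e) (he e) K
      (fine (lower_norm F Psi 0)) (fine (energy F Psi 0));

  wu_eps : (forall j, 0 < eps j <= 1) /\ eps @ \oo --> 0;
  wu_h_cont : cont_on (setT `*` `[0, T]) (uncurry h);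
  wu_h_homeo : forall t, t \in `[0, T] ->
    [/\ bijective (h^~ t), continuous (h^~ t) & continuous ((hinv h)^~ t)];
  wu_h0 : forall a, h a 0 = a;
  wu_h_cvg : cvg_loc_unif (setT `*` `[0, T])
    (fun j => uncurry (he (eps j))) (uncurry h);
  wu_hinv_cvg : cvg_loc_unif (setT `*` `[0, T])
    (fun j => uncurry (hinv (he (eps j)))) (uncurry (hinv h));
  wu_h_bilip : forall a b t, t \in `[0, T] -> a != b ->
    c1 K (fine (energy F Psi 0)) <= (h a t - h b t) / (a - b)
      <= c2 K (fine (energy F Psi 0));

  wu_z_cont : cont_on (setT `*` `[0, T]) (uncurry z);
  wu_z_C2 : forall a t, t \in `[0, T] ->
    derivable_on `[0, T] (z a) t /\ derivable_on `[0, T] (dt T z a) t;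
  wu_zt_cont : cont_on (setT `*` `[0, T]) (uncurry (dt T z));
  wu_ztt_cont : cont_on (setT `*` `[0, T]) (uncurry (dt T (dt T z)));
  wu_zt_bounded : bounded_on (setT `*` `[0, T]) (uncurry (dt T z));
  wu_ztt_bounded : bounded_on (setT `*` `[0, T]) (uncurry (dt T (dt T z)));

  wu_z_cvg :
    let ze j := comph (trace (Psie (eps j))) (he (eps j)) in
    [/\ cvg_loc_unif (setT `*` `[0, T]) (fun j => uncurry (ze j)) (uncurry z),
        cvg_loc_unif (setT `*` `[0, T])
          (fun j => uncurry (dt T (ze j))) (uncurry (dt T z)) &
        cvg_loc_unif (setT `*` `[0, T])
          (fun j => uncurry (dt T (dt T (ze j)))) (uncurry (dt T (dt T z)))];
  wu_Z_cvg :
    let ze j := comph (trace (Psie (eps j))) (he (eps j)) in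
    [/\ cvg_loc_unif (setT `*` `[0, T])
          (fun j => uncurry (trace (Psie (eps j)))) (uncurry (comph z (hinv h))),
        cvg_loc_unif (setT `*` `[0, T])
          (fun j => uncurry (conj_trace (Fe (eps j))))
          (uncurry (comph (dt T z) (hinv h))) &
        cvg_loc_unif (setT `*` `[0, T])
          (fun j => uncurry (comph (dt T (dt T (ze j))) (hinv (he (eps j)))))
          (uncurry (comph (dt T (dt T z)) (hinv h)))];
  wu_Z_trace : forall a t, t \in `[0, T] ->
    comph z (hinv h) a t = trace Psi a t /\
    conjc (comph (dt T z) (hinv h) a t) = trace F a t;

  wu_closed_cvg :
    cvg_loc_unif (Pbar `*` `[0, T])
      (fun j => uncurry (Psie (eps j))) (uncurry Psi) /\
    cvg_loc_unif (Pbar `*` `[0, T])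
      (fun j => uncurry (extt (fun w t => (dz ((Psie (eps j))^~ t) w)^-1)))
      (uncurry (extt (fun w t => (dz (Psi^~ t) w)^-1))) /\
    cvg_loc_unif (Pbar `*` `[0, T])
      (fun j => uncurry (extt (fun w t =>
         dt T (Psie (eps j)) w t / dz ((Psie (eps j))^~ t) w)))
      (uncurry (extt (fun w t => dt T Psi w t / dz (Psi^~ t) w))) /\
    cvg_loc_unif (Pbar `*` `[0, T])
      (fun j => uncurry (Fe (eps j))) (uncurry F) /\
    cvg_loc_unif (Pbar `*` `[0, T])
      (fun j => uncurry (Pre (eps j))) (uncurry Pr);
  wu_open_cvg :
    cvg_loc_unif (P_ `*` `[0, T])
      (fun j => uncurry (dt T (Psie (eps j)))) (uncurry (dt T Psi)) /\
    cvg_loc_unif (P_ `*` `[0, T])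
      (fun j => uncurry (fun w t => dz ((Psie (eps j))^~ t) w))
      (uncurry (fun w t => dz (Psi^~ t) w)) /\
    cvg_loc_unif (P_ `*` `[0, T])
      (fun j => uncurry (fun w t => dz ((Fe (eps j))^~ t) w))
      (uncurry (fun w t => dz (F^~ t) w)) /\
    cvg_loc_unif (P_ `*` `[0, T])
      (fun j => uncurry (dt T (Fe (eps j)))) (uncurry (dt T F)) /\
    cvg_loc_unif (P_ `*` `[0, T])
      (fun j => uncurry (fun w t => gradm ((toC (Pre (eps j)))^~ t) w))
      (uncurry (fun w t => gradm ((toC Pr)^~ t) w));
  wu_pressure : pressure_formula T F Pr (comph (dt T z) (hinv h)) }.

Definition singular_set (Psi : C -> R -> C) (t : R) : set R :=
  [set a | ext (fun w => (dz (Psi^~ t) w)^-1) a%:C = 0].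

End Water_waves.

(* Main.v *)
Require Import Defs.
From mathcomp Require Import all_boot all_order all_algebra.
From mathcomp Require Import complex ring lra.
From mathcomp Require Import all_classical all_reals all_analysis.
From mathcomp Require Import measurable_realfun.

Import Order.TTheory GRing.Theory Num.Theory.
Import numFieldNormedType.Exports.
Local Open Scope classical_set_scope.
Local Open Scope ring_scope.

(* Fix t and let f be the trace of F(., t) on the real line.  Since F is the Poisson
   integral of f, the pressure formula reads P(x - ib) = b + V(x, b) / 2, where V is
   the variance of f under the Poisson measure of x - ib.  The gradient of V is the
   integral of |f - mean|^2 against the gradient of the Poisson kernel, which is at
   most (1/pi) times the integral of |f(x) - f(s)|^2 / (x - s)^2.  The latter is
   bounded uniformly in x: this is the bound on A_1, which passes to the limit
   epsilon -> 0 by Fatou's lemma.  Hence the gradient of P is bounded, and at a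
   singular boundary point both members of the identity vanish, because 1/Psi_z'
   does and A_1 is bounded.  Near a nonsingular point a, |Z^e_{t,alpha'}| is at most
   C |Z^e_{,alpha'}|, so the functions Z^e_t are Lipschitz uniformly in e.  By
   dominated convergence A_1^e(a) tends to A_1(a), and the gradient
   (d_x' - i d_y') P tends to i A_1(a) at a; the identity at a is then the limit of
   the identity for the approximations. *)

(** * Integrals over the real line *)

(** Each derivative of the Poisson kernel has integral 0 but may be as large as 1/b times the
    kernel, so near the boundary it matters about which value of f the square is taken. For the
    limit at a nonsingular point, replacing the mean m by f(x) costs 2 |m - f(x)| times the modulus
    of the integral of k (f - f(x)), k being the derivative kernel. This is at most 2 kappa^2 / b,
    where kappa is the Poisson average of |f - f(x)|. For bounded f, Lipschitz near x, kappa =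
    o(sqrt b), which is just enough; the inequality of arithmetic and geometric means gives it
    without logarithmic integrals. The Poisson representation comes from shrinking the real line to
    the point x - ib through hyperbolic circles, along which the Poisson average of F stays
    constant. Two features of the a priori bounds shape the rest. The bound on A_1 is an essential
    supremum and has to be carried to every single point. The bounds on z_alpha and z_{t alpha} are
    in Lagrangian variables, so every point near a has first to be reached by the flow h^e, for all
    small e at once. *)

Section RealIntegrals.
Set Implicit Arguments.
Unset Strict Implicit.
Context {R : realType}.
Local Notation mu := (@lebesgue_measure R).
Implicit Types (f g : R -> R) (x s a b D : R).

Local Notation I g := (\int[mu]_s (g s)).

Definition integrableR g := mu.-integrable setT (EFin \o g).

Lemma measurable_EFinR g : measurable_fun [set: R] g ->
  measurable_fun (T := measurableTypeR R) setT (EFin \o g).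
Proof. by move=> mg; have := proj2 (measurable_EFinP _ _) mg; exact. Qed.

Lemma integrableR_measurable g : integrableR g -> measurable_fun [set: R] g.
Proof.
move=> /integrableP[mg _]; have := proj1 (measurable_EFinP _ _) mg; exact.
Qed.

Lemma integrableR_fin g : integrableR g -> (\int[mu]_s (g s)%:E)%E = (I g)%:E.
Proof. by move=> ig; rewrite fineK//; exact: integrable_fin_num. Qed.

Lemma integrableRZ k g : integrableR g -> integrableR (fun s => k * g s).
Proof. by move=> ig; exact: (integrableZl measurableT k ig). Qed.

Lemma integrableRD f g : integrableR f -> integrableR g -> integrableR (fun s => f s + g s).
Proof. by move=> ig iff; exact: (integrableD measurableT ig iff). Qed.

Lemma integrableRB f g : integrableR f -> integrableR g -> integrableR (fun s => f s - g s).
Proof. by move=> ig iff; exact: (integrableB measurableT ig iff). Qed.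

Lemma RintegralRZ k g : integrableR g -> I (fun s => k * g s) = k * I g.
Proof. by move=> ig; exact: (RintegralZl _ measurableT ig). Qed.

Lemma RintegralRD f g : integrableR f -> integrableR g ->
  I (fun s => f s + g s) = I f + I g.
Proof. by move=> ig iff; exact: (RintegralD measurableT ig iff). Qed.

Lemma RintegralRB f g : integrableR f -> integrableR g ->
  I (fun s => f s - g s) = I f - I g.
Proof. by move=> ig iff; exact: (RintegralB measurableT ig iff). Qed.

Lemma le_RintegralR f g : integrableR f -> integrableR g ->
  (forall s, f s <= g s) -> I f <= I g.
Proof. by move=> ig iff fg; apply: (le_Rintegral measurableT ig iff) => s _. Qed.

Lemma integrableR_le f g : measurable_fun [set: R] f ->
  (forall s, `|f s| <= `|g s|) -> integrableR g -> integrableR f.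
Proof.
move=> mf fg ig.
by apply: (@le_integrable _ _ _ mu setT measurableT (EFin \o f) (EFin \o g)
  (measurable_EFinR mf) _ ig) => s _ /=; rewrite lee_fin.
Qed.

Lemma integrableR_norm f : integrableR f -> integrableR (fun s => `|f s|).
Proof.
move=> ig; apply: (@integrableR_le _ f) => // [|s]; last by rewrite normr_id.
exact: measurableT_comp (integrableR_measurable ig).
Qed.

Lemma norm_RintegralR_le f g : integrableR f -> integrableR g ->
  (forall s, `|f s| <= g s) -> `|I f| <= I g.
Proof.
move=> ig iff fg; apply: le_trans (le_normr_Rintegral measurableT ig) _.
by apply: le_RintegralR => //; exact: integrableR_norm.
Qed.

(** The Poisson kernel of x - ib without its factor b / pi. Multiples of it are the dominating
    functions for limits and derivatives under the integral. *)
Definition cauchyw x b s : R := (b ^+ 2 + (x - s) ^+ 2)^-1.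

Lemma cvg_sqr (T : Type) (F : set_system T) (FF : Filter F) (f : T -> R) (l : R) :
  f @ F --> l -> (fun t => f t ^+ 2) @ F --> l ^+ 2.
Proof. by move=> fl; rewrite expr2; under eq_fun do rewrite expr2; exact: cvgM. Qed.

Lemma cauchyw_den x b s : 0 < b -> 0 < b ^+ 2 + (x - s) ^+ 2.
Proof. by move=> b0; rewrite ltr_wpDr ?sqr_ge0// exprn_gt0. Qed.

Lemma cauchyw_gt0 x b s : 0 < b -> 0 < cauchyw x b s.
Proof. by move=> b0; rewrite invr_gt0 cauchyw_den. Qed.

Lemma continuous_cauchyw x b : 0 < b -> continuous (cauchyw x b).
Proof.
move=> b0 s; apply: cvgV; first by rewrite gt_eqF// cauchyw_den.
apply: cvgD; first exact: cvg_cst.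
rewrite expr2; under eq_fun do rewrite expr2.
by apply: cvgM; (apply: cvgB; [exact: cvg_cst|exact: cvg_id]).
Qed.

Lemma integral_oneDsqrV : (\int[mu]_s ((1 + s ^+ 2)^-1)%:E = pi%:E)%E.
Proof.
rewrite (ge0_symfun_integralT (f := fun s : R => (1 + s ^+ 2)^-1)).
- rewrite -set_itvcy; have /= -> := @integral0y_oneDsqr R.
  by rewrite -EFinM mulrC divfK.
- by move=> s; rewrite invr_ge0 addr_ge0 ?sqr_ge0.
- exact: (@continuous_oneDsqrV R).
- by move=> s /=; rewrite sqrrN.
Qed.

Lemma integral_cauchyw x b : 0 < b -> (\int[mu]_s (cauchyw x b s)%:E = (pi / b)%:E)%E.
Proof.
move=> b0; pose F := fun s : R => (s - x) / b.
have dF s : is_derive s 1 F b^-1.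
  rewrite /F; apply: is_derive_eq; rewrite subr0 /GRing.scale/=; ring.
have F' : derive1 F = cst b^-1 by apply/funext => s; rewrite derive1E derive_val.
have bi0 : 0 < b^-1 by rewrite invr_gt0.
have := @increasing_ge0_integration_by_substitutionT R F
  (fun s => b^-1 * (1 + s ^+ 2)^-1).
rewrite F'.
have -> : (\int[mu]_s (b^-1 * (1 + s ^+ 2)^-1)%:E = (pi / b)%:E)%E.
  under eq_integral do rewrite EFinM.
  rewrite (@ge0_integralZl _ _ _ mu setT measurableT
    (EFin \o (fun s => (1 + s ^+ 2)^-1))).
  - by have /= -> := integral_oneDsqrV; rewrite -EFinM mulrC.
  - exact: measurable_EFinR (continuous_measurable_fun (@continuous_oneDsqrV R)).
  - by move=> s _ /=; rewrite lee_fin invr_ge0 addr_ge0 ?sqr_ge0.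
  - by rewrite lee_fin ltW.
move=> ->.
- apply: eq_integral => s _; congr EFin; rewrite /cauchyw /F /=.
  rewrite !fctE /=.
  by field; rewrite !gt_eqF ?cauchyw_den.
- by move=> u v uv; rewrite /F ltr_pM2r// ltrD2r.
- by move=> s; exact: cvg_cst.
- exact: is_cvg_cst.
- exact: is_cvg_cst.
- by move=> s; apply: ex_derive.
- apply/cvgrNyPle => A; near=> s.
  rewrite /F ler_pdivrMr// lerBlDr; near: s; apply: nbhs_ninfty_le; exact: num_real.
- apply/cvgryPge => A; near=> s.
  rewrite /F ler_pdivlMr// lerBrDr; near: s; apply: nbhs_pinfty_ge; exact: num_real.
- move=> s; apply: cvgM; [exact: cvg_cst|exact: (@continuous_oneDsqrV R)].
- by move=> s; rewrite mulr_ge0 ?ltW// invr_gt0 ltr_pwDl ?sqr_ge0.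
Unshelve. all: by end_near. Qed.

Lemma integrable_cauchyw x b : 0 < b -> integrableR (cauchyw x b).
Proof.
move=> b0; apply/integrableP; split.
  exact: measurable_EFinR (continuous_measurable_fun (continuous_cauchyw b0)).
under eq_integral do rewrite /= ger0_norm ?ltW ?cauchyw_gt0//.
by rewrite integral_cauchyw// ltry.
Qed.

Lemma Rintegral_cauchyw x b : 0 < b -> I (cauchyw x b) = pi / b.
Proof. by move=> b0; rewrite /Rintegral integral_cauchyw. Qed.

Lemma integrable_dominated g x b D : 0 < b -> measurable_fun setT g ->
  (forall s, `|g s| <= D * cauchyw x b s) -> integrableR g.
Proof.
move=> b0 mg gD; apply: (integrableR_le (g := fun s => D * cauchyw x b s)) => //.
  by move=> s; rewrite (le_trans (gD s))// ler_norm.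
exact/integrableRZ/integrable_cauchyw.
Qed.

Lemma ae_neq x0 : \forall s \ae mu, s != x0.
Proof.
exists [set x0]; split; [exact: measurable_set1|exact: lebesgue_measure_set1|].
by move=> s /= /negP; rewrite negbK => /eqP.
Qed.

(** Convergence may fail at [x0]: the limits of interest contain (x0 - s)^-2, which is singular
    there. *)
Lemma dominated_cvgR (g_ : nat -> R -> R) g x b D x0 : 0 < b ->
  (forall n, measurable_fun setT (g_ n)) -> measurable_fun setT g ->
  (forall s, s != x0 -> g_ ^~ s @ \oo --> g s) ->
  (forall n s, `|g_ n s| <= D * cauchyw x b s) ->
  (fun n => I (g_ n)) @ \oo --> I g.
Proof.
move=> b0 mg_ mg gs gD.
have iD : mu.-integrable setT (EFin \o (fun s => D * cauchyw x b s)).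
  exact/integrableRZ/integrable_cauchyw.
have aegs : \forall s \ae mu, setT s -> (EFin \o g_ n) s @[n --> \oo] --> (EFin \o g) s.
  have [N [mN N0 neqN]] := ae_neq x0.
  exists N; split => // s /= nd; apply: neqN => /= /gs gss; apply: nd => _.
  by apply: cvg_EFin; [exact: nearW|exact: gss].
have aegD : \forall s \ae mu, forall n, setT s ->
    (`|(EFin \o g_ n) s| <= (D * cauchyw x b s)%:E)%E.
  by apply: nearW => s n _; rewrite /= lee_fin.
have [ig _ cI] := @dominated_convergence _ _ R mu setT measurableT
  (fun n => EFin \o g_ n) (EFin \o g) (EFin \o (fun s => D * cauchyw x b s))
  (fun n => proj2 (measurable_EFinP _ _) (mg_ n)) (measurable_EFinR mg)
  aegs iD aegD.
apply/fine_cvg; rewrite fineK; last exact: integrable_fin_num.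
exact: cI.
Qed.

(** The inverse is the pointwise limit of g / (1/(n+1) + g^2), a continuous function of g. At a zero
    of g these are all 0, in agreement with 0^-1 = 0. *)
Lemma measurable_funVr g : measurable_fun setT g -> measurable_fun setT (fun s => (g s)^-1).
Proof.
move=> mg; apply: (measurable_fun_cvg (h := fun n s => g s * (n.+1%:R^-1 + g s ^+ 2)^-1)).
  move=> n; apply: measurable_funM => //.
  have -> : (fun s => (n.+1%:R^-1 + g s ^+ 2)^-1) = (fun r : R => (n.+1%:R^-1 + r ^+ 2)^-1) \o g by [].
  apply: (measurableT_comp _ mg); apply: continuous_measurable_fun => r.
  apply: cvgV; first by rewrite gt_eqF// ltr_pwDl ?sqr_ge0.
  by apply: cvgD; [exact: cvg_cst|exact: exprn_continuous].
move=> s _; have [->|g0] := eqVneq (g s) 0.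
  by under eq_fun do rewrite mul0r; rewrite invr0; exact: cvg_cst.
have -> : (g s)^-1 = g s * (0 + g s ^+ 2)^-1 by rewrite add0r expr2 invfM mulrA divff// mul1r.
apply: cvgM; first exact: cvg_cst.
apply: cvgV; first by rewrite add0r expf_neq0.
by apply: cvgD; [exact: cvg_harmonic|exact: cvg_cst].
Qed.

(** The fundamental theorem of calculus on [x - (n+1), x + (n+1)], followed by dominated convergence
    for the integrands cut off by indicators. *)
Lemma Rintegral_derive_eq0 (G g : R -> R) x b D : 0 < b ->
  (forall s, is_derive s 1 G (g s)) -> continuous g ->
  (forall s, `|g s| <= D * cauchyw x b s) ->
  (fun n => G (x + n.+1%:R) - G (x - n.+1%:R)) @ \oo --> 0 -> I g = 0.
Proof.
move=> b0 dG cg gD G0.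
have mg := continuous_measurable_fun cg.
pose g_ n s := g s * \1_(`[x - n.+1%:R, x + n.+1%:R]) s.
have gg : (fun n => I (g_ n)) @ \oo --> I g.
  apply: (dominated_cvgR (x := x) (b := b) (D := D) (x0 := 0)) => //.
  - by move=> n; apply: measurable_funM => //; exact: measurable_indic.
  - move=> s _; rewrite -[X in _ --> X]mulr1; apply: cvgM; first exact: cvg_cst.
    apply: cvg_near_cst; near=> n; rewrite indicE mem_set//=.
    rewrite in_itv/= -ler_distlC distrC; apply: (@le_trans _ _ n%:R).
      by near: n; exact: nbhs_infty_ger.
    by rewrite ler_nat.
  - move=> n s; rewrite /g_ indicE normrM; apply: le_trans (gD s).
    by rewrite ler_piMr//; case: (_ \in _); rewrite ?normr0 ?normr1.
apply: (cvg_unique _ gg) => //.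
suff -> : (fun n => I (g_ n)) = (fun n => G (x + n.+1%:R) - G (x - n.+1%:R)) by [].
apply/funext => n; rewrite /g_.
transitivity (\int[mu]_(s in `[x - n.+1%:R, x + n.+1%:R]) g s).
  rewrite [RHS]Rintegral_mkcond; apply: eq_Rintegral => s _.
  by rewrite patchE indicE; case: (_ \in _); rewrite ?mulr1 ?mulr0.
rewrite /Rintegral (@continuous_FTC2 _ _ G)//.
- by rewrite ltrD2l -subr_gt0 opprK addr_gt0.
- exact: continuous_subspaceT.
- have dG' s : derivable G s 1 by case: (dG s).
  have cG : continuous G by move=> s; exact/differentiable_continuous/derivable1_diffP.
  split; first by move=> s _; exact: dG'.
    exact: (cvg_at_right_filter (cG _)).
  exact: (cvg_at_left_filter (cG _)).
- by move=> s _; rewrite derive1E; case: (dG s).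
Unshelve. all: by end_near. Qed.

End RealIntegrals.

(** * The Poisson kernel *)

Section Poisson.
Set Implicit Arguments.
Unset Strict Implicit.
Context {R : realType}.
Local Notation mu := (@lebesgue_measure R).
Local Notation I g := (\int[mu]_s (g s)).
Implicit Types (u f g : R -> R) (x s a b D M : R).

(** [pk x b s] is [poisson (- b) (x - s)], with the depth b > 0 as parameter; [kx] and [kb] are its
    derivatives in x and in b. *)
Definition pk x b s : R := b / pi * cauchyw x b s.
Definition kx x b s : R := 2 * b * (s - x) / pi * cauchyw x b s ^+ 2.
Definition kb x b s : R := ((x - s) ^+ 2 - b ^+ 2) / pi * cauchyw x b s ^+ 2.

Lemma pi_neq0 : (pi : R) != 0. Proof. by rewrite gt_eqF// pi_gt0. Qed.

Lemma is_derive_pk_x x b s : 0 < b -> is_derive x 1 (fun x' => pk x' b s) (kx x b s).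
Proof.
move=> b0; have d0 : b ^+ 2 + (x - s) ^+ 2 != 0 by rewrite gt_eqF// cauchyw_den.
rewrite /pk /cauchyw.
have dd : is_derive x 1 (fun x' => b ^+ 2 + (x' - s) ^+ 2) (2 * (x - s)).
  apply: is_derive_eq; rewrite /GRing.scale/=; ring.
have dv := is_deriveV (f := fun x' => b ^+ 2 + (x' - s) ^+ 2) d0 dd.
apply: is_derive_eq; rewrite /kx /cauchyw /GRing.scale/=.
move: pi_neq0; generalize (pi : R) => p p0; field.
by rewrite d0 p0.
Qed.

Lemma is_derive_pk_b x b s : 0 < b -> is_derive b 1 (fun b' => pk x b' s) (kb x b s).
Proof.
move=> b0; have d0 : b ^+ 2 + (x - s) ^+ 2 != 0 by rewrite gt_eqF// cauchyw_den.
rewrite /pk /cauchyw.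
have dd : is_derive b 1 (fun b' => b' ^+ 2 + (x - s) ^+ 2) (2 * b).
  apply: is_derive_eq; rewrite /GRing.scale/=; ring.
have dv := is_deriveV (f := fun b' => b' ^+ 2 + (x - s) ^+ 2) d0 dd.
apply: is_derive_eq; rewrite /kb /cauchyw /GRing.scale/=.
move: pi_neq0; generalize (pi : R) => p p0; field.
by rewrite d0 p0.
Qed.

(** Lets a kernel whose centre or width varies be dominated by a fixed one. *)
Lemma cauchyw_comp x b x' b' s C : 0 < b -> 0 < b' ->
  b ^+ 2 + (x - s) ^+ 2 <= C * (b' ^+ 2 + (x' - s) ^+ 2) ->
  cauchyw x' b' s <= C * cauchyw x b s.
Proof.
move=> b0 b0' h; rewrite /cauchyw.
by rewrite ler_pdivlMr ?cauchyw_den// mulrC ler_pdivrMr ?cauchyw_den.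
Qed.

(** The numerator 2 b |s - x| is at most b^2 + (x - s)^2, which cancels one of the two factors
    [cauchyw]. The same happens for [kb], where the numerator is |(x - s)^2 - b^2|. *)
Lemma kx_le x b s : 0 < b -> `|kx x b s| <= pi^-1 * cauchyw x b s.
Proof.
move=> b0; have w0 := cauchyw_gt0 x s b0; have d0 := cauchyw_den x s b0.
rewrite /kx expr2 mulrA normrM (gtr0_norm w0) ler_pM2r//.
rewrite mulrAC normrM (gtr0_norm (_ : 0 < pi^-1)) ?invr_gt0 ?pi_gt0//.
rewrite -[leRHS]mul1r ler_pM2r ?invr_gt0 ?pi_gt0//.
rewrite normrM (gtr0_norm w0) /cauchyw ler_pdivrMr// mul1r.
have h1 := sqr_ge0 (b - (s - x)); have h2 := sqr_ge0 (b + (s - x)).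
have h3 := sqr_ge0 b; have h4 := sqr_ge0 (x - s).
rewrite ler_norml; apply/andP; split; nra.
Qed.

Lemma kb_le x b s : 0 < b -> `|kb x b s| <= pi^-1 * cauchyw x b s.
Proof.
move=> b0; have w0 := cauchyw_gt0 x s b0; have d0 := cauchyw_den x s b0.
rewrite /kb expr2 mulrA normrM (gtr0_norm w0) ler_pM2r//.
rewrite mulrAC normrM (gtr0_norm (_ : 0 < pi^-1)) ?invr_gt0 ?pi_gt0//.
rewrite -[leRHS]mul1r ler_pM2r ?invr_gt0 ?pi_gt0//.
rewrite normrM (gtr0_norm w0) /cauchyw ler_pdivrMr// mul1r.
have h1 := sqr_ge0 (b - (s - x)); have h2 := sqr_ge0 (b + (s - x)).
have h3 := sqr_ge0 b; have h4 := sqr_ge0 (x - s).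
rewrite ler_norml; apply/andP; split; nra.
Qed.

Lemma continuous_pk x b : 0 < b -> continuous (pk x b).
Proof. by move=> b0 s; apply: cvgM; [exact: cvg_cst|exact: continuous_cauchyw]. Qed.

Lemma continuous_kx x b : 0 < b -> continuous (kx x b).
Proof.
move=> b0 s; apply: cvgM; last first.
  under eq_fun do rewrite expr2; rewrite expr2.
  by apply: cvgM; exact: continuous_cauchyw.
apply: cvgM; last exact: cvg_cst.
by apply: cvgM; [exact: cvg_cst|apply: cvgB; [exact: cvg_id|exact: cvg_cst]].
Qed.

Lemma continuous_kb x b : 0 < b -> continuous (kb x b).
Proof.
move=> b0 s; apply: cvgM; last first.
  under eq_fun do rewrite expr2; rewrite expr2.
  by apply: cvgM; exact: continuous_cauchyw.
apply: cvgM; last exact: cvg_cst.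
apply: cvgB; last exact: cvg_cst.
under eq_fun do rewrite expr2; rewrite expr2.
by apply: cvgM; (apply: cvgB; [exact: cvg_cst|exact: cvg_id]).
Qed.

Lemma pk_ge0 x b s : 0 < b -> 0 <= pk x b s.
Proof. by move=> b0; rewrite mulr_ge0 ?divr_ge0 ?pi_ge0 ?ltW// cauchyw_gt0. Qed.

Lemma Rintegral_pk x b : 0 < b -> I (pk x b) = 1.
Proof.
move=> b0; rewrite /pk RintegralRZ; last exact: integrable_cauchyw.
by rewrite Rintegral_cauchyw// mulrA divfK ?pi_neq0// divff// gt_eqF.
Qed.

Lemma integrable_bounded_kernel (k u : R -> R) x b D M : 0 < b ->
  continuous k -> (forall s, `|k s| <= D * cauchyw x b s) ->
  measurable_fun [set: R] u -> (forall s, `|u s| <= M) ->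
  integrableR (fun s => k s * u s).
Proof.
move=> b0 ck kD mu uM; apply: (integrable_dominated (x := x) (b := b) (D := D * M)) => //.
  by apply: measurable_funM => //; exact: continuous_measurable_fun.
move=> s; rewrite normrM mulrAC.
by apply: ler_pM.
Qed.

Lemma integrable_pkM u x b M : 0 < b ->
  measurable_fun [set: R] u -> (forall s, `|u s| <= M) ->
  integrableR (fun s => pk x b s * u s).
Proof.
move=> b0; apply: (integrable_bounded_kernel (x := x) (b := b) (D := b / pi)) => //.
  exact: continuous_pk.
move=> s; rewrite ger0_norm ?pk_ge0//.
Qed.

Definition PI u x b : R := I (fun s => pk x b s * u s).

Lemma is_derive_under_Rintegral (k k' : R -> R -> R) a r x b D : 0 < r -> 0 < b ->
  (forall y s, `|y - a| < r -> is_derive y 1 (fun y' => k y' s) (k' y s)) ->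
  (forall y s, `|y - a| < r -> `|k' y s| <= D * cauchyw x b s) ->
  (forall y, `|y - a| < r -> integrableR (k y)) ->
  is_derive a 1 (fun y => I (k y)) (I (k' a)).
Proof.
move=> r0 b0 dk k'D ik.
have D0 s : 0 <= D * cauchyw x b s.
  by apply: le_trans (k'D a s _); rewrite ?subrr ?normr0.
have d1 y s : `|y - a| < r -> partial1of2 k y s = k' y s.
  by move=> ya; rewrite partial1of2E; have := dk y s ya => dky; rewrite derive_val.
have Ia : a \in `](a - r), (a + r)[ by rewrite in_itv/= ltrBlDr !ltrDl r0.
have inI y : `](a - r), (a + r)[%classic y -> `|y - a| < r.
  by rewrite /= in_itv/= ltr_distlC => /andP[? ?]; apply/andP; split; lra.
have ra : `|a - a| < r by rewrite subrr normr0.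
have intG : integrableR (fun s => D * cauchyw x b s).
  exact/integrableRZ/integrable_cauchyw.
have cv := @cvg_differentiation_under_integral R _ _ mu k
  setT measurableT a (a - r) (a + r) Ia (fun y yI => ik y (inI y yI))
  (fun y s yI _ => @ex_derive _ _ _ _ _ _ _ (dk y s (inI y yI)))
  (fun s => D * cauchyw x b s) D0 intG _.
have {}cv : h^-1 *: (I (k (h + a)) - I (k a)) @[h --> 0^'] --> I (k' a).
  rewrite (_ : k' a = (fun s => partial1of2 k a s)).
    by apply: cv => y s yI _; rewrite d1 ?k'D ?inI//; exact: inI.
  by apply/funext => s; rewrite d1.
have dd : derivable (fun y => I (k y)) a 1.
  apply/cvg_ex; eexists; under eq_fun do rewrite scaler1.
  exact: cv.
apply: DeriveDef => //.
by apply: cvg_lim => //; under eq_fun do rewrite scaler1.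
Qed.

Lemma is_derive_PI_x u x b M : 0 < b ->
  measurable_fun [set: R] u -> (forall s, `|u s| <= M) ->
  is_derive x 1 (fun x' => PI u x' b) (I (fun s => kx x b s * u s)).
Proof.
move=> b0 mu_ uM.
have M0 : 0 <= M by apply: le_trans (uM 0).
(* The factor 3: if |y - x| < b then (x - s)^2 <= 2 b^2 + 2 (y - s)^2, so b^2 + (x - s)^2 <= 3 (b^2
   + (y - s)^2). *)
apply: (@is_derive_under_Rintegral (fun x' s => pk x' b s * u s)
  (fun x' s => kx x' b s * u s) x b x b (pi^-1 * 3 * M) b0 b0).
- move=> y s _; have := is_derive_pk_x y s b0 => dk; apply: is_derive_eq.
  by rewrite /GRing.scale/=; ring.
- move=> y s yb; rewrite normrM mulrAC; apply: ler_pM => //.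
  apply: le_trans (kx_le _ _ b0) _; rewrite -mulrA ler_pM2l ?invr_gt0 ?pi_gt0//.
  apply: cauchyw_comp => //.
  move: yb; rewrite ltr_norml => /andP[? ?].
  have h1 : 0 <= (b - (y - x)) * (b + (y - x)) by apply: mulr_ge0; lra.
  have h2 := sqr_ge0 ((x - y) - (y - s)); nra.
- by move=> y _; exact: (integrable_pkM _ b0 mu_ uM).
Qed.

Lemma is_derive_PI_b u x b M : 0 < b ->
  measurable_fun [set: R] u -> (forall s, `|u s| <= M) ->
  is_derive b 1 (fun b' => PI u x b') (I (fun s => kb x b s * u s)).
Proof.
move=> b0 mu_ uM.
have M0 : 0 <= M by apply: le_trans (uM 0).
have inb y : `|y - b| < b / 2 -> b / 2 < y.
  by rewrite ltr_norml => /andP[? ?]; lra.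
have inb0 y : `|y - b| < b / 2 -> 0 < y.
  by move=> /inb; apply: lt_trans; rewrite divr_gt0.
have b20 : 0 < b / 2 by rewrite divr_gt0.
(* The factor 4: the new depth y exceeds b / 2, so b^2 <= 4 y^2. *)
apply: (@is_derive_under_Rintegral (fun b' s => pk x b' s * u s)
  (fun b' s => kb x b' s * u s) b (b / 2) x b (pi^-1 * 4 * M) b20 b0).
- move=> y s /inb0 y0; have := is_derive_pk_b x s y0 => dk; apply: is_derive_eq.
  by rewrite /GRing.scale/=; ring.
- move=> y s yb; rewrite normrM mulrAC; apply: ler_pM => //.
  have y0 := inb0 _ yb; have {}yb := inb _ yb.
  apply: le_trans (kb_le _ _ y0) _; rewrite -mulrA ler_pM2l ?invr_gt0 ?pi_gt0//.
  apply: cauchyw_comp => //.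
  have := sqr_ge0 (x - s); nra.
- by move=> y /inb0 y0; exact: (integrable_pkM _ y0 mu_ uM).
Qed.

(* the variance of u under the Poisson measure *)
Definition pvar u x b : R := PI (fun s => u s ^+ 2) x b - PI u x b ^+ 2.

Lemma PI_cst c x b : 0 < b -> PI (cst c) x b = c.
Proof.
move=> b0; rewrite /PI -[RHS]mulr1 -(Rintegral_pk x b0) -RintegralRZ.
  by apply: eq_Rintegral => s _; rewrite mulrC.
exact/integrableRZ/integrable_cauchyw.
Qed.

(** The total mass of the Poisson kernel is the constant 1; its derivative in x vanishes. *)
Lemma Rintegral_kx x b : 0 < b -> I (kx x b) = 0.
Proof.
move=> b0; have h : is_derive x 1 (fun x' => PI (cst 1) x' b) (I (fun s => kx x b s * 1)).
  by apply: (@is_derive_PI_x (cst 1) x b 1) => // s; rewrite normr1.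
have e : (fun x' => PI (cst 1) x' b) = cst 1 by apply/funext => y; exact: PI_cst.
rewrite e in h; have := derive_val (is_derive := h); rewrite derive_cst => h1.
by rewrite [RHS]h1; apply: eq_Rintegral => s _; rewrite mulr1.
Qed.

Lemma Rintegral_kb x b : 0 < b -> I (kb x b) = 0.
Proof.
move=> b0; have h : is_derive b 1 (fun b' => PI (cst 1) x b') (I (fun s => kb x b s * 1)).
  by apply: (@is_derive_PI_b (cst 1) x b 1) => // s; rewrite normr1.
have e : \forall b' \near b, PI (cst 1) x b' = cst 1 b'.
  by near=> b'; apply: PI_cst; near: b'; exact: lt_nbhsr.
have := derive_val (is_derive := h); rewrite (near_eq_derive _ e)// derive_cst => h1.
by rewrite [RHS]h1; apply: eq_Rintegral => s _; rewrite mulr1.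
Unshelve. all: by end_near. Qed.

Lemma sq_le u M s : (forall s, `|u s| <= M) -> `|u s ^+ 2| <= M ^+ 2.
Proof.
by move=> uM; rewrite normrX lerXn2r ?nnegrE//; apply: le_trans (uM 0).
Qed.

Lemma measurable_sqB u c : measurable_fun [set: R] u ->
  measurable_fun [set: R] (fun s => (u s - c) ^+ 2).
Proof. by move=> mu_; apply: measurable_funX; exact: measurable_funB. Qed.

Lemma sqB_le u c M s : (forall s, `|u s| <= M) -> `|(u s - c) ^+ 2| <= (M + `|c|) ^+ 2.
Proof.
move=> uM; rewrite normrX lerXn2r ?nnegrE ?addr_ge0 ?(le_trans _ (uM 0))//.
by rewrite (le_trans (ler_normB _ _))// lerD2r.
Qed.

Lemma kernel_sqB (k u : R -> R) x b M c D : 0 < b -> continuous k ->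
  (forall s, `|k s| <= D * cauchyw x b s) ->
  measurable_fun [set: R] u -> (forall s, `|u s| <= M) ->
  I (fun s => k s * (u s - c) ^+ 2) =
  I (fun s => k s * u s ^+ 2) - 2 * c * I (fun s => k s * u s) + c ^+ 2 * I k.
Proof.
move=> b0 ck kD mu_ uM.
have i2 : integrableR (fun s => k s * u s ^+ 2).
  apply: (integrable_bounded_kernel b0 ck kD (M := M ^+ 2)).
    exact: measurable_funX.
  by move=> s; exact: sq_le.
have i1 : integrableR (fun s => k s * u s).
  exact: (integrable_bounded_kernel b0 ck kD mu_ uM).
have i0 : integrableR k.
  by apply: (integrable_dominated b0 (continuous_measurable_fun ck) kD).
rewrite -!RintegralRZ// -RintegralRB//; last exact: integrableRZ.
rewrite -RintegralRD//; [|apply: integrableRB => //|]; try exact: integrableRZ.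
by apply: eq_Rintegral => s _; ring.
Qed.

(** With m the mean, the derivative of the variance is the integral of k u^2 minus 2 m times the
    integral of k u. Since k integrates to 0, the term m^2 k may be added for free and completes the
    square. *)
Lemma is_derive_pvar_x u x b M : 0 < b ->
  measurable_fun [set: R] u -> (forall s, `|u s| <= M) ->
  is_derive x 1 (fun x' => pvar u x' b)
    (I (fun s => kx x b s * (u s - PI u x b) ^+ 2)).
Proof.
move=> b0 mu_ uM.
have mu2 : measurable_fun [set: R] (fun s => u s ^+ 2) by exact: measurable_funX.
have u2M s : `|u s ^+ 2| <= M ^+ 2.
  exact: sq_le.
have d2 := is_derive_PI_x x b0 mu2 u2M.
have d1 := is_derive_PI_x x b0 mu_ uM.
rewrite /pvar; apply: is_derive_eq.
rewrite (kernel_sqB _ b0 (continuous_kx b0) (fun s => kx_le x s b0) mu_ uM).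
by rewrite Rintegral_kx// mulr0 addr0 /GRing.scale/=; ring.
Qed.

Lemma is_derive_pvar_b u x b M : 0 < b ->
  measurable_fun [set: R] u -> (forall s, `|u s| <= M) ->
  is_derive b 1 (fun b' => pvar u x b')
    (I (fun s => kb x b s * (u s - PI u x b) ^+ 2)).
Proof.
move=> b0 mu_ uM.
have mu2 : measurable_fun [set: R] (fun s => u s ^+ 2) by exact: measurable_funX.
have u2M s : `|u s ^+ 2| <= M ^+ 2.
  exact: sq_le.
have d2 := is_derive_PI_b x b0 mu2 u2M.
have d1 := is_derive_PI_b x b0 mu_ uM.
rewrite /pvar; apply: is_derive_eq.
rewrite (kernel_sqB _ b0 (continuous_kb b0) (fun s => kb_le x s b0) mu_ uM).
by rewrite Rintegral_kb// mulr0 addr0 /GRing.scale/=; ring.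
Qed.

Lemma pk_le x b s : 0 < b -> `|pk x b s| <= b / pi * cauchyw x b s.
Proof. by move=> b0; rewrite ger0_norm ?pk_ge0. Qed.

(** Steiner's identity: the second moment about c is the variance plus the squared distance of c
    from the mean, hence it is smallest at the mean. *)
Lemma PI_sqB u x b M c : 0 < b -> measurable_fun [set: R] u -> (forall s, `|u s| <= M) ->
  PI (fun s => (u s - c) ^+ 2) x b = pvar u x b + (PI u x b - c) ^+ 2.
Proof.
move=> b0 mu_ uM.
rewrite /PI (kernel_sqB _ b0 (continuous_pk b0) (fun s => pk_le x s b0) mu_ uM).
by rewrite Rintegral_pk// /pvar /PI; ring.
Qed.

Lemma pk_cauchyw x b s : 0 < b -> pi^-1 * cauchyw x b s = b^-1 * pk x b s.
Proof. by move=> b0; rewrite /pk !mulrA mulVf ?gt_eqF// mul1r. Qed.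

(* The variance is smallest about the mean, so it may be replaced by the second
   moment about [u x], on which the Poisson kernel is dominated by [(x - s)^-2]. *)
Lemma kernel_pvar_le (k u : R -> R) x b M : 0 < b -> continuous k ->
  (forall s, `|k s| <= pi^-1 * cauchyw x b s) ->
  measurable_fun [set: R] u -> (forall s, `|u s| <= M) ->
  integrableR (fun s => (u x - u s) ^+ 2 / (x - s) ^+ 2) ->
  `|I (fun s => k s * (u s - PI u x b) ^+ 2)| <=
  pi^-1 * I (fun s => (u x - u s) ^+ 2 / (x - s) ^+ 2).
Proof.
move=> b0 ck kD mu_ uM iu.
have mc c : measurable_fun [set: R] (fun s => (u s - c) ^+ 2) by exact: measurable_sqB.
have cM c s : `|(u s - c) ^+ 2| <= (M + `|c|) ^+ 2 by exact: sqB_le.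
have ip c : integrableR (fun s => pk x b s * (u s - c) ^+ 2).
  exact: (integrable_pkM _ b0 (mc c) (cM c)).
apply: (@le_trans _ _ (b^-1 * PI (fun s => (u s - PI u x b) ^+ 2) x b)).
  rewrite /PI -RintegralRZ//; apply: norm_RintegralR_le.
  - exact: (integrable_bounded_kernel b0 ck kD (mc _) (cM _)).
  - exact/integrableRZ/ip.
  - move=> s; rewrite normrM mulrA -pk_cauchyw// [`|_ ^+ 2|]ger0_norm ?sqr_ge0//.
    by rewrite ler_wpM2r ?sqr_ge0.
apply: (@le_trans _ _ (b^-1 * PI (fun s => (u s - u x) ^+ 2) x b)).
  apply: ler_wpM2l; first by rewrite invr_ge0 ltW.
  by rewrite !(PI_sqB _ _ b0 mu_ uM) subrr expr0n addr0 lerDl sqr_ge0.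
rewrite /PI -!RintegralRZ//; apply: le_RintegralR.
- exact/integrableRZ/ip.
- exact/integrableRZ.
move=> s; rewrite mulrA -pk_cauchyw// -mulrA ler_pM2l ?invr_gt0 ?pi_gt0//.
rewrite mulrC -[u s - _]opprB sqrrN.
have [->|xs] := eqVneq x s; first by rewrite subrr expr0n mul0r mul0r.
rewrite ler_wpM2l ?sqr_ge0// /cauchyw lef_pV2 ?posrE ?cauchyw_den//.
  by rewrite lerDr sqr_ge0.
by rewrite exprn_even_gt0//= subr_eq0.
Qed.

End Poisson.

(** * Boundary limits of the kernel integrals at a point of Lipschitz continuity *)

Section PoissonBoundary.
Set Implicit Arguments.
Unset Strict Implicit.
Context {R : realType}.
Local Notation mu := (@lebesgue_measure R).
Local Notation I g := (\int[mu]_s (g s)).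
Implicit Types (u f g : R -> R) (x s a b D M L rho eta : R).

(** With r = x - s, the part |r| <= eta uses the Lipschitz bound and |r| <= lam / 2 + r^2 / (2 lam),
    where [pk] has mass 1 and [pk] times r^2 is at most b / pi. The part |r| > eta uses |u| <= M.
    Both are absorbed in multiples of [pk x b] and [cauchyw x eta], whose integrals are known
    exactly; [lam] stays free, to be optimized later. *)
Lemma PI_dist_le u x b M L rho eta lam :
  0 < b -> measurable_fun [set: R] u -> (forall s, `|u s| <= M) ->
  0 < eta <= rho -> 0 < lam ->
  (forall s, `|s - x| <= rho -> `|u s - u x| <= L * `|s - x|) ->
  PI (fun s => `|u s - u x|) x b
    <= L / 2 * lam + b * L * eta / lam + 4 * M * b / eta.
Proof.
move=> b0 mu_ uM /andP[eta0 eta_rho] lam0 uL.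
have p0 : (0 : R) < pi by exact: pi_gt0.
have M0 : 0 <= M by apply: le_trans (uM 0).
have L0 : 0 <= L.
  have := uL (x + rho); rewrite addrAC subrr add0r.
  have rho0 : 0 < rho by exact: lt_le_trans eta_rho.
  rewrite (ger0_norm (ltW rho0)) => /(_ (lexx _)) h.
  by rewrite -(pmulr_lge0 _ rho0); exact: le_trans h.
have mq : measurable_fun [set: R] (fun s => `|u s - u x|).
  by apply: measurableT_comp => //; exact: measurable_funB.
have qM s : Num.norm `|u s - u x| <= 2 * M.
  rewrite normr_id (le_trans (ler_normB _ _))//.
  by rewrite mulr_natl mulr2n lerD.
have ipk : integrableR (fun s => L / 2 * lam * pk x b s).
  apply: integrableRZ; rewrite /pk; exact/integrableRZ/integrable_cauchyw.
have icw : integrableR (fun s => b / pi * (L * eta ^+ 2 / lam + 4 * M) * cauchyw x eta s).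
  exact/integrableRZ/integrable_cauchyw.
apply: (@le_trans _ _ (I (fun s => L / 2 * lam * pk x b s +
    b / pi * (L * eta ^+ 2 / lam + 4 * M) * cauchyw x eta s))); last first.
  have ip1 : integrableR (pk x b).
    by rewrite /pk; exact/integrableRZ/integrable_cauchyw.
  rewrite RintegralRD// (RintegralRZ _ ip1) RintegralRZ; last exact: integrable_cauchyw.
  rewrite Rintegral_pk// Rintegral_cauchyw//.
  rewrite le_eqVlt; apply/orP; left; apply/eqP.
  move: (@pi_neq0 R); generalize (pi : R) => p pn0; field.
  by rewrite pn0 !gt_eqF.
apply: le_RintegralR => [||s].
- exact: (integrable_pkM _ b0 mq qM).
- exact: integrableRD.
set q := `|u s - u x|; set r := x - s.
have q0 : 0 <= q by exact: normr_ge0.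
have den := cauchyw_den x s b0; have dene := cauchyw_den x s eta0.
have cw0 : 0 <= cauchyw x b s by rewrite ltW ?cauchyw_gt0.
have cwe0 : 0 <= cauchyw x eta s by rewrite ltW ?cauchyw_gt0.
have pk0 := pk_ge0 x s b0.
have bp0 : 0 <= b / pi by rewrite divr_ge0 ?ltW.
have pkr : pk x b s * r ^+ 2 <= b / pi.
  rewrite /pk -mulrA; apply: ler_piMr => //.
  by rewrite /cauchyw mulrC ler_pdivrMr// mul1r lerDr sqr_ge0.
have [rle|rgt] := lerP `|s - x| eta.
  have qL : q <= L * `|r| by rewrite /r distrC; apply: uL; exact: le_trans rle _.
  have r2 : r ^+ 2 <= eta ^+ 2.
    by move: rle; rewrite ler_norml /r => /andP[? ?]; nra.
  (* Replaces the constant bound b / pi, which is not integrable on the line, by a multiple of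
     [cauchyw x eta]. *)
  have cwe : 1 <= 2 * eta ^+ 2 * cauchyw x eta s.
    by rewrite /cauchyw ler_pdivlMr// mul1r -/r; nra.
  have amgm : `|r| <= lam / 2 + r ^+ 2 / (2 * lam).
    rewrite -(@ler_pM2r _ (2 * lam)) ?mulr_gt0//.
    have -> : (lam / 2 + r ^+ 2 / (2 * lam)) * (2 * lam) = lam ^+ 2 + r ^+ 2.
      by field; rewrite gt_eqF.
    rewrite -[r ^+ 2](real_normK (num_real r)).
    have := sqr_ge0 (`|r| - lam); nra.
  apply: (@le_trans _ _ (pk x b s * (L * (lam / 2 + r ^+ 2 / (2 * lam))))).
    rewrite ler_wpM2l// (le_trans qL)// ler_wpM2l//.
  have -> : pk x b s * (L * (lam / 2 + r ^+ 2 / (2 * lam))) =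
     L / 2 * lam * pk x b s + (L / (2 * lam)) * (pk x b s * r ^+ 2).
    by field; rewrite gt_eqF.
  rewrite lerD2l.
  apply: (@le_trans _ _ (L / (2 * lam) * (b / pi) * (2 * eta ^+ 2 * cauchyw x eta s))).
    have c0 : 0 <= L / (2 * lam) by rewrite divr_ge0// mulr_ge0// ltW.
    apply: (@le_trans _ _ (L / (2 * lam) * (b / pi) * 1)).
      by rewrite mulr1 ler_wpM2l.
    by rewrite ler_wpM2l// mulr_ge0.
  have -> : L / (2 * lam) * (b / pi) * (2 * eta ^+ 2 * cauchyw x eta s) =
     b / pi * (L * eta ^+ 2 / lam) * cauchyw x eta s.
    by generalize (b / pi) => B; field; rewrite gt_eqF.
  by rewrite ler_wpM2r// ler_wpM2l// lerDl mulr_ge0.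
have q2M : q <= 2 * M by have := qM s; rewrite normr_id.
have r2 : eta ^+ 2 <= r ^+ 2.
  by move: rgt; rewrite lter_normr /r => /orP[?|?]; nra.
have r0 : 0 < r ^+ 2 by apply: lt_le_trans r2; exact: exprn_gt0.
have cwr : cauchyw x b s <= 2 * cauchyw x eta s.
  apply: cauchyw_comp => //; rewrite -/r; have := sqr_ge0 b; nra.
apply: (@le_trans _ _ (b / pi * (4 * M) * cauchyw x eta s)).
  rewrite /pk -[leLHS]mulrA -[leRHS]mulrA; apply: ler_wpM2l => //.
  by apply: (@le_trans _ _ (2 * cauchyw x eta s * (2 * M))); [exact: ler_pM|nra].
apply: (@le_trans _ _ (0 + b / pi * (L * eta ^+ 2 / lam + 4 * M) * cauchyw x eta s)).
  rewrite add0r; apply: ler_wpM2r => //; apply: ler_wpM2l => //; rewrite lerDr.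
  by apply: divr_ge0; [apply: mulr_ge0 => //; exact: sqr_ge0|exact: ltW].
rewrite lerD2r; apply: mulr_ge0 => //.
by apply: mulr_ge0; [exact: divr_ge0|exact: ltW].
Qed.

(** The choice lam = sqrt (b eta) makes the first two terms of [PI_dist_le] both multiples of L lam,
    with sum 3/2 L lam. Then (3/2 p + B)^2 <= 4 p^2 + 3 B^2 with p = L lam; as B = 4 M b / eta, this
    gives 48 = 3 * 16. *)
Lemma PI_dist_sq_le u x b M L rho eta :
  0 < b -> measurable_fun [set: R] u -> (forall s, `|u s| <= M) ->
  0 < eta <= rho ->
  (forall s, `|s - x| <= rho -> `|u s - u x| <= L * `|s - x|) ->
  PI (fun s => `|u s - u x|) x b ^+ 2 <= b * (4 * L ^+ 2 * eta + 48 * M ^+ 2 * b / eta ^+ 2).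
Proof.
move=> b0 mu_ uM eta_rho uL; have eta0 : 0 < eta by case/andP: eta_rho.
set lam := Num.sqrt (b * eta).
have be0 : 0 < b * eta by rewrite mulr_gt0.
have lam0 : 0 < lam by rewrite sqrtr_gt0.
have lam2 : lam ^+ 2 = b * eta by rewrite sqr_sqrtr ?ltW.
have k0 : 0 <= PI (fun s => `|u s - u x|) x b.
  by apply: Rintegral_ge0 => s _; rewrite mulr_ge0// pk_ge0.
have := PI_dist_le b0 mu_ uM eta_rho lam0 uL.
set k := PI _ _ _ in k0 *.
have -> : b * L * eta / lam = L * lam.
  have -> : b * L * eta = L * lam ^+ 2 by rewrite lam2; ring.
  by field; rewrite gt_eqF.
move=> h; set B := 4 * M * b / eta in h.
have {}h : k <= 3 / 2 * L * lam + B by apply: le_trans h _; lra.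
have B2 : B ^+ 2 = 16 * M ^+ 2 * b ^+ 2 / eta ^+ 2.
  by rewrite /B; field; rewrite gt_eqF.
apply: (@le_trans _ _ ((3 / 2 * L * lam + B) ^+ 2)).
  by rewrite lerXn2r// nnegrE (le_trans k0).
have -> : b * (4 * L ^+ 2 * eta + 48 * M ^+ 2 * b / eta ^+ 2) =
    4 * L ^+ 2 * lam ^+ 2 + 3 * B ^+ 2.
  by rewrite lam2 B2; field; rewrite gt_eqF.
have := sqr_ge0 (L * lam - B); nra.
Qed.

Lemma cvg_PI_dist_sq u (x_ b_ : nat -> R) M L rho :
  0 < rho -> (forall n, 0 < b_ n) -> b_ @ \oo --> 0 ->
  measurable_fun [set: R] u -> (forall s, `|u s| <= M) ->
  (forall n s, `|s - x_ n| <= rho -> `|u s - u (x_ n)| <= L * `|s - x_ n|) ->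
  (fun n => (b_ n)^-1 * PI (fun s => `|u s - u (x_ n)|) (x_ n) (b_ n) ^+ 2) @ \oo --> 0.
Proof.
move=> rho0 b0 bcv mu_ uM uL.
apply/cvgr0Pnorm_lt => e e0.
(* [eta] is fixed before b: it brings 4 L^2 eta below e / 2, the summand 1 covering L = 0. The other
   term is then made small by letting b tend to 0. *)
set eta := Num.min rho (e / (8 * L ^+ 2 + 1)).
have den : 0 < 8 * L ^+ 2 + 1 by rewrite ltr_wpDl// mulr_ge0// sqr_ge0.
have eta0 : 0 < eta by rewrite lt_min rho0 divr_gt0.
have eta_rho : 0 < eta <= rho by rewrite eta0 ge_min lexx.
have eta_e : eta * (8 * L ^+ 2 + 1) <= e by rewrite -ler_pdivlMr// ge_min lexx orbT.
have bs : \forall n \near \oo, b_ n < e / 2 / (48 * M ^+ 2 / eta ^+ 2 + 1).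
  have d0 : 0 < 48 * M ^+ 2 / eta ^+ 2 + 1.
    by rewrite ltr_wpDl// divr_ge0 ?sqr_ge0// mulr_ge0 ?sqr_ge0.
  by apply: (cvgr_lt _ bcv); rewrite !divr_gt0.
near=> n.
have : b_ n < e / 2 / (48 * M ^+ 2 / eta ^+ 2 + 1) by near: n.
rewrite ltr_pdivlMr; last first.
  by rewrite ltr_wpDl// divr_ge0 ?sqr_ge0// mulr_ge0 ?sqr_ge0.
move=> bns; have bn0 := b0 n.
have k0 : 0 <= PI (fun s => `|u s - u (x_ n)|) (x_ n) (b_ n).
  by apply: Rintegral_ge0 => s _; rewrite mulr_ge0// pk_ge0.
rewrite ger0_norm; last by rewrite mulr_ge0 ?invr_ge0 ?sqr_ge0 ?ltW.
rewrite mulrC ltr_pdivrMr//.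
apply: le_lt_trans (PI_dist_sq_le bn0 mu_ uM eta_rho (uL n)) _.
rewrite mulrC ltr_pM2r//.
have -> : 48 * M ^+ 2 * b_ n / eta ^+ 2 = b_ n * (48 * M ^+ 2 / eta ^+ 2) by ring.
lra.
Unshelve. all: by end_near. Qed.

(** The mean is first replaced by u (x_ n), with an error that [cvg_PI_dist_sq] sends to 0. After
    that the square vanishes to second order at s = x_ n and compensates the kernel, so dominated
    convergence applies. The Lipschitz bound is asked on twice the radius [rho] so that it also
    holds on the interval of radius [rho] about each x_ n. *)
Lemma cvg_kernel_pvar (k_ : nat -> R -> R) (k0 : R -> R) u (x_ b_ : nat -> R) x0 M L rho :
  0 < rho -> (forall n, 0 < b_ n) -> b_ @ \oo --> 0 ->
  x_ @ \oo --> x0 -> (forall n, `|x_ n - x0| <= rho) ->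
  (forall n, continuous (k_ n)) -> measurable_fun [set: R] k0 ->
  (forall n s, `|k_ n s| <= pi^-1 * cauchyw (x_ n) (b_ n) s) ->
  (forall n, I (k_ n) = 0) ->
  (forall s, s != x0 -> k_ ^~ s @ \oo --> k0 s) ->
  measurable_fun [set: R] u -> (forall s, `|u s| <= M) ->
  (forall s s', `|s - x0| <= 2 * rho -> `|s' - x0| <= 2 * rho ->
     `|u s - u s'| <= L * `|s - s'|) ->
  (fun n => I (fun s => k_ n s * (u s - PI u (x_ n) (b_ n)) ^+ 2)) @ \oo -->
  I (fun s => k0 s * (u s - u x0) ^+ 2).
Proof.
move=> rho0 b0 bcv xcv xrho ck mk0 kD Ik kcv mu_ uM uL.
have p0 : (0 : R) < pi by exact: pi_gt0.
have uLn n s : `|s - x_ n| <= rho -> `|u s - u (x_ n)| <= L * `|s - x_ n|.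
  move=> sx; apply: uL.
    rewrite (_ : s - x0 = (s - x_ n) + (x_ n - x0)); last by ring.
    by rewrite (le_trans (ler_normD _ _))// mulr_natl mulr2n lerD.
  by rewrite (le_trans (xrho n))// mulr_natl mulr2n lerDl ltW.
have ucv : (fun n => u (x_ n)) @ \oo --> u x0.
  apply: cvg_zero; rewrite (_ : _ - _ = fun n => u (x_ n) - u x0)//.
  have h : (fun n => L * `|x_ n - x0|) @ \oo --> 0.
    rewrite -[X in _ --> X](mulr0 L); apply: cvgM; first exact: cvg_cst.
    by rewrite -[X in _ --> X](@normr0 _ R); apply: cvg_norm; apply/subr_cvg0.
  apply: norm_cvg0; apply: (squeeze_cvgr _ (cvg_cst 0) h).
  apply: nearW => n; rewrite normr_ge0/=; apply: uL.
    by rewrite (le_trans (xrho n))// mulr_natl mulr2n lerDl ltW.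
  by rewrite subrr normr0 mulr_ge0// ltW.
(* Because k_ n integrates to 0, the two integrals differ by exactly - 2 (m - u (x_ n)) J. Here |m -
   u (x_ n)| <= kap and, as the kernel is at most 1/b times [pk], |J| <= kap / b. *)
have kdist n : `|I (fun s => k_ n s * (u s - PI u (x_ n) (b_ n)) ^+ 2) -
    I (fun s => k_ n s * (u s - u (x_ n)) ^+ 2)| <=
    2 * ((b_ n)^-1 * PI (fun s => `|u s - u (x_ n)|) (x_ n) (b_ n) ^+ 2).
  have bn0 := b0 n.
  have mc c : measurable_fun [set: R] (fun s => u s - c) by exact: measurable_funB.
  have cM c s : `|u s - c| <= M + `|c| by rewrite (le_trans (ler_normB _ _))// lerD2r.
  have mq : measurable_fun [set: R] (fun s => `|u s - u (x_ n)|).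
    exact: measurableT_comp.
  have qM s : Num.norm `|u s - u (x_ n)| <= M + `|u (x_ n)|.
    by rewrite normr_id.
  have ik := integrable_bounded_kernel bn0 (ck n) (kD n).
  have i0 : integrableR (k_ n).
    exact: (integrable_dominated bn0 (continuous_measurable_fun (ck n)) (kD n)).
  have ipk v M' mv vM := @integrable_pkM R v (x_ n) (b_ n) M' bn0 mv vM.
  rewrite !(kernel_sqB _ bn0 (ck n) (kD n) mu_ uM) Ik !mulr0 !addr0.
  set m := PI u _ _; set J := I (fun s => k_ n s * u s).
  set kap := PI _ _ _.
  have kap0 : 0 <= kap by apply: Rintegral_ge0 => s _; rewrite mulr_ge0// pk_ge0.
  have JE : J = I (fun s => k_ n s * (u s - u (x_ n))).
    transitivity (J - u (x_ n) * I (k_ n)); first by rewrite Ik mulr0 subr0.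
    rewrite /J -RintegralRZ// -RintegralRB//; [|exact: (ik _ _ mu_ uM)|exact: integrableRZ].
    by apply: eq_Rintegral => s _; ring.
  have Jle : `|J| <= (b_ n)^-1 * kap.
    rewrite JE /kap /PI -RintegralRZ; last exact: (ipk _ _ mq qM).
    apply: norm_RintegralR_le => [||s].
    - exact: (ik _ _ (mc _) (cM _)).
    - exact/integrableRZ/(ipk _ _ mq qM).
    - rewrite normrM mulrA -pk_cauchyw//; exact: ler_wpM2r.
  have mle : `|m - u (x_ n)| <= kap.
    have -> : m - u (x_ n) = I (fun s => pk (x_ n) (b_ n) s * (u s - u (x_ n))).
      rewrite -[u (x_ n) in LHS]mulr1 -(Rintegral_pk (x_ n) bn0) /m /PI.
      have ip : integrableR (pk (x_ n) (b_ n)).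
        by rewrite /pk; exact/integrableRZ/integrable_cauchyw.
      rewrite -RintegralRZ// -RintegralRB//; [|exact: (ipk _ _ mu_ uM)|exact: integrableRZ].
      by apply: eq_Rintegral => s _; ring.
    apply: norm_RintegralR_le => [||s].
    - exact: (ipk _ _ (mc _) (cM _)).
    - exact: (ipk _ _ mq qM).
    - by rewrite normrM ger0_norm// pk_ge0.
  rewrite (_ : _ - _ = - 2 * ((m - u (x_ n)) * J)); last by ring.
  rewrite normrM normrN normr_nat ler_pM2l// normrM.
  rewrite expr2 mulrA [_ * kap * kap]mulrC.
  by apply: ler_pM.
have c1 : (fun n => I (fun s => k_ n s * (u s - u (x_ n)) ^+ 2)) @ \oo -->
    I (fun s => k0 s * (u s - u x0) ^+ 2).
  (* Write W for the square and Q for rho^2 + (x0 - s)^2. If |s - x0| <= 2 rho, then W <= L^2 (x_ n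
     - s)^2 and Q <= 5 rho^2. Otherwise W <= 4 M^2, and |x_ n - s| is at least rho and at least half
     of |s - x0|, so Q <= 5 (x_ n - s)^2. *)
  apply: (@dominated_cvgR _ _ _ x0 rho
    (pi^-1 * (5 * rho ^+ 2 * L ^+ 2 + 20 * M ^+ 2)) x0) => //.
  - move=> n; apply: measurable_funM; first exact: continuous_measurable_fun.
    exact: measurable_sqB.
  - by apply: measurable_funM => //; exact: measurable_sqB.
  - move=> s sx0; apply: cvgM; first exact: kcv.
    rewrite !expr2; under eq_fun do rewrite expr2.
    by apply: cvgM; (apply: cvgB; [exact: cvg_cst|exact: ucv]).
  - move=> n s; have bn0 := b0 n; rewrite normrM [`|_ ^+ 2|]ger0_norm ?sqr_ge0//.
    have den := cauchyw_den (x_ n) s bn0.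
    apply: (@le_trans _ _ (pi^-1 * cauchyw (x_ n) (b_ n) s * (u s - u (x_ n)) ^+ 2)).
      by rewrite ler_wpM2r// sqr_ge0.
    rewrite -[leLHS]mulrA -[leRHS]mulrA ler_pM2l ?invr_gt0//.
    have M0 : 0 <= M by apply: le_trans (uM 0).
    have := xrho n; rewrite ler_norml => /andP[h1 h1'].
    rewrite [cauchyw x0 rho s]/cauchyw ler_pdivlMr ?cauchyw_den//.
    rewrite /cauchyw mulrC [_^-1 * _]mulrC mulrA ler_pdivrMr//.
    set W := (u s - u (x_ n)) ^+ 2; set Q := rho ^+ 2 + (x0 - s) ^+ 2.
    have W0 : 0 <= W by exact: sqr_ge0.
    have Q0 : 0 <= Q by rewrite addr_ge0 ?sqr_ge0.
    have rho2 := sqr_ge0 rho; have b2 := sqr_ge0 (b_ n).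
    have M2 := sqr_ge0 M; have L2 := sqr_ge0 L; have r2 := sqr_ge0 (x_ n - s).
    have [near_|far] := lerP `|s - x0| (2 * rho).
      have WL : W <= L ^+ 2 * (x_ n - s) ^+ 2.
        rewrite /W -exprMn -real_normK ?num_real// -[leRHS]real_normK ?num_real//.
        rewrite lerXn2r ?nnegrE// normrM (distrC (x_ n)).
        apply: le_trans (uL _ _ near_ _) _.
          by rewrite (le_trans (xrho n))// mulr_natl mulr2n lerDl ltW.
        by rewrite ler_wpM2r// ler_norm.
      have Q5 : Q <= 5 * rho ^+ 2.
        by move: near_; rewrite ler_norml /Q => /andP[? ?]; nra.
      rewrite mulrC; apply: le_trans (ler_pM W0 Q0 WL Q5) _.
      have h2 : 0 <= rho ^+ 2 * L ^+ 2 * b_ n ^+ 2 by do ?[apply: mulr_ge0 => //].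
      have h3 : 0 <= M ^+ 2 * b_ n ^+ 2 by apply: mulr_ge0.
      have h4 : 0 <= M ^+ 2 * (x_ n - s) ^+ 2 by apply: mulr_ge0.
      nra.
    have W4 : W <= 4 * M ^+ 2.
      have := uM s; have := uM (x_ n); rewrite !ler_norml => /andP[? ?] /andP[? ?].
      by rewrite /W; nra.
    have Q5 : Q <= 5 * (x_ n - s) ^+ 2.
      by move: far; rewrite lter_normr /Q => /orP[?|?]; nra.
    rewrite mulrC; apply: le_trans (ler_pM W0 Q0 W4 Q5) _.
    have h2 : 0 <= rho ^+ 2 * L ^+ 2 * b_ n ^+ 2 by do ?[apply: mulr_ge0 => //].
    have h3 : 0 <= M ^+ 2 * b_ n ^+ 2 by apply: mulr_ge0.
    have h4 : 0 <= rho ^+ 2 * L ^+ 2 * (x_ n - s) ^+ 2 by do ?[apply: mulr_ge0 => //].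
    nra.
have c2 : (fun n => I (fun s => k_ n s * (u s - PI u (x_ n) (b_ n)) ^+ 2) -
    I (fun s => k_ n s * (u s - u (x_ n)) ^+ 2)) @ \oo --> 0.
  have h := cvg_PI_dist_sq rho0 b0 bcv mu_ uM uLn.
  have {}h : (fun n => 2 * ((b_ n)^-1 * PI (fun s => `|u s - u (x_ n)|) (x_ n) (b_ n) ^+ 2))
    @ \oo --> 0.
    by rewrite -[X in _ --> X](mulr0 2); apply: cvgM => //; exact: cvg_cst.
  apply: norm_cvg0; apply: (squeeze_cvgr _ (cvg_cst 0) h).
  by apply: nearW => n; rewrite normr_ge0/=.
rewrite -[X in _ --> X]add0r.
rewrite (_ : (fun n => _) = (fun n => (I (fun s => k_ n s * (u s - PI u (x_ n) (b_ n)) ^+ 2) -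
    I (fun s => k_ n s * (u s - u (x_ n)) ^+ 2)) +
    I (fun s => k_ n s * (u s - u (x_ n)) ^+ 2))).
  exact: cvgD.
by apply/funext => n; rewrite subrK.
Qed.

End PoissonBoundary.

Local Open Scope complex_scope.

(** * Complex differentiation *)

Section ComplexCalculus.
Set Implicit Arguments.
Unset Strict Implicit.
Context {R : realType}.
Local Notation C := R[i].
Local Notation Re := complex.Re.
Local Notation Im := complex.Im.
Implicit Types (z w l : C) (e d s t : R).

Lemma cabs_norm z : `|z| = (cabs z)%:C.
Proof. by []. Qed.

Lemma cabs_ge0 z : 0 <= cabs z.
Proof. by case: z => a b; rewrite /cabs /= sqrtr_ge0. Qed.

Lemma cabs_sq z : cabs z ^+ 2 = Re z ^+ 2 + Im z ^+ 2.
Proof. by case: z => a b; rewrite /cabs /= sqr_sqrtr// addr_ge0 ?sqr_ge0. Qed.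

Lemma cabsM z w : cabs (z * w) = cabs z * cabs w.
Proof. exact: ComplexField.Normc.normcM. Qed.

Lemma cabsV z : cabs z^-1 = (cabs z)^-1.
Proof. exact: ComplexField.Normc.normcV. Qed.

Lemma cabsD z w : cabs (z + w) <= cabs z + cabs w.
Proof. by have := ler_normD z w; rewrite !cabs_norm -rmorphD/= lecR. Qed.

Lemma cabsN z : cabs (- z) = cabs z.
Proof. by have := normrN z; rewrite !cabs_norm => /complexI. Qed.

Lemma cabsB z w : cabs (z - w) = cabs (w - z).
Proof. by rewrite -cabsN opprB. Qed.

Lemma cabs0 : cabs (0 : C) = 0.
Proof. exact: ComplexField.Normc.normc0. Qed.

Lemma cabs_eq0 z : cabs z = 0 -> z = 0.
Proof. exact: ComplexField.Normc.eq0_normc. Qed.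

Lemma cabs_gt0 z : z != 0 -> 0 < cabs z.
Proof.
move=> z0; rewrite lt_neqAle cabs_ge0 andbT eq_sym.
by apply: contra z0 => /eqP/cabs_eq0 ->.
Qed.

Lemma cabs_real (a : R) : cabs a%:C = `|a|.
Proof. by rewrite /cabs /= expr0n addr0 sqrtr_sqr. Qed.

Lemma cabs_conj z : cabs (conjc z) = cabs z.
Proof. by case: z => a b; rewrite /cabs /= sqrrN. Qed.

Lemma cabs_i : cabs ('i%C : C) = 1.
Proof. by rewrite /cabs /= expr0n expr1n add0r sqrtr1. Qed.

Lemma norm_Re_le z : `|Re z| <= cabs z.
Proof.
rewrite -(@ler_pXn2r _ 2%N) ?nnegrE ?cabs_ge0// cabs_sq real_normK ?num_real//.
by rewrite lerDl sqr_ge0.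
Qed.

Lemma norm_Im_le z : `|Im z| <= cabs z.
Proof.
rewrite -(@ler_pXn2r _ 2%N) ?nnegrE ?cabs_ge0// cabs_sq real_normK ?num_real//.
by rewrite lerDr sqr_ge0.
Qed.

Lemma cabs_le_ReIm z : cabs z <= `|Re z| + `|Im z|.
Proof.
rewrite -(@ler_pXn2r _ 2%N) ?nnegrE ?cabs_ge0 ?addr_ge0// cabs_sq.
rewrite -[Re z ^+ 2]real_normK ?num_real// -[Im z ^+ 2]real_normK ?num_real//.
have := normr_ge0 (Re z); have := normr_ge0 (Im z); nra.
Qed.

Lemma ReC_D z w : Re (z + w) = Re z + Re w. Proof. by case: z w => ? ? [? ?]. Qed.
Lemma ImC_D z w : Im (z + w) = Im z + Im w. Proof. by case: z w => ? ? [? ?]. Qed.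
Lemma ReC_N z : Re (- z) = - Re z. Proof. by case: z. Qed.
Lemma ImC_N z : Im (- z) = - Im z. Proof. by case: z. Qed.
Lemma ReC_M z w : Re (z * w) = Re z * Re w - Im z * Im w. Proof. by case: z w => ? ? [? ?]. Qed.
Lemma ImC_M z w : Im (z * w) = Re z * Im w + Im z * Re w. Proof. by case: z w => ? ? [? ?]. Qed.

Lemma complex_eq z w : Re z = Re w -> Im z = Im w -> z = w.
Proof. by case: z w => ? ? [? ?] /= -> ->. Qed.

(** Radii of balls in R[i] are positive elements of R[i], and the order forces these to be real. *)
Lemma cvgC_lt (T : Type) (F : set_system T) (FF : Filter F) (f : T -> C) l :
  f @ F --> l <-> forall e, 0 < e -> \forall x \near F, cabs (l - f x) < e.
Proof.
split.
  move=> /cvgrPdist_lt h e e0; have := h e%:C.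
  rewrite ltcR => /(_ e0); apply: filterS => x.
  by rewrite cabs_norm ltcR.
move=> h; apply/cvgrPdist_lt => e; rewrite ltcE/= => /andP[/eqP ie e0].
have := h _ e0; apply: filterS => x.
by rewrite cabs_norm ltcE/= ie eqxx.
Qed.

(** Multiplying out the difference quotient includes s = t and makes remainders easy to compose. *)
Lemma has_deriv_onTP (f : R -> C) t l : has_deriv_on setT f t l <->
  forall e, 0 < e -> exists2 d, 0 < d &
    forall s, `|s - t| < d -> cabs (f s - f t - (s - t)%:C * l) <= e * `|s - t|.
Proof.
rewrite /has_deriv_on cvgC_lt /diff_quotient.
have key s : s != t -> cabs (l - ((s - t)^-1)%:C * (f s - f t)) * `|s - t| =
    cabs (f s - f t - (s - t)%:C * l).
  move=> st; have st0 : s - t != 0 by rewrite subr_eq0.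
  have stC : (s - t)%:C != 0 :> C by rewrite -(inj_eq (@complexI R)) in st0.
  rewrite -cabs_real -cabsM -cabsN; congr cabs.
  rewrite mulrBl opprB; congr (_ - _); last by rewrite mulrC.
  by rewrite mulrAC -rmorphM/= mulVf// mul1r.
split=> h e e0.
  have [d /= d0 dh] := h _ e0; exists d => // s sd.
  have [->|st] := eqVneq s t.
    by rewrite !subrr mul0r subr0 cabs0 normr0 mulr0.
  rewrite -key// ler_pM2r ?normr_gt0 ?subr_eq0//; apply: ltW.
  by apply: dh => //=; rewrite distrC.
have [d d0 dh] := h _ (divr_gt0 e0 (ltr0Sn _ 1)).
exists d => //= s sd st _.
rewrite -(@ltr_pM2r _ `|s - t|) ?normr_gt0 ?subr_eq0// key//.
rewrite /= distrC in sd; apply: le_lt_trans (dh _ sd) _.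
rewrite ltr_pM2r ?normr_gt0 ?subr_eq0// ltr_pdivrMr// ltr_pMr// ltr1n //.
Qed.

Lemma is_deriveRP (f : R -> R) t (l : R) : is_derive t 1 f l <->
  forall e, 0 < e -> exists2 d, 0 < d &
    forall s, `|s - t| < d -> `|f s - f t - (s - t) * l| <= e * `|s - t|.
Proof.
have key s h : h != 0 -> s = h + t ->
   `|l - h^-1 *: (f (h *: 1 + t) - f t)| * `|s - t| = `|f s - f t - (s - t) * l|.
  move=> h0 ->; rewrite addrK -normrM distrC /GRing.scale/= mulr1; congr (`|_|).
  by field.
split=> [[dv dE] e e0|h].
  have cv : h^-1 *: ((f \o shift t) (h *: 1) - f t) @[h --> 0^'] --> l.
    by rewrite -dE; exact: dv.
  move/cvgrPdist_lt : cv => /(_ _ e0)[d /= d0 dh]; exists d => // s sd.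
  have [->|st] := eqVneq s t.
    by rewrite !subrr mul0r subr0 normr0 mulr0.
  rewrite -(@key s (s - t)) ?subr_eq0// ?subrK// ler_pM2r ?normr_gt0 ?subr_eq0//.
  by apply/ltW/dh; rewrite ?subr_eq0//= sub0r normrN.
have cv : h^-1 *: ((f \o shift t) (h *: 1) - f t) @[h --> 0^'] --> l.
  apply/cvgrPdist_lt => e e0; have [d d0 dh] := h _ (divr_gt0 e0 (ltr0Sn _ 1)).
  exists d => //= k; rewrite /= sub0r normrN => kd k0.
  rewrite -(@ltr_pM2r _ `|k|) ?normr_gt0//.
  have := key (k + t) k k0 erefl; rewrite addrK => ->.
  have := dh (k + t); rewrite addrK => /(_ kd) h1; apply: le_lt_trans h1 _.
  by rewrite ltr_pM2r ?normr_gt0// ltr_pdivrMr// ltr_pMr// ltr1n.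
apply: DeriveDef; last exact: cvg_lim cv.
by apply/cvg_ex; exists l.
Qed.

Lemma has_deriv_ReIm (f : R -> C) t l : has_deriv_on setT f t l <->
  is_derive t 1 (fun s => Re (f s)) (Re l) /\ is_derive t 1 (fun s => Im (f s)) (Im l).
Proof.
have eR s : Re (f s) - Re (f t) - (s - t) * Re l = Re (f s - f t - (s - t)%:C * l).
  by rewrite !(ReC_D, ReC_N, ReC_M)/= mul0r subr0.
have eI s : Im (f s) - Im (f t) - (s - t) * Im l = Im (f s - f t - (s - t)%:C * l).
  by rewrite !(ImC_D, ImC_N, ImC_M)/= mul0r addr0.
rewrite has_deriv_onTP !is_deriveRP; split=> [h|[hR hI] e e0].
  split=> e e0; have [d d0 dh] := h _ e0; exists d => // s sd.
  - by rewrite eR; exact: le_trans (norm_Re_le _) (dh _ sd).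
  - by rewrite eI; exact: le_trans (norm_Im_le _) (dh _ sd).
have e20 : 0 < e / 2 by rewrite divr_gt0.
have [d1 d10 dh1] := hR _ e20; have [d2 d20 dh2] := hI _ e20.
exists (Num.min d1 d2); first by rewrite lt_min d10.
move=> s; rewrite lt_min => /andP[s1 s2].
apply: le_trans (cabs_le_ReIm _) _; rewrite -eR -eI.
apply: le_trans (lerD (dh1 _ s1) (dh2 _ s2)) _.
by rewrite -mulrDl -splitr.
Qed.

Lemma has_deriv_deriv_onT (f : R -> C) t l :
  has_deriv_on setT f t l -> deriv_on setT f t = l.
Proof.
have e : within [set: R] t^' = t^'.
  by apply/seteqP; split => A /=; rewrite /within/=; apply: filterS => s; [apply|].
by rewrite /deriv_on /has_deriv_on e => h; exact: cvg_lim h.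
Qed.

Lemma has_deriv_comp (f : R -> C) (g : R -> R) t l (r : R) :
  is_derive t 1 g r -> has_deriv_on setT f (g t) l ->
  has_deriv_on setT (f \o g) t (r%:C * l).
Proof.
move=> dg /has_deriv_ReIm[dR dI]; apply/has_deriv_ReIm.
rewrite ReC_M ImC_M /= !mul0r subr0 addr0.
have cR := @is_derive1_comp R (fun s => Re (f s)) g t (Re l) r dR dg.
have cI := @is_derive1_comp R (fun s => Im (f s)) g t (Im l) r dI dg.
by rewrite mulrC; split => //; rewrite mulrC.
Qed.

Definition cderiv (f : C -> C) z l : Prop := forall e, 0 < e ->
  exists2 d, 0 < d & forall h, cabs h < d -> cabs (f (z + h) - f z - l * h) <= e * cabs h.

Lemma derivable_cderiv (f : C -> C) z : derivable f z 1 -> exists l, cderiv f z l.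
Proof.
move=> /cvg_ex[l]; rewrite cvgC_lt => h; exists l => e e0.
have [d /= d0 dh] := h _ e0; move: d0; rewrite ltcE/= => /andP[/eqP id d0].
exists (Re d) => // k kd.
have [->|k0] := eqVneq k 0.
  by rewrite addr0 subrr mulr0 subr0 cabs0 mulr0.
have := dh k; rewrite /ball_/= sub0r normrN cabs_norm ltcE/= id eqxx => /(_ kd k0).
rewrite /GRing.scale/= mulr1 => hk; have ck := cabs_gt0 k0.
have -> : f (z + k) - f z - l * k = - ((l - k^-1 * (f (k + z) - f z)) * k).
  by rewrite (addrC k z); field.
by rewrite cabsN cabsM ler_pM2r//; exact: ltW.
Qed.

Lemma has_deriv_cderiv (f : C -> C) (phi : R -> C) t l v :
  cderiv f (phi t) l -> has_deriv_on setT phi t v ->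
  has_deriv_on setT (f \o phi) t (l * v).
Proof.
move=> df /has_deriv_onTP dp; apply/has_deriv_onTP => e e0.
set K := cabs v + 1; have K0 : 0 < K by rewrite ltr_wpDl ?cabs_ge0.
set L := cabs l + 1; have L0 : 0 < L by rewrite ltr_wpDl ?cabs_ge0.
have [d1 d10 h1] := df (e / (2 * K)) (divr_gt0 e0 (mulr_gt0 (ltr0Sn _ 1) K0)).
(* The bound 1 makes the increment of [phi] at most K |s - t|; the bound e / (2 L) keeps l times its
   remainder within half of the allowed error. *)
have m0 : 0 < Num.min 1 (e / (2 * L)) by rewrite lt_min ltr01 divr_gt0// mulr_gt0.
have [d2 d20 h2] := dp _ m0.
exists (Num.min d2 (d1 / K)); first by rewrite lt_min d20 divr_gt0.
move=> s; rewrite lt_min ltr_pdivlMr// => /andP[s2 s1].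
have {h2} := h2 _ s2; set q := phi s - phi t - _ => qm.
have st0 := normr_ge0 (s - t).
have q1 : cabs q <= `|s - t|.
  by apply: le_trans qm _; rewrite ler_piMl// ge_min lexx.
have q2 : cabs q <= e / (2 * L) * `|s - t|.
  by apply: le_trans qm _; rewrite ler_wpM2r// ge_min lexx orbT.
have pK : cabs (phi s - phi t) <= K * `|s - t|.
  rewrite (_ : phi s - phi t = q + (s - t)%:C * v); last by rewrite /q subrK.
  apply: le_trans (cabsD _ _) _; rewrite cabsM cabs_real /K; lra.
have := h1 (phi s - phi t); rewrite [phi t + _]addrC subrK => /(_ (le_lt_trans pK _)).
rewrite [K * _]mulrC => /(_ s1) h3.
rewrite (_ : _ - _ = (f (phi s) - f (phi t) - l * (phi s - phi t)) + l * q)/=; last first.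
  by rewrite /q; ring.
apply: le_trans (cabsD _ _) _; rewrite cabsM.
have h4 : e / (2 * K) * cabs (phi s - phi t) <= e / 2 * `|s - t|.
  apply: (@le_trans _ _ (e / (2 * K) * (K * `|s - t|))).
    by rewrite ler_wpM2l// ltW// divr_gt0// mulr_gt0.
  by rewrite le_eqVlt; apply/orP; left; apply/eqP; field; rewrite gt_eqF.
have h5 : cabs l * cabs q <= e / 2 * `|s - t|.
  apply: (@le_trans _ _ (L * (e / (2 * L) * `|s - t|))).
    by apply: ler_pM; rewrite ?cabs_ge0// /L lerDl.
  by rewrite le_eqVlt; apply/orP; left; apply/eqP; field; rewrite gt_eqF.
lra.
Qed.

Lemma cderiv_lines (f : C -> C) z l : cderiv f z l ->
  [/\ has_deriv_on setT (xline f z) 0 l, has_deriv_on setT (yline f z) 0 ('i%C * l) & dz f z = l].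
Proof.
move=> df.
have hx : has_deriv_on setT (xline f z) 0 l.
  apply/has_deriv_onTP => e e0; have [d d0 h] := df _ e0; exists d => // s.
  by rewrite subr0 /xline addr0 -cabs_real => sd; rewrite mulrC; exact: h.
have hy : has_deriv_on setT (yline f z) 0 ('i%C * l).
  apply/has_deriv_onTP => e e0; have [d d0 h] := df _ e0; exists d => // s.
  rewrite subr0 /yline mulr0 addr0 -cabs_real => sd.
  have cs : cabs ('i%C * s%:C : C) = cabs s%:C by rewrite cabsM cabs_i mul1r.
  have := h ('i%C * s%:C); rewrite cs => /(_ sd).
  by rewrite (_ : l * ('i%C * s%:C) = s%:C * ('i%C * l))//; ring.
split=> //; rewrite /dz /dx /dy (has_deriv_deriv_onT hx) (has_deriv_deriv_onT hy).
have -> : 'i%C * ('i%C * l) = - l by rewrite mulrA -expr2 sqr_i mulN1r.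
by rewrite opprK; field.
Qed.

Lemma is_derive_lipschitz (f f' : R -> R) (a b K : R) :
  (forall s, Num.min a b <= s <= Num.max a b -> is_derive s 1 f (f' s)) ->
  (forall s, Num.min a b <= s <= Num.max a b -> `|f' s| <= K) ->
  `|f b - f a| <= K * `|b - a|.
Proof.
wlog ab : a b / a < b => [hw|].
  have [ab|ba|->] := ltgtP a b.
  - by have := hw a b ab; rewrite (min_idPl (ltW ab)) (max_idPr (ltW ab)).
  - have := hw b a ba; rewrite (min_idPl (ltW ba)) (max_idPr (ltW ba)).
    by rewrite (distrC (f a)) (distrC a).
  - by rewrite !subrr normr0 mulr0.
rewrite (min_idPl (ltW ab)) (max_idPr (ltW ab)) => df fK.
have [c cab ->] : exists2 c, c \in `]a, b[ & f b - f a = f' c * (b - a).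
  apply: MVT => // [s sab|].
    by apply: df; move: sab; rewrite in_itv/= => /andP[/ltW-> /ltW->].
  apply: derivable_within_continuous => s; rewrite in_itv/= => sab.
  by have := df s sab => -[].
rewrite normrM ler_wpM2r//; apply: fK.
by move: cab; rewrite in_itv/= => /andP[/ltW-> /ltW->].
Qed.

(** The mean value theorem is applied to the real and the imaginary part separately, whence the
    factor 2. *)
Lemma has_deriv_lipschitz (f f' : R -> C) (a b K : R) :
  (forall s, Num.min a b <= s <= Num.max a b -> has_deriv_on setT f s (f' s)) ->
  (forall s, Num.min a b <= s <= Num.max a b -> cabs (f' s) <= K) ->
  cabs (f b - f a) <= 2 * K * `|b - a|.
Proof.
move=> df fK; apply: le_trans (cabs_le_ReIm _) _.
rewrite !(ReC_D, ImC_D, ReC_N, ImC_N) mulr_natl mulr2n mulrDl.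
apply: lerD.
- apply: (@is_derive_lipschitz (fun s => Re (f s)) (fun s => Re (f' s))) => s sab.
    by have /has_deriv_ReIm[] := df s sab.
  exact: le_trans (norm_Re_le _) (fK s sab).
- apply: (@is_derive_lipschitz (fun s => Im (f s)) (fun s => Im (f' s))) => s sab.
    by have /has_deriv_ReIm[] := df s sab.
  exact: le_trans (norm_Im_le _) (fK s sab).
Qed.

Lemma has_deriv_continuous (f : R -> C) t l :
  has_deriv_on setT f t l -> f s @[s --> t] --> f t.
Proof.
move=> /has_deriv_onTP h; apply/cvgC_lt => e e0.
have [d d0 dh] := h 1 ltr01.
set K := cabs l + 2; have K0 : 0 < K by rewrite ltr_wpDl ?cabs_ge0.
near=> s.
have sd : `|s - t| < d by near: s; exists d => //= s; rewrite /ball_/= distrC.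
have se : `|s - t| < e / K.
  by near: s; exists (e / K) => /=; rewrite ?divr_gt0// => s; rewrite /ball_/= distrC.
rewrite cabsB.
rewrite (_ : f s - f t = (f s - f t - (s - t)%:C * l) + (s - t)%:C * l); last by rewrite subrK.
apply: le_lt_trans (cabsD _ _) _; rewrite cabsM cabs_real.
rewrite ltr_pdivlMr// in se; have := dh _ sd; have := normr_ge0 (s - t).
have := cabs_ge0 l; rewrite /K in se; nra.
Unshelve. all: by end_near. Qed.

Lemma cderiv_continuous (f : C -> C) z l : cderiv f z l -> f w @[w --> z] --> f z.
Proof.
move=> h; apply/(@cvgC_lt _ (nbhs z) _ f (f z)) => e e0.
have [d d0 dh] := h 1 ltr01.
set K := cabs l + 2; have K0 : 0 < K by rewrite ltr_wpDl ?cabs_ge0.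
exists (Num.min d (e / K))%:C => /=; first by rewrite ltcR lt_min d0 divr_gt0.
move=> w; rewrite /ball_/= cabs_norm ltcR (cabsB z) (cabsB (f z)) lt_min => /andP[wd we].
rewrite (_ : f w - f z = (f w - f z - l * (w - z)) + l * (w - z)); last by rewrite subrK.
apply: le_lt_trans (cabsD _ _) _; rewrite cabsM.
rewrite ltr_pdivlMr// in we; have := dh _ wd; rewrite subrKC; have := cabs_ge0 (w - z).
have := cabs_ge0 l; rewrite /K in we; nra.
Qed.

(** Reduces boundary limits to sequences, the setting of [dominated_cvgR]. The sequences may be
    taken inside a prescribed radius r, where local Lipschitz bounds hold. *)
Lemma cvg_within_seq (D : set C) (f : C -> C) z l (r : R) : 0 < r ->
  (forall w_ : nat -> C, (forall n, D (w_ n)) -> (forall n, cabs (w_ n - z) < r) ->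
     (forall n, cabs (w_ n - z) < n.+1%:R^-1) -> f (w_ n) @[n --> \oo] --> l) ->
  f w @[w --> within D (nbhs z)] --> l.
Proof.
move=> r0 h; apply/cvgC_lt => e e0; apply: contrapT => nh.
have : forall n, exists w, [/\ D w, cabs (w - z) < Num.min r n.+1%:R^-1 & e <= cabs (l - f w)].
  move=> n; apply: contrapT => nw; apply: nh.
  exists (Num.min r n.+1%:R^-1)%:C => /=; first by rewrite ltcR lt_min r0 invr_gt0 ltr0Sn.
  move=> w /= wz Dw; rewrite ltNge; apply/negP => ew; apply: nw; exists w; split => //.
  by move: wz; rewrite /ball_/= distrC cabs_norm ltcR.
move=> /choice[w_ wP].
have /cvgC_lt/(_ _ e0)[N _ hN] : f (w_ n) @[n --> \oo] --> l.
  apply: h => n; have [Dw] := wP n; rewrite lt_min => /andP[wr wn] _ //.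
have := hN N (leqnn N); case: (wP N) => _ _ /=.
by rewrite leNgt => /negP.
Qed.

Lemma cvg_within_Re (w_ : nat -> C) z :
  (forall n, cabs (w_ n - z) < n.+1%:R^-1) ->
  (fun n => Re (w_ n)) @ \oo --> Re z /\ (fun n => Im (w_ n)) @ \oo --> Im z.
Proof.
move=> wz; split; apply/cvgrPdist_lt => e e0; near=> n.
  apply: (@lt_trans _ _ n.+1%:R^-1).
    by rewrite distrC -ReC_N -ReC_D; apply: le_lt_trans (norm_Re_le _) (wz n).
  by near: n; apply: (cvgr_lt _ cvg_harmonic).
apply: (@lt_trans _ _ n.+1%:R^-1).
  by rewrite distrC -ImC_N -ImC_D; apply: le_lt_trans (norm_Im_le _) (wz n).
by near: n; apply: (cvgr_lt _ cvg_harmonic).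
Unshelve. all: by end_near. Qed.

Lemma cvgC_ReIm (T : Type) (F : set_system T) (FF : Filter F) (f : T -> C) l :
  f @ F --> l <-> (Re (f x) @[x --> F] --> Re l) /\ (Im (f x) @[x --> F] --> Im l).
Proof.
rewrite cvgC_lt; split=> [h|[/cvgrPdist_lt hR /cvgrPdist_lt hI] e e0].
  split; apply/cvgrPdist_lt => e e0; apply: filterS (h _ e0) => x; apply: le_lt_trans.
    by rewrite -ReC_N -ReC_D norm_Re_le.
  by rewrite -ImC_N -ImC_D norm_Im_le.
have e2 : 0 < e / 2 by rewrite divr_gt0.
apply: filterS2 (hR _ e2) (hI _ e2) => x h1 h2.
apply: le_lt_trans (cabs_le_ReIm _) _; rewrite !(ReC_D, ImC_D, ReC_N, ImC_N).
by rewrite [e]splitr ltrD.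
Qed.

End ComplexCalculus.

(** * The Poisson representation of bounded holomorphic functions *)

Section PoissonRepresentation.
Set Implicit Arguments.
Unset Strict Implicit.
Context {R : realType}.
Local Notation mu := (@lebesgue_measure R).
Local Notation I g := (\int[mu]_s (g s)).
Local Notation C := R[i].
Local Notation Re := complex.Re.
Local Notation Im := complex.Im.

Lemma box_bounded (f : C -> C) (a1 a2 b1 b2 : R) :
  (forall z, a1 <= Re z <= a2 -> b1 <= Im z <= b2 -> f w @[w --> z] --> f z) ->
  exists K : R, forall z, a1 <= Re z <= a2 -> b1 <= Im z <= b2 -> cabs (f z) <= K.
Proof.
move=> cf; pose g (p : R * R) := cabs (f (p.1 +i* p.2)).
have cg : {within `[a1, a2] `*` `[b1, b2], continuous g}.
  apply: continuous_in_subspaceT => -[u v] /set_mem[/=].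
  rewrite !in_itv/= => uI vI; apply/cvgrPdist_lt => e e0.
  have /cvgC_lt/(_ _ e0)[d /= d0 dh] := cf (u +i* v) uI vI.
  move: d0; rewrite ltcE/= => /andP[/eqP id d0].
  have d2 : 0 < Re d / 2 by rewrite divr_gt0.
  exists (ball u (Re d / 2), ball v (Re d / 2)) => /=.
    by split; exact: nbhsx_ballx.
  move=> [u' v'] [/= uu vv].
  have := dh (u' +i* v'); rewrite /ball_/= cabs_norm ltcE/= id eqxx/=.
  have h : cabs ((u +i* v) - (u' +i* v')) < Re d.
    apply: le_lt_trans (cabs_le_ReIm _) _ => /=.
    by rewrite [Re d]splitr ltrD.
  move=> /(_ h) fe; apply: le_lt_trans fe; rewrite /g /=.
  set p := f _; set q := f _; rewrite ler_norml; apply/andP; split.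
    rewrite lerNl opprB lerBlDr cabsB; rewrite -{1}(subrK p q); exact: cabsD.
  rewrite lerBlDr -{1}(subrK q p); exact: cabsD.
have ck : compact (`[a1, a2] `*` `[b1, b2] : set (R * R)).
  by apply: compact_setX; exact: segment_compact.
have := compact_bounded (continuous_compact cg ck).
move=> [K [_ hK]]; exists (K + 1) => z zR zI.
have := hK (K + 1); rewrite ltrDl => /(_ ltr01 (cabs (f z))).
rewrite /= ger0_norm ?cabs_ge0//; apply; exists (Re z, Im z).
  by split; rewrite /= in_itv.
by rewrite /g /=; congr (cabs (f _)); case: z {zR zI}.
Qed.

(** * Deformation of the real line to a point through hyperbolic circles *)

Section path.
Variables (x b : R).
Hypothesis b0 : 0 < b.

(** The squared modulus of b + i tau (s - x), the denominator of the Moebius map [phi]. *)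
Definition hQ (tau s : R) : R := b ^+ 2 + tau ^+ 2 * (s - x) ^+ 2.

Lemma hQ_gt0 tau s : 0 < hQ tau s.
Proof. by rewrite /hQ ltr_wpDr ?exprn_gt0// mulr_ge0 ?sqr_ge0. Qed.

(* [phi tau] parametrizes the image of the real line under a Moebius map; it is the
   real line for [tau = 0], the point x - i b for [tau = 1], and a hyperbolic circle
   about this point in between.  It is x + b ((s-x) - i tau b) / (b + i tau (s-x)). *)
Definition phi (tau s : R) : C :=
  (x + b ^+ 2 * (s - x) * (1 - tau ^+ 2) / hQ tau s) +i*
  (- (tau * b * (b ^+ 2 + (s - x) ^+ 2) / hQ tau s)).

(* 1 / (b + i tau (s-x))^2 *)
Definition ephi (tau s : R) : C :=
  ((b ^+ 2 - tau ^+ 2 * (s - x) ^+ 2) / hQ tau s ^+ 2) +i*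
  (- (2 * tau * b * (s - x) / hQ tau s ^+ 2)).

(** The derivatives of [phi] in s and in tau are a real and a purely imaginary multiple of the same
    [ephi]. By holomorphy, the tau-derivative of Re (F o phi) is thus a real multiple of the
    s-derivative of Im (F o phi). *)
Lemma phi_s tau s :
  has_deriv_on setT (phi tau) s ((b ^+ 2 * (1 - tau ^+ 2))%:C * ephi tau s).
Proof.
have Q0 : hQ tau s != 0 by rewrite gt_eqF ?hQ_gt0.
have dQ : is_derive s 1 (hQ tau) (tau ^+ 2 * (2 * (s - x))).
  rewrite /hQ; apply: is_derive_eq; rewrite /GRing.scale/=; ring.
have dV := is_deriveV (f := hQ tau) Q0 dQ.
apply/has_deriv_ReIm; rewrite /phi /=; split; apply: is_derive_eq.
  rewrite /GRing.scale/= ?mul0r /ephi/=; move: Q0; rewrite /hQ => Q0; field.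
  by rewrite exprMn.
  rewrite /GRing.scale/= ?mul0r /ephi/=; move: Q0; rewrite /hQ => Q0; field.
  by rewrite exprMn.
Qed.

(** The factor b^2 + (s - x)^2 is the inverse of [cauchyw x b s]. It cancels the Poisson weight,
    leaving b^2 / pi times Im (F' ephi) as integrand. *)
Lemma phi_tau tau s :
  has_deriv_on setT (phi ^~ s) tau (- 'i%C * (b * (b ^+ 2 + (s - x) ^+ 2))%:C * ephi tau s).
Proof.
have Q0 : hQ tau s != 0 by rewrite gt_eqF ?hQ_gt0.
have dQ : is_derive tau 1 (hQ ^~ s) (2 * tau * (s - x) ^+ 2).
  rewrite /hQ; apply: is_derive_eq; rewrite /GRing.scale/=; ring.
have dV := is_deriveV (f := hQ ^~ s) Q0 dQ.
apply/has_deriv_ReIm; rewrite /phi /=; split; apply: is_derive_eq.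
  rewrite /GRing.scale/=  ?(mul0r, oppr0, add0r, addr0) /ephi/=; move: Q0; rewrite /hQ => Q0; field.
  by rewrite exprMn.
  rewrite /GRing.scale/=  ?(mul0r, oppr0, add0r, addr0) /ephi/=; move: Q0; rewrite /hQ => Q0; field.
  by rewrite exprMn.
Qed.

Lemma hQ_le tau s : 0 <= tau <= 1 -> hQ tau s <= b ^+ 2 + (s - x) ^+ 2.
Proof.
move=> /andP[t0 t1]; rewrite /hQ lerD2l ler_piMl ?sqr_ge0// expr_le1//.
Qed.

Lemma hQ_ge tau s : 0 <= tau <= 1 -> tau ^+ 2 * (b ^+ 2 + (s - x) ^+ 2) <= hQ tau s.
Proof.
move=> /andP[t0 t1]; rewrite /hQ mulrDr lerD2r ler_piMl ?sqr_ge0// expr_le1//.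
Qed.

(** For tau in [t0, 1] all circles lie in one compact rectangle inside the open half plane, on which
    F' is bounded by continuity. The rectangle touches the real line as t0 tends to 0, so this bound
    depends on t0. *)
Lemma phi_box tau t0 s : 0 < t0 <= tau -> tau <= 1 ->
  x - b / t0 <= Re (phi tau s) <= x + b / t0 /\ - (b / t0) <= Im (phi tau s) <= - (t0 * b).
Proof.
move=> /andP[t00 t0t] t1; have tau0 : 0 < tau by exact: lt_le_trans t0t.
have Q0 := hQ_gt0 tau s; set d := s - x.
have t01 : 0 <= tau <= 1 by rewrite ltW.
have Q1 := hQ_le s t01; have Q2 := hQ_ge s t01; rewrite -/d in Q1 Q2.
have bt : b / tau <= b / t0 by rewrite ler_wpM2l ?(ltW b0)// lef_pV2 ?posrE.
have d2 := sqr_ge0 d; have b2 : 0 < b ^+ 2 by rewrite exprn_gt0.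
split.
  have h : `|b ^+ 2 * d * (1 - tau ^+ 2) / hQ tau s| <= b / tau.
    rewrite normrM (gtr0_norm (_ : 0 < (hQ tau s)^-1)) ?invr_gt0//.
    rewrite ler_pdivrMr// [leRHS]mulrAC ler_pdivlMr//.
    have tt : `|1 - tau ^+ 2| <= 1 by rewrite ler_norml; apply/andP; split; nra.
    have dd : b ^+ 2 * `|d| * tau <= b * hQ tau s.
      have -> : b * hQ tau s = b ^+ 2 * `|d| * tau + b * ((b - tau * `|d| / 2) ^+ 2 +
          3 / 4 * (tau * `|d|) ^+ 2).
        by rewrite /hQ -/d -[d ^+ 2](real_normK (num_real d)); field.
      by rewrite lerDl mulr_ge0 ?(ltW b0)// addr_ge0 ?sqr_ge0// mulr_ge0 ?sqr_ge0.
    apply: le_trans dd; rewrite ler_pM2r// (normrM (_ * d)) (normrM (b ^+ 2)) (gtr0_norm b2).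
    by rewrite ler_piMr// mulr_ge0// ltW.
  rewrite /phi /= -/d; move: h; rewrite ler_norml => /andP[h1 h2].
  by apply/andP; split; lra.
rewrite /phi /= -/d; apply/andP; split.
  rewrite lerN2; apply: le_trans bt.
  rewrite ler_pdivrMr// [leRHS]mulrAC ler_pdivlMr//.
  have -> : tau * b * (b ^+ 2 + d ^+ 2) * tau = b * (tau ^+ 2 * (b ^+ 2 + d ^+ 2)) by ring.
  by rewrite ler_pM2l.
rewrite lerN2 ler_pdivlMr//; apply: ler_pM => //; last by rewrite ler_pM2r.
  by apply: mulr_ge0; exact: ltW.
exact: ltW.
Qed.

Lemma cabs_ephi tau s : 0 < tau <= 1 -> cabs (ephi tau s) <= tau ^- 2 * cauchyw x b s.
Proof.
move=> /andP[tau0 tau1]; have Q0 := hQ_gt0 tau s.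
have -> : cabs (ephi tau s) = (hQ tau s)^-1.
  apply: (@pexpIrn _ 2%N) => //; rewrite ?nnegrE ?cabs_ge0 ?invr_ge0 ?(ltW Q0)//.
  have Qn0 : hQ tau s != 0 by rewrite gt_eqF.
  rewrite cabs_sq /ephi /=; move: Qn0; rewrite /hQ => Qn0; field.
  by rewrite exprMn.
have den := cauchyw_den x s b0.
rewrite /cauchyw -invfM lef_pV2 ?posrE ?mulr_gt0 ?exprn_gt0//.
by rewrite -(sqrrN (x - s)) opprB; apply: hQ_ge; rewrite ltW.
Qed.

Lemma phi0 s : phi 0 s = s%:C.
Proof.
by rewrite /phi /hQ expr0n/= !mul0r addr0 subr0 mulr1 oppr0 mulrAC divff ?mul1r ?subrKC// expf_neq0// gt_eqF.
Qed.

Lemma phi1 s : phi 1 s = x +i* (- b).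
Proof.
have Q0 : b ^+ 2 + (s - x) ^+ 2 != 0 by rewrite gt_eqF// ltr_wpDr ?sqr_ge0 ?exprn_gt0.
rewrite /phi /hQ expr1n !mul1r subrr mulr0 mul0r addr0.
by rewrite mulfK.
Qed.

Lemma Im_phi_lt0 tau s : 0 < tau -> Im (phi tau s) < 0.
Proof.
move=> t0; rewrite /phi /= oppr_lt0 divr_gt0 ?hQ_gt0// !mulr_gt0//.
by rewrite ltr_wpDr ?sqr_ge0 ?exprn_gt0.
Qed.

Variables (F F' : C -> C) (M : R).
Hypothesis dF : forall z, Im z < 0 -> cderiv F z (F' z).
Hypothesis cF' : forall z, Im z < 0 -> F' w @[w --> z] --> F' z.
Hypothesis FM : forall z, Im z <= 0 -> cabs (F z) <= M.
Hypothesis cF : cont_on (@closed_lower_half_plane R) F.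

Let K_ (t0 : R) : exists K : R, forall tau s, t0 <= tau -> tau <= 1 ->
  0 < t0 -> cabs (F' (phi tau s)) <= K.
Proof.
have [t00|t00] := ltP 0 t0; last first.
  by exists 0 => tau s _ _.
have [|K hK] := @box_bounded F' (x - b / t0) (x + b / t0) (- (b / t0)) (- (t0 * b)).
  move=> z _ /andP[_ zI]; apply: cF'.
  by apply: le_lt_trans zI _; rewrite oppr_lt0 mulr_gt0.
exists K => tau s t1 t2 _.
have [|h1 h2] := @phi_box tau t0 s _ t2; first by rewrite t00.
exact: hK.
Qed.

Let cphi tau : forall s, phi tau s' @[s' --> s] --> phi tau s.
Proof. by move=> s; exact: has_deriv_continuous (@phi_s tau s). Qed.

Let cephi tau : (forall s, Re (ephi tau s') @[s' --> s] --> Re (ephi tau s)) /\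
  (forall s, Im (ephi tau s') @[s' --> s] --> Im (ephi tau s)).
Proof.
have cd : continuous (fun s => s - x) by move=> s; apply: cvgB; [exact: cvg_id|exact: cvg_cst].
have cd2 : continuous (fun s => (s - x) ^+ 2).
  by move=> s; apply: cvg_sqr; exact: cd.
have cQ : continuous (hQ tau).
  move=> s; apply: cvgD; first exact: cvg_cst.
  by apply: cvgM; [exact: cvg_cst|exact: cd2].
have cQ2 : continuous (fun s => (hQ tau s ^+ 2)^-1).
  move=> s; apply: cvgV; first by rewrite expf_neq0// gt_eqF// hQ_gt0.
  by apply: cvg_sqr; exact: cQ.
split=> s; rewrite /ephi /=.
  apply: cvgM; last exact: cQ2.
  by apply: cvgB; [exact: cvg_cst|apply: cvgM; [exact: cvg_cst|exact: cd2]].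
apply: cvgN; apply: cvgM; last exact: cQ2.
by apply: cvgM; [exact: cvg_cst|exact: cd].
Qed.

Let cIm tau : 0 < tau -> continuous (fun s => Im (F' (phi tau s) * ephi tau s)).
Proof.
move=> t0; have [cR cI] := cephi tau.
have -> : (fun s => Im (F' (phi tau s) * ephi tau s)) = (fun s =>
    Re (F' (phi tau s)) * Im (ephi tau s) + Im (F' (phi tau s)) * Re (ephi tau s)).
  by apply/funext => s; rewrite ImC_M.
move=> s; have cF1 : F' (phi tau s') @[s' --> s] --> F' (phi tau s).
  exact: (cvg_comp _ _ (@cphi tau s) (cF' (Im_phi_lt0 s t0))).
have [c1 c2] := (proj1 (cvgC_ReIm _ _ _) cF1).
by apply: cvgD; apply: cvgM => //; [exact: cI|exact: cR].
Qed.

(* d/dtau of the Poisson average over the circle is the integral of a total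
   s-derivative by the Cauchy-Riemann equations, hence vanishes. *)
Let circ_deriv0 tau : 0 < tau < 1 ->
  I (fun s => b ^+ 2 / pi * Im (F' (phi tau s) * ephi tau s)) = 0.
Proof.
move=> /andP[t0 t1].
have [K hK] := K_ tau.
have c0 : b ^+ 2 * (1 - tau ^+ 2) != 0.
  by rewrite mulf_neq0 ?expf_neq0 ?gt_eqF// subr_gt0 expr_lt1// ltW.
have K0 : 0 <= K by apply: le_trans (hK tau 0 (lexx _) (ltW t1) t0); exact: cabs_ge0.
have bnd s : `|Im (F' (phi tau s) * ephi tau s)| <= K * tau ^- 2 * cauchyw x b s.
  apply: le_trans (norm_Im_le _) _; rewrite cabsM -mulrA.
  apply: ler_pM; rewrite ?cabs_ge0//; first exact: hK (ltW t1) t0.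
  by apply: cabs_ephi; rewrite t0 ltW.
have int : integrableR (fun s => Im (F' (phi tau s) * ephi tau s)).
  exact: (integrable_dominated b0 (continuous_measurable_fun (cIm t0)) bnd).
rewrite RintegralRZ//.
suff h : I (fun s => b ^+ 2 * (1 - tau ^+ 2) * Im (F' (phi tau s) * ephi tau s)) = 0.
  move: h; rewrite RintegralRZ// => /eqP; rewrite mulf_eq0 (negPf c0)/= => /eqP ->.
  by rewrite mulr0.
apply: (@Rintegral_derive_eq0 R (fun s => Im (F (phi tau s))) _ x b
    (b ^+ 2 * (1 - tau ^+ 2) * (K * tau ^- 2))) => //.
- move=> s; have h := has_deriv_cderiv (dF (Im_phi_lt0 s t0)) (@phi_s tau s).
  have [_ hI] := proj1 (has_deriv_ReIm _ _ _) h; apply: (is_derive_eq hI).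
  by rewrite (mulrCA (F' _)) (ImC_M _%:C)/= mul0r addr0.
- by move=> s; apply: cvgM; [exact: cvg_cst|exact: cIm].
- move=> s; rewrite normrM -mulrA; apply: ler_pM => //.
  by rewrite ger0_norm// mulr_ge0 ?sqr_ge0// subr_ge0 expr_le1// ltW.
(* At both ends of the line the circle closes up at the point x - i b / tau, so the two boundary
   terms cancel. *)
have lim (d_ : nat -> R) : (forall n, d_ n != 0) -> (fun n => (d_ n)^-1) @ \oo --> 0 ->
    Im (F (phi tau (x + d_ n))) @[n --> \oo] --> Im (F (x +i* (- (b / tau)))).
  move=> dn0 dcv.
  have zI : Im (x +i* (- (b / tau))) < 0 by rewrite /= oppr_lt0 divr_gt0.
  have cp : phi tau (x + d_ n) @[n --> \oo] --> (x +i* (- (b / tau))).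
    have cden : (fun n => (b ^+ 2 * (d_ n)^-1 ^+ 2 + tau ^+ 2)^-1) @ \oo --> (tau ^+ 2)^-1.
      rewrite (_ : tau ^- 2 = (b ^+ 2 * 0 ^+ 2 + tau ^+ 2)^-1); last first.
        by rewrite expr0n mulr0 add0r.
      apply: cvgV; first by rewrite expr0n mulr0 add0r expf_neq0// gt_eqF.
      apply: cvgD; last exact: cvg_cst.
      by apply: cvgM; [exact: cvg_cst|exact: cvg_sqr].
    apply/cvgC_ReIm; split => /=.
      rewrite -[X in _ --> X]addr0; apply: cvgD; first exact: cvg_cst.
      rewrite -(mul0r ((tau ^+ 2)^-1)) -(mulr0 (b ^+ 2 * (1 - tau ^+ 2))).
      rewrite (_ : (fun n => _) = (fun n => b ^+ 2 * (1 - tau ^+ 2) * (d_ n)^-1 *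
         (b ^+ 2 * (d_ n)^-1 ^+ 2 + tau ^+ 2)^-1)).
        by apply: cvgM => //; apply: cvgM => //; exact: cvg_cst.
      apply/funext => n; rewrite /hQ [x + _]addrC addrK.
      have n0 := dn0 n; have Q0 : b ^+ 2 + tau ^+ 2 * d_ n ^+ 2 != 0.
        by rewrite gt_eqF// ltr_wpDr ?exprn_gt0// mulr_ge0 ?sqr_ge0.
      by field; rewrite ?exprMn; do ?[apply/andP; split]; rewrite ?Q0 ?n0.
    rewrite (_ : b / tau = tau * b * (b ^+ 2 * 0 ^+ 2 + 1) * (tau ^+ 2)^-1).
      rewrite (_ : (fun n => _) = (fun n => - (tau * b * (b ^+ 2 * (d_ n)^-1 ^+ 2 + 1) *
         (b ^+ 2 * (d_ n)^-1 ^+ 2 + tau ^+ 2)^-1))).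
        apply: cvgN; apply: cvgM => //; apply: cvgM; first exact: cvg_cst.
        apply: cvgD; last exact: cvg_cst.
        by apply: cvgM; [exact: cvg_cst|exact: cvg_sqr].
      apply/funext => n; rewrite /hQ [x + _]addrC addrK.
      have n0 := dn0 n; have Q0 : b ^+ 2 + tau ^+ 2 * d_ n ^+ 2 != 0.
        by rewrite gt_eqF// ltr_wpDr ?exprn_gt0// mulr_ge0 ?sqr_ge0.
      by field; rewrite ?exprMn; do ?[apply/andP; split]; rewrite ?Q0 ?n0.
    by rewrite expr0n mulr0 add0r; field; rewrite gt_eqF.
  have h := cvg_comp _ _ cp (cderiv_continuous (dF zI)).
  by have [_] := proj1 (cvgC_ReIm _ _ _) h.
rewrite -(subrr (Im (F (x +i* (- (b / tau)))))); apply: cvgB; apply: lim.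
- by move=> n; rewrite pnatr_eq0.
- exact: cvg_harmonic.
- by move=> n; rewrite oppr_eq0 pnatr_eq0.
- by under eq_fun do rewrite invrN; rewrite -oppr0; apply: cvgN; exact: cvg_harmonic.
Qed.

Lemma continuous_Fphi tau : 0 < tau -> continuous (fun s => Re (F (phi tau s))).
Proof.
move=> t0 s; have h := cvg_comp _ _ (@cphi tau s) (cderiv_continuous (dF (Im_phi_lt0 s t0))).
by have [] := proj1 (cvgC_ReIm _ _ _) h.
Qed.

Let J tau := I (fun s => pk x b s * Re (F (phi tau s))).

Let J_deriv0 (tau : R) : 0 < tau < 1 -> is_derive tau (1 : R) J 0.
Proof.
(* This radius keeps the parameter in [tau / 2, 1], so a single bound on F' serves for the whole
   neighbourhood. *)
move=> /andP[t0 t1]; set r := Num.min (tau / 2) (1 - tau).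
have r0 : 0 < r by rewrite lt_min divr_gt0// subr_gt0.
have inr y : `|y - tau| < r -> tau / 2 <= y <= 1.
  rewrite lt_min => /andP[]; rewrite !ltr_norml => /andP[? ?] /andP[? ?].
  by apply/andP; split; lra.
have [K hK] := K_ (tau / 2).
have t20 : 0 < tau / 2 by rewrite divr_gt0.
have yt y : `|y - tau| < r -> 0 < y by move=> /inr /andP[+ _]; exact: lt_le_trans.
have t01 : 0 < tau < 1 by rewrite t0.
rewrite -[X in is_derive _ _ _ X](circ_deriv0 t01).
apply: (@is_derive_under_Rintegral R (fun y s => pk x b s * Re (F (phi y s)))
  (fun y s => b ^+ 2 / pi * Im (F' (phi y s) * ephi y s)) tau r x b
  (b ^+ 2 / pi * (K * (tau / 2) ^- 2)) r0 b0).
- move=> y s /yt y0.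
  have h := has_deriv_cderiv (phi := phi^~ s) (dF (Im_phi_lt0 s y0)) (@phi_tau y s).
  have [hR _] := proj1 (has_deriv_ReIm _ _ _) h; apply: is_derive_eq.
  rewrite /GRing.scale/= /pk /cauchyw.
  have Q0 : b ^+ 2 + (x - s) ^+ 2 != 0 by rewrite gt_eqF// cauchyw_den.
  set w := F' _; rewrite !(ReC_M, ImC_M)/= !(mul0r, oppr0, mulr0, subr0, addr0, add0r).
  move: (@pi_neq0 R); generalize (pi : R) => p p0; field.
  by rewrite Q0 p0 gt_eqF// hQ_gt0.
- move=> y s yr; have y0 := yt _ yr; have /andP[y1 y2] := inr _ yr.
  have bp : 0 <= b ^+ 2 / pi by rewrite divr_ge0 ?sqr_ge0 ?pi_ge0.
  rewrite normrM (ger0_norm bp) -mulrA ler_wpM2l//.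
  apply: le_trans (norm_Im_le _) _; rewrite cabsM -mulrA.
  apply: ler_pM; rewrite ?cabs_ge0//; first exact: hK.
  apply: le_trans (cabs_ephi _ _) _; first by rewrite y0.
  rewrite ler_pM2r ?cauchyw_gt0// lef_pV2 ?posrE ?exprn_gt0//.
  by rewrite lerXn2r// nnegrE; exact: ltW.
- move=> y /yt y0; apply: (integrable_pkM _ b0 (M := M)).
    exact: continuous_measurable_fun (continuous_Fphi y0).
  move=> s; apply: le_trans (norm_Re_le _) _; apply: FM; exact/ltW/Im_phi_lt0.
Qed.

Let J_const t1 t2 : 0 < t1 < 1 -> 0 < t2 < 1 -> J t1 = J t2.
Proof.
move=> /andP[a1 a2] /andP[b1 b2].
have := @is_derive_lipschitz _ J (cst 0) t2 t1 0.
rewrite mul0r => h; apply/eqP; rewrite -subr_eq0 -normr_le0; apply: h => s.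
  move=> /andP[s1 s2]; apply: J_deriv0.
  rewrite (lt_le_trans _ s1) ?lt_min ?a1 ?b1//.
  by rewrite (le_lt_trans s2)// gt_max a2 b2.
by rewrite normr0.
Qed.

(** For l = 0 the limit point is on the real line, and the continuity of F on the closed half plane
    is what gives the limit. *)
Let Fphi_cvg (t_ : nat -> R) (l : R) s : (forall n, 0 < t_ n) -> 0 <= l ->
  t_ @ \oo --> l -> Re (F (phi (t_ n) s)) @[n --> \oo] --> Re (F (phi l s)).
Proof.
move=> t0 l0 tl.
have cp : phi (t_ n) s @[n --> \oo] --> phi l s.
  exact: cvg_comp _ _ tl (has_deriv_continuous (@phi_tau l s)).
have zI : closed_lower_half_plane (phi l s).
  rewrite /closed_lower_half_plane/= oppr_le0; apply: divr_ge0; last exact/ltW/hQ_gt0.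
  by apply: mulr_ge0; [apply: mulr_ge0 => //; exact: ltW|rewrite addr_ge0 ?sqr_ge0].
have cFw : F w @[w --> within (@closed_lower_half_plane R) (nbhs (phi l s))] --> F (phi l s).
  by have /subspace_continuousP/(_ _ zI) := cF.
have h : F (phi (t_ n) s) @[n --> \oo] --> F (phi l s).
  apply/cvgC_lt => e e0; have /cvgC_lt/(_ _ e0) h1 := cFw.
  have h2 : \forall n \near \oo, closed_lower_half_plane (phi (t_ n) s) ->
      cabs (F (phi l s) - F (phi (t_ n) s)) < e := cp _ h1.
  apply: filterS h2 => n; apply.
  by apply: ltW; exact: Im_phi_lt0.
by have [] := proj1 (cvgC_ReIm _ _ _) h.
Qed.

(** The average J is constant on ]0, 1[, and dominated convergence extends this to both ends. At 0
    it is the Poisson integral of the boundary values; at 1 the path is the single point x - ib and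
    the kernel has mass 1. *)
Lemma Re_Poisson : PI (fun s => Re (F s%:C)) x b = Re (F (x +i* (- b))).
Proof.
have half : 0 < (2^-1 : R) < 1 by rewrite invr_gt0 ltr0n invf_lt1// ltr1n.
have lim (t_ : nat -> R) (l : R) : (forall n, 0 < t_ n < 1) -> 0 <= l -> t_ @ \oo --> l ->
   J l = J 2^-1.
  move=> t01 l0 tl.
  have t0 n : 0 < t_ n by have /andP[] := t01 n.
  have mF : measurable_fun [set: R] (fun s => Re (F (phi l s))).
    apply: (measurable_fun_cvg (h := fun n s => Re (F (phi (t_ n) s)))) => [n|s _].
      exact: continuous_measurable_fun (continuous_Fphi (t0 n)).
    exact: Fphi_cvg.
  have c1 : (fun n => J (t_ n)) @ \oo --> J l.
    apply: (@dominated_cvgR R _ _ x b (b / pi * M) 0 b0).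
    - move=> n; apply: measurable_funM; first exact: continuous_measurable_fun (continuous_pk b0).
      exact: continuous_measurable_fun (continuous_Fphi (t0 n)).
    - by apply: measurable_funM => //; exact: continuous_measurable_fun (continuous_pk b0).
    - by move=> s _; apply: cvgM; [exact: cvg_cst|exact: Fphi_cvg].
    - move=> n s; rewrite normrM mulrAC; apply: ler_pM => //; first exact: pk_le.
      by apply: le_trans (norm_Re_le _) _; apply: FM; exact/ltW/Im_phi_lt0.
  have c2 : (fun n => J (t_ n)) @ \oo --> J 2^-1.
    by apply: cvg_near_cst; apply: nearW => n; exact: J_const.
  exact: (cvg_unique _ c1 c2).
(* The shift by 2 keeps the parameters strictly between 0 and 1, already for n = 0. *)
have inv2 n : 0 < (n.+2%:R^-1 : R) < 1 by rewrite invr_gt0 ltr0n invf_lt1// ltr1n.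
have inv0 : (fun n => n.+2%:R^-1 : R) @ \oo --> 0.
  by have := (@cvg_harmonic R); rewrite -cvg_shiftS; exact.
have e0 : J 0 = J 2^-1.
  exact: (lim (fun n => n.+2%:R^-1)).
have e1 : J 1 = J 2^-1.
  apply: (lim (fun n => 1 - n.+2%:R^-1)) => //.
  - move=> n; move: (inv2 n); generalize (n.+2%:R^-1 : R) => v /andP[? ?].
    by apply/andP; split; lra.
  - by rewrite -[X in _ --> X]subr0; apply: cvgB => //; exact: cvg_cst.
transitivity (J 0).
  by rewrite /J /PI; apply: eq_Rintegral => s _; rewrite phi0.
rewrite e0 -e1 /J; under eq_Rintegral do rewrite phi1.
by have := PI_cst (Re (F (x +i* (- b)))) x b0; rewrite /PI.
Qed.

End path.

Theorem Poisson_representation (F : C -> C) (M x b : R) : 0 < b ->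
  (forall z, Im z < 0 -> derivable F z 1) -> cont_on (@lower_half_plane R) (dx F) ->
  (forall z, Im z <= 0 -> cabs (F z) <= M) -> cont_on (@closed_lower_half_plane R) F ->
  PI (fun s => Re (F s%:C)) x b = Re (F (x +i* (- b))) /\
  PI (fun s => Im (F s%:C)) x b = Im (F (x +i* (- b))).
Proof.
move=> b0 hF cdF FM cF.
have dF z : Im z < 0 -> cderiv F z (dx F z).
  move=> z0; have [l hl] := derivable_cderiv (hF z z0).
  by have [hx _ _] := cderiv_lines hl; rewrite /dx (has_deriv_deriv_onT hx).
have oP : open (@lower_half_plane R).
  rewrite openE => z z0; exists (- Im z)%:C => /=; first by rewrite ltcR oppr_gt0.
  move=> w; rewrite /ball_/= cabs_norm ltcR => wz; rewrite /lower_half_plane/=.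
  have := le_lt_trans (norm_Im_le _) wz; rewrite ImC_D ImC_N ltr_norml => /andP[? ?]; lra.
have cdF' z : Im z < 0 -> dx F w @[w --> z] --> dx F z.
  move: cdF; rewrite /cont_on continuous_open_subspace// => cdF z0.
  by apply: cdF; rewrite inE.
split; first exact: Re_Poisson dF cdF' FM cF.
(* Im F is the real part of - i F, to which the real case applies. *)
have := @Re_Poisson x b b0 (fun z => - 'i%C * F z) (fun z => - 'i%C * dx F z) M.
have ReE (w : C) : Re (- 'i%C * w) = Im w by rewrite ReC_M/=; ring.
rewrite ReE => h; rewrite -h.
- by apply: eq_Rintegral => s _; rewrite ReE.
- move=> z z0 e e0; have [d d0 dh] := dF z z0 e e0; exists d => // k kd.
  rewrite (_ : _ - _ = - 'i%C * (F (z + k) - F z - dx F z * k)); last by ring.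
  by rewrite cabsM cabsN cabs_i mul1r; exact: dh.
- move=> z z0; apply/(@cvgC_lt R _ (nbhs z) _ (fun w => - 'i%C * dx F w)) => e e0.
  have := proj1 (@cvgC_lt R _ (nbhs z) (nbhs_filter z) (dx F) (dx F z)) (cdF' z z0) e e0.
  apply: filterS => w.
  by rewrite -mulrBr cabsM cabsN cabs_i mul1r.
- by move=> z z0; rewrite cabsM cabsN cabs_i mul1r; exact: FM.
- apply/subspace_continuousP => z z0; apply/cvgC_lt => e e0.
  have /subspace_continuousP/(_ z z0)/cvgC_lt/(_ _ e0) := cF; apply: filterS => w.
  by rewrite /from_subspace -mulrBr cabsM cabsN cabs_i mul1r.
Qed.

End PoissonRepresentation.

(** * Fatou's lemma and the integrand of A_1 *)

Section SquareQuotient.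
Set Implicit Arguments.
Unset Strict Implicit.
Context {R : realType}.
Local Notation mu := (@lebesgue_measure R).
Local Notation I g := (\int[mu]_s (g s)).
Local Notation C := R[i].
Local Notation Re := complex.Re.
Local Notation Im := complex.Im.

(** Serves where no common dominating function is at hand, in particular at singular points: bounded
    integrals are enough. *)
Lemma fatouR (g_ : nat -> R -> R) (g : R -> R) (x0 K : R) :
  (forall n, integrableR (g_ n)) -> (forall n s, 0 <= g_ n s) ->
  measurable_fun [set: R] g -> (forall s, 0 <= g s) ->
  (forall s, s != x0 -> g_ ^~ s @ \oo --> g s) ->
  (forall n, I (g_ n) <= K) -> integrableR g /\ I g <= K.
Proof.
move=> ig g0 mg gg0 gcv gK.
have mg_ n := measurable_EFinR (integrableR_measurable (ig n)).
have := @fatou _ _ R mu setT measurableT (fun n => EFin \o g_ n) mg_ _.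
have h0 : forall n s, [set: R] s -> (0 <= (EFin \o g_ n) s)%E by move=> n s _ /=; rewrite lee_fin.
move=> /(_ h0) h.
have hI : (\int[mu]_s (g s)%:E <= K%:E)%E.
  have einf0 s : (0 <= limn_einf (fun n => (g_ n s)%:E))%E.
    rewrite limn_einf_lim; apply: lime_ge; first exact: is_cvg_einfs.
    by apply: nearW => n; apply: le_ereal_inf_tmp => _ [m /= nm <-]; rewrite lee_fin.
  have hle : (\int[mu]_s (g s)%:E <= \int[mu]_s limn_einf (fun n => (g_ n s)%:E))%E.
    apply: ae_ge0_le_integral => //.
    - by move=> s _; rewrite lee_fin.
    - exact: measurable_EFinR.
    - rewrite (_ : (fun s => _) = (fun s => - limn_esup ((fun n s => - (g_ n s)%:E)%E ^~ s))%E).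
        apply: measurableT_comp => //; apply: measurable_fun_limn_esup => n.
        by apply: measurableT_comp => //; exact: mg_.
      apply/funext => s; have := limn_esupN (fun n => (g_ n s)%:E).
      by rewrite /comp => ->; rewrite oppeK.
    - have [N [mN N0 neqN]] := ae_neq x0.
      exists N; split => // s /= nd; apply: neqN => /= /gcv gs; apply: nd => _.
      have h1 : (g_ n s)%:E @[n --> \oo] --> (g s)%:E.
        by apply: cvg_EFin; [exact: nearW|exact: gs].
      by rewrite (cvg_limn_einf_sup h1).1.
  apply: le_trans hle _; apply: le_trans h _; rewrite limn_einf_lim.
  apply: lime_le; first exact: is_cvg_einfs.
  apply: nearW => n; apply: (@le_trans _ _ (\int[mu]_s (g_ n s)%:E)%E).
    by apply: ereal_inf_lbound; exists n => /=.
  by rewrite integrableR_fin ?lee_fin//; exact: gK.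
have ig0 : integrableR g.
  apply/integrableP; split; first exact: measurable_EFinR.
  under eq_integral do rewrite /= ger0_norm//.
  by apply: le_lt_trans hI _; rewrite ltry.
by split => //; rewrite -lee_fin -integrableR_fin.
Qed.

Lemma ae_dense (P : R -> Prop) (x e : R) : (\forall s \ae mu, P s) -> 0 < e ->
  exists2 s, `|s - x| < e & P s.
Proof.
move=> [N [mN N0 PN]] e0; apply: contrapT => h.
have sub : ball x e `<=` N.
  move=> s; rewrite /ball/= distrC => sx; apply: PN => /= Ps; apply: h; by exists s.
have : (mu (ball x e) <= mu N)%E.
  apply: le_measure => //; rewrite inE//; exact: measurable_ball.
rewrite N0 lebesgue_measure_ball ?(ltW e0)// lee_fin leNgt.
by rewrite mulrn_wgt0.
Qed.

Lemma Linfnorm_ae (f : R -> C) (K : R) : (Linfnorm f <= K%:E)%E ->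
  \forall s \ae mu, cabs (f s) <= K.
Proof.
rewrite /Linfnorm unlock /=.
have -> : (0 < mu [set: R])%E.
  apply: (@lt_le_trans _ _ (mu (ball 0 1))).
    by rewrite lebesgue_measure_ball// lte_fin.
  by apply: le_measure => //; rewrite inE//; exact: measurable_ball.
move=> /ess_sup_inf.ess_supP[N [mN N0 PN]]; exists N; split => // s /= ns; apply: PN => /=.
move=> h; apply: ns; move: h; rewrite lee_fin ger0_norm// cabs_ge0//.
Qed.

(** The integrand of [A1]; at s = x it is 0 / 0 = 0. *)
Definition sqq (f : R -> C) (x s : R) : R := cabs (f x - f s) ^+ 2 / (x - s) ^+ 2.

Lemma sqq_ge0 f x s : 0 <= sqq f x s.
Proof. by rewrite divr_ge0 ?sqr_ge0. Qed.

Lemma measurable_sqq f x : measurable_fun [set: R] (fun s => Re (f s)) ->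
  measurable_fun [set: R] (fun s => Im (f s)) -> measurable_fun [set: R] (sqq f x).
Proof.
move=> mR mI; apply: measurable_funM; last first.
  apply: measurable_funVr; apply: measurable_funX; exact: measurable_funB.
rewrite (_ : (fun s => _) = (fun s => (Re (f x) - Re (f s)) ^+ 2 + (Im (f x) - Im (f s)) ^+ 2)).
  by apply: measurable_funD; apply: measurable_funX; exact: measurable_funB.
by apply/funext => s; rewrite cabs_sq ReC_D ImC_D ReC_N ImC_N.
Qed.

(** For |s - x| <= rho the quotient is at most L^2 and rho^2 + (x - s)^2 <= 2 rho^2. Farther away
    the numerator is at most 4 M^2 and rho^2 + (x - s)^2 <= 2 (x - s)^2. *)
Lemma sqq_le f x s M L rho : 0 < rho -> (forall s, cabs (f s) <= M) ->
  (forall s, `|s - x| <= rho -> cabs (f x - f s) <= L * `|x - s|) ->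
  sqq f x s <= (2 * rho ^+ 2 * L ^+ 2 + 8 * M ^+ 2) * cauchyw x rho s.
Proof.
move=> rho0 fM fL; rewrite /cauchyw ler_pdivlMr ?cauchyw_den//.
have rho2 := sqr_ge0 rho; have M2 := sqr_ge0 M; have L2 := sqr_ge0 L.
have [->|sx] := eqVneq s x.
  rewrite /sqq !subrr cabs0 expr0n mul0r mul0r.
  by apply: addr_ge0; do ?[apply: mulr_ge0 => //].
have r0 : 0 < (x - s) ^+ 2 by rewrite exprn_even_gt0//= subr_eq0 eq_sym.
rewrite /sqq mulrAC ler_pdivrMr//; set W := cabs _ ^+ 2.
have W0 : 0 <= W by exact: sqr_ge0.
have M0 : 0 <= M by apply: le_trans (fM 0); exact: cabs_ge0.
have [near_|far] := lerP `|s - x| rho.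
  have WL : W <= L ^+ 2 * (x - s) ^+ 2.
    rewrite -exprMn -[leRHS]real_normK ?num_real// /W.
    rewrite lerXn2r ?nnegrE ?cabs_ge0// normrM.
    apply: le_trans (fL _ near_) _.
    by rewrite ler_wpM2r// ler_norm.
  have Q5 : rho ^+ 2 + (x - s) ^+ 2 <= 2 * rho ^+ 2.
    by move: near_; rewrite ler_norml => /andP[? ?]; nra.
  apply: le_trans (ler_pM W0 _ WL Q5) _; first by rewrite addr_ge0 ?sqr_ge0.
  have : 0 <= 8 * M ^+ 2 * (x - s) ^+ 2 by have r0' := ltW r0; do ?[apply: mulr_ge0 => //].
  nra.
have W4 : W <= 4 * M ^+ 2.
  have := cabsD (f x) (- f s); rewrite cabsN => h1; have := fM x; have := fM s => h2 h3.
  have := cabs_ge0 (f x - f s); rewrite /W => h4.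
  have : cabs (f x - f s) <= 2 * M by lra.
  nra.
have Q5 : rho ^+ 2 + (x - s) ^+ 2 <= 2 * (x - s) ^+ 2.
  by move: far; rewrite lter_normr => /orP[?|?]; nra.
apply: le_trans (ler_pM W0 _ W4 Q5) _; first by rewrite addr_ge0 ?sqr_ge0.
have : 0 <= 2 * rho ^+ 2 * L ^+ 2 * (x - s) ^+ 2 by have r0' := ltW r0; do ?[apply: mulr_ge0 => //].
nra.
Qed.

Lemma integrable_sqq f x M L rho : 0 < rho -> (forall s, cabs (f s) <= M) ->
  measurable_fun [set: R] (fun s => Re (f s)) -> measurable_fun [set: R] (fun s => Im (f s)) ->
  (forall s, `|s - x| <= rho -> cabs (f x - f s) <= L * `|x - s|) ->
  integrableR (sqq f x).
Proof.
move=> rho0 fM mR mI fL.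
apply: (integrable_dominated (x := x) rho0 (measurable_sqq x mR mI)) => s.
rewrite ger0_norm ?sqq_ge0//; exact: (sqq_le s rho0 fM fL).
Qed.

Lemma cvg_sqq (f_ : nat -> R -> C) (f : R -> C) (x_ : nat -> R) x s : s != x ->
  x_ @ \oo --> x -> f_ n (x_ n) @[n --> \oo] --> f x -> f_ n s @[n --> \oo] --> f s ->
  sqq (f_ n) (x_ n) s @[n --> \oo] --> sqq f x s.
Proof.
move=> sx xcv /cvgC_ReIm[fR fI] /cvgC_ReIm[sR sI]; rewrite /sqq; apply: cvgM.
  rewrite cabs_sq; under eq_fun do rewrite cabs_sq.
  by apply: cvgD; apply: cvg_sqr; rewrite ?(ReC_D, ImC_D, ReC_N, ImC_N);
    under eq_fun do rewrite ?(ReC_D, ImC_D, ReC_N, ImC_N); apply: cvgB.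
apply: cvgV; first by rewrite expf_neq0// subr_eq0 eq_sym.
by apply: cvg_sqr; apply: cvgB => //; exact: cvg_cst.
Qed.

Lemma sqq_ReIm f x s : sqq f x s =
  (Re (f x) - Re (f s)) ^+ 2 / (x - s) ^+ 2 + (Im (f x) - Im (f s)) ^+ 2 / (x - s) ^+ 2.
Proof. by rewrite /sqq cabs_sq ReC_D ImC_D ReC_N ImC_N mulrDl. Qed.

End SquareQuotient.

(** * Boundary values *)

Section BoundaryExtension.
Set Implicit Arguments.
Unset Strict Implicit.
Context {R : realType}.
Local Notation C := R[i].
Local Notation Re := complex.Re.
Local Notation Im := complex.Im.
Local Notation P_ := (@lower_half_plane R).
Local Notation Pbar := (@closed_lower_half_plane R).

Lemma open_lower_half_plane : open P_.
Proof.
rewrite openE => z z0; exists (- Im z)%:C => /=; first by rewrite ltcR oppr_gt0.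
move=> w; rewrite /ball_/= cabs_norm ltcR => wz; rewrite /lower_half_plane/=.
have := le_lt_trans (norm_Im_le _) wz; rewrite ImC_D ImC_N ltr_norml => /andP[? ?]; lra.
Qed.

Lemma nbhsC_P (A : set C) (z : C) : nbhs z A <->
  exists2 e : R, 0 < e & forall w, cabs (w - z) < e -> A w.
Proof.
split=> [[e /= e0 eA]|[e e0 eA]].
  move: e0; rewrite ltcE/= => /andP[/eqP ie e0]; exists (Re e) => // w wz; apply: eA.
  by rewrite /ball_/= distrC cabs_norm ltcE/= ie eqxx.
exists e%:C => /=; first by rewrite ltcR.
by move=> w; rewrite /ball_/= distrC cabs_norm ltcR; exact: eA.
Qed.

Lemma cont_onP (D : set C) (f : C -> C) : cont_on D f <->
  forall z, D z -> forall e : R, 0 < e -> exists2 d : R, 0 < d &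
    forall w, D w -> cabs (w - z) < d -> cabs (f w - f z) < e.
Proof.
rewrite /cont_on subspace_continuousP; split=> h z Dz.
  move=> e e0; have /cvgC_lt/(_ _ e0)/nbhsC_P[d d0 dh] := h z Dz.
  by exists d => // w Dw wz; rewrite cabsB; exact: dh.
apply/cvgC_lt => e e0; have [d d0 dh] := h z Dz e e0.
by apply/nbhsC_P; exists d => // w wz Dw; rewrite cabsB; exact: dh.
Qed.

Lemma lower_half_plane_real (a : R) (e : R) : 0 < e ->
  exists2 w : C, P_ w & cabs (w - a%:C) < e.
Proof.
move=> e0; exists (a +i* (- (e / 2))); first by rewrite /lower_half_plane/= oppr_lt0 divr_gt0.
apply: le_lt_trans (cabs_le_ReIm _) _ => /=.
by rewrite subrr normr0 add0r oppr0 addr0 normrN gtr0_norm ?divr_gt0// ltr_pdivrMr// ltr_pMr// ltr1n.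
Qed.

Lemma within_lower_real_proper (a : R) : ProperFilter (within P_ (nbhs (a%:C : C))).
Proof.
apply: Build_ProperFilter_ex => A /nbhsC_P[e e0 eA].
by have [w Pw wa] := lower_half_plane_real a e0; exists w; exact: eA.
Qed.

Lemma extE (f : C -> C) z : P_ z -> ext f z = f z.
Proof. by move=> Pz; rewrite /ext mem_set. Qed.

Lemma ext_real (f : C -> C) (a : R) (l : C) :
  f w @[w --> within P_ (nbhs (a%:C : C))] --> l -> ext f a%:C = l.
Proof.
move=> h; rewrite /ext memNset; last by rewrite /lower_half_plane/= ltxx.
have PF := within_lower_real_proper a; exact: cvg_lim h.
Qed.

Lemma ext_cont (f : C -> C) (g : R -> C) : cont_on P_ f ->
  (forall a : R, f w @[w --> within P_ (nbhs (a%:C : C))] --> g a) -> cont_on Pbar (ext f).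
Proof.
move=> cf fg; apply/cont_onP => z zP e e0.
have [zlt|zge] := ltP (Im z) 0.
  have [d d0 dh] := proj1 (cont_onP _ _) cf z zlt e e0.
  have /nbhsC_P[d' d'0 dh'] : nbhs z P_ by apply: open_nbhs_nbhs; split => //; exact: open_lower_half_plane.
  exists (Num.min d d'); first by rewrite lt_min d0.
  move=> w _; rewrite lt_min => /andP[wd wd'].
  by rewrite (extE _ (dh' _ wd')) (extE _ zlt); apply: dh => //; exact: dh'.
have zE : z = (Re z)%:C.
  by apply: complex_eq => //=; apply/eqP; rewrite eq_le zP zge.
rewrite zE; set a := Re z; rewrite (ext_real (fg a)).
have e2 : 0 < e / 2 by rewrite divr_gt0.
have /cvgC_lt/(_ _ e2)/nbhsC_P[d d0 dh] := fg a.
exists d => // w wP wa.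
have [wlt|wge] := ltP (Im w) 0.
  rewrite extE// cabsB; apply: lt_trans (dh w wa wlt) _.
  by rewrite ltr_pdivrMr// ltr_pMr// ltr1n.
have wE : w = (Re w)%:C.
  by apply: complex_eq => //=; apply/eqP; rewrite eq_le wP wge.
rewrite wE (ext_real (fg (Re w))).
have /cvgC_lt/(_ _ e2)/nbhsC_P[d' d'0 dh'] := fg (Re w).
(* When w is itself on the boundary, its value is compared with that at an interior point w', so
   close to w that it remains in the ball of radius d about a. *)
have m0 : 0 < Num.min d' (d - cabs (w - a%:C)) by rewrite lt_min d'0 subr_gt0.
have [w' Pw'] := lower_half_plane_real (Re w) m0; rewrite lt_min => /andP[w1 w2].
have h1 := dh' w' w1 Pw'.
have h2 : cabs (g a - f w') < e / 2.
  apply: (dh w' _ Pw'); rewrite (_ : w' - a%:C = (w' - (Re w)%:C) + (w - a%:C)).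
    by apply: le_lt_trans (cabsD _ _) _; rewrite -ltrBrDr.
  by rewrite -wE subrKA.
rewrite (_ : g (Re w) - g a = (g (Re w) - f w') - (g a - f w')); last by ring.
apply: le_lt_trans (cabsD _ _) _; rewrite cabsN; lra.
Qed.

Lemma cont_slice (D : set C) (T t : R) (V : topologicalType) (f : C -> R -> V) :
  t \in `[0, T] -> cont_on (D `*` `[0, T]) (uncurry f) -> cont_on D (f ^~ t).
Proof.
move=> tT /subspace_continuousP h; apply/subspace_continuousP => z Dz.
have := h (z, t) (conj Dz tT).
move=> hz A /hz [[/= U V'] [/= nU nV] UV].
have : nbhs z (fun w => D w -> A (f w t)).
  apply: filterS nU => w Uw Dw; apply: (UV (w, t)) => //; split => //=.
  exact: nbhs_singleton.
exact.
Qed.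

Lemma cvgC_M (T : Type) (F : set_system T) (FF : Filter F) (f g : T -> C) (l k : C) :
  f @ F --> l -> g @ F --> k -> (fun x => f x * g x) @ F --> l * k.
Proof.
move=> /cvgC_ReIm[fR fI] /cvgC_ReIm[gR gI]; apply/cvgC_ReIm; rewrite ReC_M ImC_M.
split; (under eq_fun do rewrite ?ReC_M ?ImC_M).
  by apply: cvgB; apply: cvgM.
by apply: cvgD; apply: cvgM.
Qed.

Lemma cvgC_V (T : Type) (F : set_system T) (FF : Filter F) (f : T -> C) (l : C) :
  l != 0 -> f @ F --> l -> (fun x => (f x)^-1) @ F --> l^-1.
Proof. by move=> l0 fl; exact: cvgV. Qed.

(** The derivative is known only inside, so the mean value theorem is applied on the line at depth
    y. The continuity of f up to the boundary then brings the estimate to the real line, at the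
    price of an arbitrary [eta]. *)
Lemma trace_has_deriv (f g : C -> C) (a : R) : cont_on Pbar f -> cont_on Pbar g ->
  (forall z, P_ z -> has_deriv_on setT (xline f z) 0 (g z)) ->
  has_deriv_on setT (fun s : R => f s%:C) a (g a%:C).
Proof.
move=> cf cg df; apply/has_deriv_onTP => e e0.
have e4 : 0 < e / 4 by rewrite divr_gt0.
have real_Pbar (s : R) : Pbar s%:C by rewrite /closed_lower_half_plane/=.
have [d d0 dh] := proj1 (cont_onP _ _) cg a%:C (real_Pbar a) _ e4.
have d2 : 0 < d / 2 by rewrite divr_gt0.
exists (d / 2) => // s sd.
apply: (@le_trans _ _ (e / 2 * `|s - a|)); last first.
  by rewrite ler_wpM2r// ler_pdivrMr// ler_pMr// ler1n.
apply/ler_addgt0Pr => eta eta0.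
have eta2 : 0 < eta / 2 by rewrite divr_gt0.
have [d1 d10 h1] := proj1 (cont_onP _ _) cf s%:C (real_Pbar s) _ eta2.
have [d2' d20 h2] := proj1 (cont_onP _ _) cf a%:C (real_Pbar a) _ eta2.
set y := Num.min (d / 2) (Num.min d1 d2') / 2.
have y0 : 0 < y by rewrite divr_gt0// !lt_min d2 d10.
have : y < Num.min (d / 2) (Num.min d1 d2').
  by rewrite ltr_pdivrMr// ltr_pMr ?ltr1n// !lt_min d2 d10.
rewrite !lt_min => /andP[yd /andP[y1 y2]].
have Pz (u : R) : P_ (u +i* (- y)) by rewrite /lower_half_plane/= oppr_lt0.
have Pz' (u : R) : Pbar (u +i* (- y)) by rewrite /closed_lower_half_plane/= oppr_le0 ltW.
have cz (u : R) : cabs (u +i* (- y) - u%:C) = y.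
  by rewrite /cabs /= subrr expr0n add0r oppr0 addr0 sqrrN sqrtr_sqr gtr0_norm.
have {}h1 := h1 _ (Pz' s); have {}h2 := h2 _ (Pz' a); rewrite !cz in h1 h2.
have {}h1 := h1 y1; have {}h2 := h2 y2.
(* Once the linear part is subtracted, the derivative is g (u - iy) - g a, at most e / 4 in modulus;
   the factor 2 of [has_deriv_lipschitz] turns this into e / 2. *)
pose psi (u : R) : C := f (u +i* (- y)) - u%:C * g a%:C.
have dpsi u : has_deriv_on setT psi u (g (u +i* (- y)) - g a%:C).
  apply/has_deriv_onTP => e' e'0; have /has_deriv_onTP/(_ _ e'0)[k k0 kh] := df _ (Pz u).
  exists k => // v vk; have := kh (v - u); rewrite !subr0 => /(_ vk).
  rewrite /xline addr0 (_ : _ + (v - u)%:C = v +i* (- y)); last first.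
    by apply: complex_eq; rewrite /= ?subrKC ?addr0.
  rewrite (_ : psi v - psi u - _ = f (v +i* - y) - f (u +i* - y) - (v - u)%:C * g (u +i* - y))//.
  by rewrite /psi rmorphB/=; ring.
have := @has_deriv_lipschitz R psi _ a s (e / 4) (fun u _ => dpsi u) _.
have ub u : Num.min a s <= u <= Num.max a s -> cabs (g (u +i* - y) - g a%:C) <= e / 4.
  move=> /andP[u1 u2]; apply/ltW/dh => //.
  apply: le_lt_trans (cabs_le_ReIm _) _ => /=.
  rewrite oppr0 addr0 normrN (gtr0_norm y0) [d]splitr ltrD//.
  apply: le_lt_trans sd; rewrite ler_norml.
  have [as_|sa] := leP a s.
    rewrite (min_idPl as_) (max_idPr as_) in u1 u2.
    by rewrite ger0_norm ?subr_ge0//; apply/andP; split; lra.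
  rewrite (min_idPr (ltW sa)) (max_idPl (ltW sa)) in u1 u2.
  by rewrite ltr0_norm ?subr_lt0//; apply/andP; split; lra.
move=> /(_ ub) h3.
rewrite (_ : _ - _ - _ = (psi s - psi a) - (f (s +i* - y) - f s%:C) + (f (a +i* - y) - f a%:C)); last first.
  by rewrite /psi rmorphB/=; ring.
apply: le_trans (cabsD _ _) _; rewrite [eta]splitr addrA lerD ?(ltW h2)//.
apply: le_trans (cabsD _ _) _; rewrite cabsN lerD ?(ltW h1)//.
by apply: le_trans h3 _; lra.
Qed.

Lemma ext_inv_dz (f g : C -> C) (a : R) : holomorphic f -> cont_on Pbar g ->
  (forall z, P_ z -> has_deriv_on setT (xline f z) 0 (g z)) -> g a%:C != 0 ->
  ext (fun w => (dz f w)^-1) a%:C = (g a%:C)^-1.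
Proof.
move=> hf cg df ga; apply: ext_real; apply: cvgC_V => //.
have dzE z : P_ z -> dz f z = g z.
  move=> Pz; have [l hl] := derivable_cderiv (hf z Pz).
  have [hx _ ->] := cderiv_lines hl.
  by rewrite -(has_deriv_deriv_onT hx) (has_deriv_deriv_onT (df z Pz)).
apply/cvgC_lt => e e0.
have [//|d d0 dh] := proj1 (cont_onP _ _) cg a%:C _ e e0.
  by rewrite /closed_lower_half_plane/=.
apply/nbhsC_P; exists d => // w wa Pw; rewrite dzE// cabsB; apply: dh => //.
exact: ltW.
Qed.

Lemma smooth_slice (T t : R) (f : C -> R -> C) : smooth_up_to_boundary T f -> t \in `[0, T] ->
  cont_on Pbar (f ^~ t) /\ exists2 g : C -> C, cont_on Pbar g &
    forall z, P_ z -> has_deriv_on setT (xline (f ^~ t) z) 0 (g z).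
Proof.
move=> [G [G0 cG dG]] tT; split.
  have := cont_slice tT (cG 0%N 0%N 0%N); move=> /cont_onP h; apply/cont_onP => z zP e e0.
  have [d d0 dh] := h z zP e e0; exists d => // w wP wz.
  by rewrite -!G0//; exact: dh.
exists ((G 1%N 0%N 0%N) ^~ t); first exact: cont_slice tT (cG _ _ _).
move=> z zP; have [h _ _] := dG 0%N 0%N 0%N z t zP tT.
rewrite (_ : xline (f^~ t) z = xline ((G 0 0 0)^~ t) z)//.
apply/funext => s; rewrite /xline G0// /closed_lower_half_plane/= ImC_D/= addr0.
exact: ltW.
Qed.

End BoundaryExtension.

(** * Smooth solutions *)

Section SmoothSolution.
Set Implicit Arguments.
Unset Strict Implicit.
Context {R : realType}.
Local Notation mu := (@lebesgue_measure R).
Local Notation I g := (\int[mu]_s (g s)).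
Local Notation C := R[i].
Local Notation Re := complex.Re.
Local Notation Im := complex.Im.

Lemma has_deriv_conj (f : R -> C) (t : R) (l : C) :
  has_deriv_on setT f t l -> has_deriv_on setT (fun s => conjc (f s)) t (conjc l).
Proof.
move=> /has_deriv_onTP h; apply/has_deriv_onTP => e e0; have [d d0 dh] := h e e0.
exists d => // s sd.
rewrite (_ : _ - _ - _ = conjc (f s - f t - (s - t)%:C * l)) ?cabs_conj; first exact: dh.
by clear; case: (f s) (f t) l => a1 a2 [b1 b2] [k1 k2]; apply: complex_eq => /=; ring.
Qed.

Lemma continuous_ae_le (f : R -> C) (K : R) : (forall x, f s @[s --> x] --> f x) ->
  (\forall s \ae mu, cabs (f s) <= K) -> forall x, cabs (f x) <= K.
Proof.
move=> cf aef x; rewrite leNgt; apply/negP => Kx.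
have e0 : 0 < cabs (f x) - K by rewrite subr_gt0.
have /cvgC_lt/(_ _ e0)[d /= d0 dh] := cf x.
have [s sx] := ae_dense x aef d0.
have := dh s; rewrite /ball_/= distrC => /(_ sx) h1.
have := cabsD (f x - f s) (f s); rewrite subrK => h2 h3; lra.
Qed.

Variables (K : @wu_constants R) (c0 E T : R) (F Psi : C -> R -> C) (Pr : C -> R -> R)
  (h : R -> R -> R) (t : R).
Hypothesis tT : t \in `[0, T].
Hypothesis hS : wu_smooth_solution T F Psi Pr h.
Hypothesis hB : wu_uniform_bounds T F Psi h K c0 E.

Local Notation Zt := (fun s => conj_trace F s t).

Lemma smooth_Zt_deriv s : has_deriv_on setT Zt s (da (conj_trace F) s t).
Proof.
have [cF [g cg dg]] := smooth_slice (sm_F hS) tT.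
have hd := has_deriv_conj (@trace_has_deriv R _ g s cF cg dg).
by rewrite /da (has_deriv_deriv_onT hd).
Qed.

Lemma smooth_Z_deriv s : has_deriv_on setT (fun s => trace Psi s t) s (da (trace Psi) s t).
Proof.
have [cF [g cg dg]] := smooth_slice (sm_Psi hS) tT.
have hd := @trace_has_deriv R _ g s cF cg dg.
by rewrite /da (has_deriv_deriv_onT hd).
Qed.

Lemma smooth_inv_Za s :
  extt (fun w t => (dz (Psi^~ t) w)^-1) s%:C t = (da (trace Psi) s t)^-1.
Proof.
have [cF [g cg dg]] := smooth_slice (sm_Psi hS) tT.
have hd := @trace_has_deriv R _ g s cF cg dg.
have ga : g s%:C = da (trace Psi) s t by rewrite /da (has_deriv_deriv_onT hd).
have [hol _] := ww_conf (sm_system hS) tT.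
rewrite /extt (ext_inv_dz (a := s) hol cg dg) ga//.
exact: sm_Za hS _ _ tT.
Qed.

Lemma smooth_Zt_bounded s : cabs (Zt s) <= CcE K c0 E.
Proof.
apply: continuous_ae_le s; first by move=> x; exact: has_deriv_continuous (@smooth_Zt_deriv x).
apply: Linfnorm_ae; apply: le_trans (ub_cE hB tT).
by rewrite leeDl// /Linfnorm Lnorm_ge0.
Qed.

Lemma smooth_measurable_Zt : measurable_fun [set: R] (fun s => Re (Zt s)) /\
  measurable_fun [set: R] (fun s => Im (Zt s)).
Proof.
have c s := has_deriv_continuous (@smooth_Zt_deriv s).
by split; apply: continuous_measurable_fun => s; have [] := proj1 (cvgC_ReIm _ _ _) (c s).
Qed.

(** Differentiability at x bounds the quotient near x. This bound depends on the solution, but only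
    integrability is retained. *)
Lemma smooth_integrable_sqq x : integrableR (sqq Zt x).
Proof.
have /has_deriv_onTP/(_ _ ltr01)[d d0 dh] := (@smooth_Zt_deriv x).
have [mR mI] := smooth_measurable_Zt.
have d2 : 0 < d / 2 by rewrite divr_gt0.
apply: (@integrable_sqq _ Zt x (CcE K c0 E) (cabs (da (conj_trace F) x t) + 1) (d / 2) d2
  smooth_Zt_bounded mR mI) => s sx.
have sd : `|s - x| < d by apply: le_lt_trans sx _; rewrite ltr_pdivrMr// ltr_pMr// ltr1n.
have := dh s sd; rewrite cabsB [`|x - s|]distrC.
set q := cabs _ => hq.
rewrite (_ : Zt s - Zt x = (Zt s - Zt x - (s - x)%:C * da (conj_trace F) x t) +
   (s - x)%:C * da (conj_trace F) x t); last by rewrite subrK.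
apply: le_trans (cabsD _ _) _; rewrite cabsM cabs_real -/q; lra.
Qed.

(** The bound on [A1] holds only almost everywhere, hence on a dense set. Fatou's lemma along points
    x_ n of that set tending to x gives it at x itself. The constant is A_1 <= [CE K E] solved for
    the integral. *)
Lemma smooth_sqq_le x : I (sqq Zt x) <= 2 * pi * (CE K E - 1).
Proof.
have [mR mI] := smooth_measurable_Zt.
have [_ [_ [A1b _]]] := ub_E hB tT.
have aeA := Linfnorm_ae A1b.
have h1 n : exists s : R, `|s - x| < n.+1%:R^-1 /\ cabs (toC (A1 (conj_trace F)) s t) <= CE K E.
  have n0 : 0 < (n.+1%:R^-1 : R) by rewrite invr_gt0.
  by have [s s1 s2] := ae_dense x aeA n0; exists s.
move: h1 => /choice[x_ xP].
have xcv : x_ @ \oo --> x.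
  apply/cvgrPdist_lt => e e0; near=> n; rewrite distrC.
  apply: (@lt_trans _ _ n.+1%:R^-1); first by have [] := xP n.
  by near: n; apply: (cvgr_lt _ cvg_harmonic).
have c s := has_deriv_continuous (@smooth_Zt_deriv s).
apply: (proj2 (@fatouR R (fun n => sqq Zt (x_ n)) (sqq Zt x) x _ _ _ _ _ _ _)).
- by move=> n; exact: smooth_integrable_sqq.
- by move=> n s; exact: sqq_ge0.
- exact: measurable_sqq.
- by move=> s; exact: sqq_ge0.
- move=> s sx; apply: (cvg_sqq (f_ := fun=> Zt)) => //; first exact: (cvg_comp _ _ xcv (c x)).
  exact: cvg_cst.
- move=> n; have [_] := xP n; rewrite /toC cabs_real /A1 -/(sqq Zt (x_ n)) => h2.
  have := ler_norm (1 + (2 * pi)^-1 * I (sqq Zt (x_ n))) => h3.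
  have {h2}h3 := le_trans h3 h2.
  have p0 : 0 < 2 * pi :> R by rewrite mulr_gt0 ?pi_gt0.
  by rewrite mulrC -ler_pdivrMr// mulrC lerBrDl.
Unshelve. all: by end_near. Qed.

Lemma smooth_A1_bound x : `|A1 (conj_trace F) x t| <= `|CE K E|.
Proof.
have p0 : 0 < 2 * pi :> R by rewrite mulr_gt0 ?pi_gt0.
have h1 := smooth_sqq_le x.
have h2 : 0 <= I (sqq Zt x) by apply: Rintegral_ge0 => s _; exact: sqq_ge0.
have h3 : (2 * pi)^-1 * I (sqq Zt x) <= CE K E - 1.
  by rewrite mulrC ler_pdivrMr// mulrC.
have h4 : 0 <= (2 * pi)^-1 * I (sqq Zt x) by rewrite mulr_ge0// invr_ge0 ltW.
rewrite /A1 -/(sqq Zt x) ger0_norm; last by rewrite addr_ge0.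
by apply: le_trans (ler_norm _); lra.
Qed.

Lemma smooth_h_deriv (a : R) : exists r : R,
  [/\ is_derive a (1 : R) (h^~ t) r, c1 K E <= `|r| & da (toC h) a t = r%:C].
Proof.
have [G [G0 _ dG]] := sm_h hS.
have [hd _] := dG 0%N 0%N a t tT.
have e : (fun s => G 0%N 0%N s t) = (fun s => (h s t)%:C).
  by apply/funext => s; rewrite G0.
rewrite e in hd; have daE : da (toC h) a t = G 1%N 0%N a t.
  by rewrite /da (has_deriv_deriv_onT hd).
have [hR hI] := proj1 (has_deriv_ReIm _ _ _) hd; rewrite /= in hR hI.
have I0 : Im (G 1%N 0%N a t) = 0.
  by have := derive_val (is_derive := hI); rewrite derive_cst.
have GE : G 1%N 0%N a t = (Re (G 1%N 0%N a t))%:C by apply: complex_eq.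
exists (Re (G 1%N 0%N a t)); split => //; last by rewrite daE.
have /andP[+ _] := ub_ha hB a tT.
by rewrite daE GE cabs_real.
Qed.

Lemma smooth_h_continuous : continuous (h^~ t).
Proof.
move=> a; have [r [[dr _] _ _]] := smooth_h_deriv a.
exact/differentiable_continuous/derivable1_diffP.
Qed.

(* By the chain rule the quotient of the two sides is z_{t alpha} / z_alpha. *)
Lemma smooth_Zta_le a : cabs (da (conj_trace F) (h a t) t) <=
  c2 K E / c1 K E * cabs (da (trace Psi) (h a t) t).
Proof.
have [r [dr rc daE]] := smooth_h_deriv a.
have k1 := c1_gt0 K E; have k2 := c2_gt0 K E.
have r0 : 0 < `|r| by exact: lt_le_trans rc.
have T0 : (0 : R) \in `[0, T].
  by move: tT; rewrite !in_itv/= lexx => /andP[]; exact: le_trans.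
set z := comph (trace Psi) h.
have dzE : da z a t = r%:C * da (trace Psi) (h a t) t.
  rewrite /da; apply: has_deriv_deriv_onT.
  exact: (has_deriv_comp (f := fun s => trace Psi s t) dr (@smooth_Z_deriv _)).
have dztE : da (dt T z) a t = r%:C * da (conj_trace F) (h a t) t.
  rewrite /da; apply: has_deriv_deriv_onT.
  rewrite (_ : (fun s => dt T z s t) = (fun s => conj_trace F (h s t) t)).
    exact: (has_deriv_comp (f := Zt) dr (@smooth_Zt_deriv _)).
  by apply/funext => s; rewrite (sm_zt hS s tT).
have := ub_zta hB a tT; rewrite -/z dztE cabsM cabs_real => h1.
have /andP[+ _] := ub_za hB a tT; rewrite -/z dzE cabsM cabs_real => h2.
rewrite -(ler_pM2l r0); apply: le_trans h1 _.
rewrite -(ler_pM2l k1).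
have -> : c1 K E * (`|r| * (c2 K E / c1 K E * cabs (da (trace Psi) (h a t) t))) =
   c2 K E * (`|r| * cabs (da (trace Psi) (h a t) t)) by field; rewrite gt_eqF.
by rewrite mulrCA ler_pM2l.
Qed.

End SmoothSolution.

(** * The limit solution *)

Section WuSolution.
Set Implicit Arguments.
Unset Strict Implicit.
Context {R : realType}.
Local Notation mu := (@lebesgue_measure R).
Local Notation I g := (\int[mu]_s (g s)).
Local Notation C := R[i].
Local Notation Re := complex.Re.
Local Notation Im := complex.Im.
Local Notation P_ := (@lower_half_plane R).
Local Notation Pbar := (@closed_lower_half_plane R).

Lemma cvg_loc_unif_pt (X : topologicalType) (U : set X) (V : uniformType)
    (f_ : nat -> X -> V) (f : X -> V) (p : X) :
  cvg_loc_unif U f_ f -> U p -> f_ n p @[n --> \oo] --> f p.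
Proof.
move=> h Up; have := h [set p] (@compact_set1 _ p).
by rewrite uniform_set1; apply => _ ->.
Qed.

Lemma cvg_loc_unif_lt (X : topologicalType) (U : set X)
    (f_ : nat -> X -> C) (f : X -> C) (K : set X) (e : R) :
  cvg_loc_unif U f_ f -> compact K -> K `<=` U -> 0 < e ->
  \forall n \near \oo, forall p, K p -> cabs (f p - f_ n p) < e.
Proof.
move=> h cK KU e0; have := h K cK KU.
pose E := [set pq : C * C | ball pq.1 (e%:C : C) pq.2].
have entE : entourage E.
  have e0' : (0 : C) < e%:C by rewrite ltcR.
  have entE := @entourage_ballE C C.
  by rewrite -entE; exists e%:C.
move=> /(_ [set g | forall p, K p -> E (f p, g p)]) hh.
have /hh : nbhs (f : {uniform` K -> C}) [set g | forall p, K p -> E (f p, g p)].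
  by apply/(@uniform_nbhs X K C f); exists E; split.
move=> hnear; have : \forall n \near \oo, forall p, K p -> E (f p, f_ n p) := hnear.
apply: filterS => n hn p Kp; have := hn p Kp.
by rewrite /E/= /ball/= cabs_norm ltcR.
Qed.

Lemma cabs_le3 (a b c : C) : cabs a <= cabs (a - b) + cabs (b - c) + cabs c.
Proof.
have t1 := cabsD (a - b) (b - c); have t2 := cabsD (a - c) c.
rewrite subrKA in t1; rewrite subrK in t2; lra.
Qed.

Lemma half_cabs_le (a b c : C) : cabs (b - a) < cabs a / 4 ->
  cabs (b - c) < cabs a / 4 -> cabs a / 2 <= cabs c.
Proof. by have := cabs_le3 a b c; rewrite (cabsB a); lra. Qed.

(** Turns derivatives in x and in the depth b into [dx] and [dy]: c is 1 horizontally and -1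
    vertically, as the depth decreases when y' grows. Agreement for |s| < r suffices, the vertical
    line leaving the half plane at s = b. *)
Lemma is_derive_affine (G g : R -> R) (x c l r : R) : 0 < r -> `|c| <= 1 ->
  (forall s, `|s| < r -> G s = g (x + c * s)) -> is_derive x (1 : R) g l ->
  is_derive (0 : R) (1 : R) G (c * l).
Proof.
move=> r0 c1 Gg /is_deriveRP dg; apply/is_deriveRP => e e0.
have [d d0 dh] := dg e e0; exists (Num.min d r); first by rewrite lt_min d0.
move=> s; rewrite subr0 lt_min => /andP[sd sr].
have cs : `|c * s| <= `|s| by rewrite normrM ler_piMl.
rewrite !Gg ?normr0// mulr0 addr0.
have := dh (x + c * s); rewrite addrAC subrr add0r => /(_ (le_lt_trans cs sd)).
rewrite mulrA (mulrC s); move/le_trans; apply; exact: ler_wpM2l (ltW e0) _ _ cs.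
Qed.

Lemma cabsB_le (a' b' a b : C) :
  cabs (a - b) <= cabs (a - a') + cabs (a' - b') + cabs (b - b').
Proof.
have := cabs_le3 (a - b) (a' - b) (a' - b').
rewrite (_ : a - b - (a' - b) = a - a'); last by ring.
rewrite (_ : a' - b - (a' - b') = - (b - b')); last by ring.
by rewrite cabsN addrAC.
Qed.

Lemma is_derive_half_sum (k g1 g2 : R -> R) x (dk d1 d2 : R) :
  is_derive x (1 : R) k dk -> is_derive x (1 : R) g1 d1 -> is_derive x (1 : R) g2 d2 ->
  is_derive x (1 : R) (fun y => k y + 2^-1 * (g1 y + g2 y)) (dk + 2^-1 * (d1 + d2)).
Proof.
by move=> h0 h1 h2; apply: is_derive_eq; rewrite /GRing.scale/=; ring.
Qed.

Lemma cvgC_real (F : set_system nat) (FF : Filter F) (u : nat -> R) (l : R) :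
  u @ F --> l -> (u n)%:C @[n --> F] --> l%:C.
Proof. by move=> h; apply/cvgC_ReIm; split => //=; exact: cvg_cst. Qed.

Lemma cvgC_unique (u : nat -> C) (l l' : C) :
  u @ \oo --> l -> u @ \oo --> l' -> l = l'.
Proof. by move=> h1 h2; apply: (cvg_unique _ h1 h2); exact: norm_hausdorff. Qed.
Variables (K : @wu_constants R) (T0 : R)
    (F Psi : R[i] -> R -> R[i]) (Pr : R[i] -> R -> R)
    (Fe Psie : R -> R[i] -> R -> R[i]) (Pre : R -> R[i] -> R -> R)
    (he : R -> R -> R -> R) (eps : nat -> R)
    (h : R -> R -> R) (z : R -> R -> R[i]) (t : R).
Hypothesis hW : wu_solution K T0 F Psi Pr Fe Psie Pre he eps h z.
Hypothesis tT : t \in `[0, T0].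

Local Notation E := (fine (energy F Psi 0)).
Local Notation c0 := (fine (lower_norm F Psi 0)).
Local Notation f := (fun s : R => conj_trace F s t).
Local Notation fe j := (fun s : R => conj_trace (Fe (eps j)) s t).
Local Notation W := (ext (fun w => (dz (Psi^~ t) w)^-1)).
Local Notation We j := (ext (fun w => (dz ((Psie (eps j))^~ t) w)^-1)).
Local Notation Ztt := (comph (dt T0 (dt T0 z)) (hinv h)).
Local Notation CM := (CcE K c0 E).
Local Notation CA := (CE K E).

Let eps01 j : 0 < eps j <= 1. Proof. by have [] := wu_eps hW. Qed.
Let hS j := wu_approx hW (eps01 j).
Let hB j := wu_bounds hW (eps01 j).

Lemma wu_f_cvg s : fe j s @[j --> \oo] --> f s.
Proof.
have [_ h1 _] := wu_Z_cvg hW.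
have [_ hE] := wu_Z_trace hW s tT.
have := cvg_loc_unif_pt (p := (s, t)) h1 (conj Logic.I tT).
by rewrite /conj_trace -/(trace F s t) -hE conjcK.
Qed.

Lemma wu_f_le s : cabs (f s) <= CM.
Proof.
rewrite leNgt; apply/negP => lt.
have e0 : 0 < cabs (f s) - CM by rewrite subr_gt0.
have /cvgC_lt/(_ _ e0)[N _ hN] := wu_f_cvg (s := s).
have h1 := hN N (leqnn N); have h2 := smooth_Zt_bounded tT (hS N) (hB N) s.
have := cabsD (f s - fe N s) (fe N s); rewrite subrK; lra.
Qed.

Lemma wu_f_continuous s : f s' @[s' --> s] --> f s.
Proof.
have /cont_onP cF := cont_slice tT (wu_F_cont hW).
apply/cvgC_lt => e e0.
have [|d d0 dh] := cF s%:C _ e e0; first by rewrite /closed_lower_half_plane/=.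
exists d => //= s'; rewrite /ball_/= => ss.
rewrite /conj_trace -rmorphB cabs_conj cabsB; apply: dh.
  by rewrite /closed_lower_half_plane/=.
by rewrite -rmorphB cabs_real distrC.
Qed.

Lemma wu_f_measurable : measurable_fun [set: R] (fun s => Re (f s)) /\
  measurable_fun [set: R] (fun s => Im (f s)).
Proof.
by split; apply: continuous_measurable_fun => s;
   have [] := proj1 (cvgC_ReIm _ _ _) (wu_f_continuous (s := s)).
Qed.

(** Fatou's lemma once more, now along the approximations; it works at every x, singular or not. *)
Lemma wu_sqq x : integrableR (sqq f x) /\ I (sqq f x) <= 2 * pi * (CA - 1).
Proof.
have [mR mI] := wu_f_measurable.
apply: (@fatouR R (fun j => sqq (fe j) x) (sqq f x) x).
- by move=> n; exact: smooth_integrable_sqq tT (hS n) (hB n) x.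
- by move=> n s; exact: sqq_ge0.
- exact: measurable_sqq.
- by move=> s; exact: sqq_ge0.
- move=> s sx; apply: (cvg_sqq (f_ := fun j => fe j) (x_ := fun=> x)) => //.
  + exact: cvg_cst.
  + exact: wu_f_cvg.
  + exact: wu_f_cvg.
- by move=> n; exact: smooth_sqq_le tT (hS n) (hB n) x.
Qed.

Lemma wu_W_cvg (s : R) : We j s%:C @[j --> \oo] --> W s%:C.
Proof.
have [_ [h1 _]] := wu_closed_cvg hW.
have sP : (Pbar `*` `[0, T0]) (s%:C, t) by split => //=; rewrite /closed_lower_half_plane/=.
exact: (cvg_loc_unif_pt h1 sP).
Qed.

Lemma wu_W_cont : cont_on Pbar W.
Proof. exact: cont_slice tT (wu_invPsi_cont hW). Qed.

Lemma compact_real_segment (a b : R) :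
  compact ([set p : C * R | exists2 s : R, a <= s <= b & p = (s%:C, t)]).
Proof.
have -> : [set p : C * R | exists2 s : R, a <= s <= b & p = (s%:C, t)] =
   (fun s : R => (s%:C, t)) @` `[a, b].
  apply/seteqP; split => p /=; first by move=> [s sab ->]; exists s => //; rewrite in_itv.
  by move=> [s]; rewrite in_itv/= => sab <-; exists s.
apply: continuous_compact; last exact: segment_compact.
apply: continuous_subspaceT => s.
suff c : s'%:C @[s' --> s] --> s%:C by exact: (cvg_pair c (cvg_cst t)).
apply/(@cvgC_lt R _ (nbhs s) (nbhs_filter s)) => e e0.
exists e => //= s'; rewrite /ball_/= => ss.
by rewrite !subr0 expr0n/= addr0 sqrtr_sqr.
Qed.

(** Uniform convergence of 1/Psi^e_z' on a real segment keeps |1/Z^e_{,alpha'}| above d / 2 there.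
    Then [smooth_Zta_le] bounds the derivative of Z^e_t at every point of the segment that the flow
    reaches. *)
Lemma wu_f_lipschitz (x0 : R) : W x0%:C != 0 -> exists rho L : R, 0 < rho /\
  \forall j \near \oo, forall s s', `|s - x0| <= rho -> `|s' - x0| <= rho ->
    cabs (fe j s - fe j s') <= L * `|s - s'|.
Proof.
move=> W0; have d0 := cabs_gt0 W0; set d := cabs (W x0%:C) in d0.
have k1 := c1_gt0 K E; have k2 := c2_gt0 K E.
have d4 : 0 < d / 4 by rewrite divr_gt0.
have [|r r0 hr] := proj1 (cont_onP _ _) wu_W_cont x0%:C _ _ d4.
  by rewrite /closed_lower_half_plane/=.
have [bij _ _] := wu_h_homeo hW tT; have [hi hK1 hK2] := bij.
set a0 := hi x0; have ha0 : h a0 t = x0 by exact: hK2.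
(* By the lower Lipschitz bound on h, moving the label by 1 moves the position by at least [c1 K E].
   Hence for large j the image of [a0 - 1, a0 + 1] under the approximate flow covers the points
   within [c1 K E / 2] of x0. *)
have hp : x0 + c1 K E <= h (a0 + 1) t.
  have := wu_h_bilip hW (a := a0 + 1) (b := a0) tT _.
  rewrite addrAC subrr add0r divr1 ha0 => /(_ _)/andP[|+ _]; last lra.
  by rewrite -subr_eq0 addrAC subrr add0r oner_neq0.
have hm : h (a0 - 1) t <= x0 - c1 K E.
  have := wu_h_bilip hW (a := a0 - 1) (b := a0) tT _.
  rewrite addrAC subrr add0r divrN divr1 opprB ha0 => /(_ _)/andP[|+ _]; last lra.
  by rewrite -subr_eq0 addrAC subrr add0r oppr_eq0 oner_neq0.
(* r / 2 keeps 1/Psi_z' within d / 4 of its value at x0; [c1 K E / 2] keeps the interval in the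
   range of the flows. *)
set rho := Num.min (r / 2) (c1 K E / 2).
have rho0 : 0 < rho by rewrite lt_min !divr_gt0.
(* |Z^e_{,alpha'}| is at most 2 / d; the leading 2 comes from the mean value estimate for complex
   functions. *)
exists rho, (2 * (c2 K E / c1 K E * (2 / d))); split => //.
have [_ [cW _]] := wu_closed_cvg hW.
have nearW_ : \forall j \near \oo, forall s : R, `|s - x0| <= rho ->
    cabs (W s%:C - We j s%:C) < d / 4.
  have := cvg_loc_unif_lt cW (@compact_real_segment (x0 - rho) (x0 + rho)) _ d4.
  move=> /(_ _); have sub : [set p : C * R | exists2 s : R, x0 - rho <= s <= x0 + rho & p = (s%:C, t)]
      `<=` Pbar `*` `[0, T0].
    by move=> p [s _ ->]; split => //=; rewrite /closed_lower_half_plane/=.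
  move=> /(_ sub); apply: filterS => j hj s; rewrite ler_distl => sx.
  by apply: (hj (s%:C, t)); exists s.
have nearh (a : R) : he (eps j) a t @[j --> \oo] --> h a t.
  exact: (@cvg_loc_unif_pt _ _ _ _ _ (a, t) (wu_h_cvg hW) (conj Logic.I tT)).
have c12 : 0 < c1 K E / 2 by rewrite divr_gt0.
have near1 : \forall j \near \oo, x0 + c1 K E / 2 < he (eps j) (a0 + 1) t.
  by apply: (cvgr_gt _ (nearh (a0 + 1))); lra.
have near2 : \forall j \near \oo, he (eps j) (a0 - 1) t < x0 - c1 K E / 2.
  by apply: (cvgr_lt _ (nearh (a0 - 1))); lra.
near=> j.
have hW1 : forall s : R, `|s - x0| <= rho -> cabs (W s%:C - We j s%:C) < d / 4 by near: j.
have h1 : x0 + c1 K E / 2 < he (eps j) (a0 + 1) t by near: j.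
have h2 : he (eps j) (a0 - 1) t < x0 - c1 K E / 2 by near: j.
have ub s : `|s - x0| <= rho -> cabs (da (conj_trace (Fe (eps j))) s t) <=
    c2 K E / c1 K E * (2 / d).
  move=> sx.
  have ch : {within `[a0 - 1, a0 + 1], continuous (fun a => he (eps j) a t)}.
    by apply: continuous_subspaceT; exact: smooth_h_continuous tT (hS j) (hB j).
  have sin : s \in `[(Num.min (he (eps j) (a0 - 1) t) (he (eps j) (a0 + 1) t)),
      (Num.max (he (eps j) (a0 - 1) t) (he (eps j) (a0 + 1) t))].
    have : `|s - x0| <= c1 K E / 2 by apply: le_trans sx _; rewrite ge_min lexx orbT.
    rewrite ler_norml => /andP[? ?].
    by rewrite in_itv/= ge_min le_max; apply/andP; split; apply/orP; [left|right]; lra.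
  have a01 : a0 - 1 <= a0 + 1 by lra.
  (* The intermediate value theorem provides the label a that the flow carries to s. *)
  have [a _ has] := IVT a01 ch sin.
  rewrite -has; apply: le_trans (smooth_Zta_le tT (hS j) (hB j) a) _; rewrite has.
  apply: ler_wpM2l; first by rewrite divr_ge0 ?ltW.
  have Za0 := sm_Za (hS j) s tT.
  have WE := smooth_inv_Za tT (hS j) s; rewrite /extt in WE.
  have Ws : cabs (W s%:C - W x0%:C) < d / 4.
    apply: hr; first by rewrite /closed_lower_half_plane/=.
    rewrite -rmorphB cabs_real; apply: le_lt_trans sx _.
    by rewrite gt_min ltr_pdivrMr// ltr_pMr// ltr1n.
  have Wej := hW1 s sx.
  have : d / 2 <= cabs (We j s%:C) by exact: half_cabs_le Ws Wej.
  rewrite WE cabsV => h3; rewrite -[leLHS]invrK -[leRHS]invrK.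
  by rewrite lef_pV2 ?posrE ?invr_gt0 ?divr_gt0 ?cabs_gt0// invf_div.
move=> s s' sx sx'.
apply: (@has_deriv_lipschitz R (fe j) (fun s => da (conj_trace (Fe (eps j))) s t) s' s) => u uI.
  exact: (@smooth_Zt_deriv R _ _ _ _ _ _ tT (hS j) u).
apply: ub; move: uI sx sx'; rewrite !ler_norml ge_min le_max.
by move=> /andP[/orP[?|?] /orP[?|?]] /andP[? ?] /andP[? ?]; apply/andP; split; lra.
Unshelve. all: by end_near. Qed.

Lemma wu_f_limit_lipschitz (x0 : R) : W x0%:C != 0 -> exists rho L : R, 0 < rho /\
  forall s s', `|s - x0| <= rho -> `|s' - x0| <= rho ->
    cabs (f s - f s') <= L * `|s - s'|.
Proof.
have arith (p q r k v : R) : q < (p - v) / 2 -> k < (p - v) / 2 -> r <= v ->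
  p <= q + r + k -> False by lra.
move=> /wu_f_lipschitz[rho [L [rho0 [N _ hN]]]]; exists rho, L; split => //.
move=> s s' sx sx'; rewrite leNgt; apply/negP => lt.
set e := (cabs (f s - f s') - L * `|s - s'|) / 2.
have e0 : 0 < e by rewrite /e; lra.
have /cvgC_lt/(_ _ e0)[N1 _ h1] := wu_f_cvg (s := s).
have /cvgC_lt/(_ _ e0)[N2 _ h2] := wu_f_cvg (s := s').
set n := maxn N (maxn N1 N2).
have {}h1 : cabs (f s - fe n s) < e.
  by apply: h1; rewrite /= /n; apply: leq_trans (leq_maxr _ _); exact: leq_maxl.
have {}h2 : cabs (f s' - fe n s') < e.
  by apply: h2; rewrite /= /n; apply: leq_trans (leq_maxr _ _); exact: leq_maxr.
have h3 := hN n (leq_maxl _ _) s s' sx sx'.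
have h4 := cabsB_le (fe n s) (fe n s') (f s) (f s').
exact: arith h1 h2 h3 h4.
Qed.

Lemma wu_A1_cvg (x0 : R) : W x0%:C != 0 ->
  A1 (conj_trace (Fe (eps j))) x0 t @[j --> \oo] --> A1 (conj_trace F) x0 t.
Proof.
move=> /wu_f_lipschitz[rho [L [rho0 [N _ hN]]]].
have [mR mI] := wu_f_measurable.
rewrite /A1 -/(sqq f x0); apply: cvgD; first exact: cvg_cst.
apply: cvgM; first exact: cvg_cst.
(* The Lipschitz bound holds from index N on only, whereas the domination is required of every
   term. *)
rewrite -(cvg_shiftn N) /=.
apply: (@dominated_cvgR R (fun n => sqq (fe (n + N)%N) x0) (sqq f x0) x0 rho
  (2 * rho ^+ 2 * L ^+ 2 + 8 * CM ^+ 2) x0) => //.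
- by move=> n; exact: integrableR_measurable (smooth_integrable_sqq tT (hS _) (hB _) x0).
- exact: measurable_sqq.
- move=> s sx; have shift s' : fe (n + N)%N s' @[n --> \oo] --> f s'.
    by have h1 := wu_f_cvg (s := s'); rewrite (cvg_shiftn N (fun n => fe n s')).
  exact: (@cvg_sqq R (fun n => fe (n + N)%N) f (fun=> x0) x0 s sx (cvg_cst _) (shift x0) (shift s)).
- move=> n s; rewrite ger0_norm ?sqq_ge0//; apply: sqq_le => //.
    by move=> s'; exact: smooth_Zt_bounded tT (hS _) (hB _) s'.
  move=> s' sx; apply: hN => //; first by rewrite /= leq_addl.
  by rewrite subrr normr0 ltW.
Qed.

Lemma wu_Ztt_cvg (a : R) :
  - ('i%C * ((A1 (conj_trace (Fe (eps j))) a t)%:C * We j a%:C)) @[j --> \oo]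
    --> conjc (Ztt a t) - 'i%C.
Proof.
have [_ _ h3] := wu_Z_cvg hW.
have := @cvg_loc_unif_pt _ _ _ _ _ (a, t) h3 (conj Logic.I tT).
rewrite /uncurry /= => hz.
apply/cvgC_lt => e e0; have /cvgC_lt/(_ _ e0) := hz; apply: filterS => j hj.
have := sm_Ztt (hS j) a tT.
have := smooth_inv_Za tT (hS j) a; rewrite /extt => -> <-.
by rewrite opprB addrA subrK -rmorphB cabs_conj.
Qed.

Lemma wu_Ztt_singular (a : R) : W a%:C = 0 -> conjc (Ztt a t) = 'i%C.
Proof.
move=> W0; have := wu_Ztt_cvg (a := a); have := wu_W_cvg (s := a); rewrite W0 => cW cZ.
apply/eqP; rewrite -subr_eq0; apply/eqP; apply: (cvgC_unique cZ).
apply/cvgC_lt => e e0.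
have e1 : 0 < e / (`|CA| + 1) by rewrite divr_gt0// ltr_wpDl.
have /cvgC_lt/(_ _ e1) := cW; apply: filterS => j.
rewrite !sub0r !cabsN !cabsM cabs_i mul1r cabs_real ltr_pdivlMr ?ltr_wpDl// => h1.
have h2 := smooth_A1_bound tT (hS j) (hB j) a.
apply: le_lt_trans h1; rewrite mulrC; apply: ler_wpM2l; first exact: cabs_ge0.
by apply: le_trans h2 _; rewrite lerDl.
Qed.

Lemma wu_Ztt_regular (a : R) : W a%:C != 0 ->
  conjc (Ztt a t) - 'i%C = - ('i%C * ((A1 (conj_trace F) a t)%:C * W a%:C)).
Proof.
move=> W0; apply: (cvgC_unique (wu_Ztt_cvg (a := a))).
have FE : Filter (\oo : set_system nat) by exact: _.
have hA := cvgC_real FE (wu_A1_cvg W0).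
have hAW := cvgC_M FE hA (wu_W_cvg (s := a)).
have ci : (fun=> 'i%C : C) @ \oo --> ('i%C : C) by exact: cvg_cst.
by apply: cvgN; exact: (cvgC_M FE ci hAW).
Qed.

(** * The pressure gradient and its boundary limit *)

Local Notation uR := (fun s : R => Re (F s%:C t)).
Local Notation uI := (fun s : R => Im (F s%:C t)).

Let uRE s : Re (conj_trace F s t) = Re (F s%:C t).
Proof. by rewrite /conj_trace; case: (F s%:C t). Qed.

Let uIE s : Im (conj_trace F s t) = - Im (F s%:C t).
Proof. by rewrite /conj_trace; case: (F s%:C t). Qed.

Let measR : measurable_fun [set: R] uR.
Proof.
have [mR _] := wu_f_measurable.
by rewrite (_ : uR = fun s => Re (f s))//; apply/funext => s; rewrite uRE.
Qed.

Let measI : measurable_fun [set: R] uI.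
Proof.
have [_ mI] := wu_f_measurable.
rewrite (_ : uI = fun s => - Im (f s)); first exact: measurable_funN.
by apply/funext => s; rewrite uIE opprK.
Qed.

Let bndR s : `|Re (F s%:C t)| <= CM.
Proof. by rewrite -uRE (le_trans (norm_Re_le _))// wu_f_le. Qed.

Let bndI s : `|Im (F s%:C t)| <= CM.
Proof. by rewrite -normrN -uIE (le_trans (norm_Im_le _))// wu_f_le. Qed.

Let sqqE x s : sqq f x s = (uR x - uR s) ^+ 2 / (x - s) ^+ 2 + (uI x - uI s) ^+ 2 / (x - s) ^+ 2.
Proof. by rewrite sqq_ReIm !uRE !uIE -opprD sqrrN. Qed.

Let quotient_measurable (u : R -> R) x : measurable_fun [set: R] u ->
  measurable_fun [set: R] (fun s => (u x - u s) ^+ 2 / (x - s) ^+ 2).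
Proof.
move=> mu_; apply: measurable_funM.
  by apply: measurable_funX; apply: measurable_funB.
by apply: measurable_funVr; apply: measurable_funX; apply: measurable_funB.
Qed.

(** Both real components have quotients below [sqq f x], since their squares add up to its
    numerator; the sign brought by conjugation is squared away. *)
Let integrable_quotient (u : R -> R) x : (u = uR \/ u = uI) ->
  integrableR (fun s => (u x - u s) ^+ 2 / (x - s) ^+ 2).
Proof.
move=> hu; have [iq _] := wu_sqq x.
apply: (integrableR_le _ _ iq) => [|s].
  by apply: quotient_measurable; case: hu => ->.
rewrite !ger0_norm ?sqq_ge0//; last by rewrite divr_ge0 ?sqr_ge0.
by case: hu => ->; rewrite sqqE ?lerDl ?lerDr divr_ge0 ?sqr_ge0.
Qed.

Let quotient_le (u : R -> R) x : (u = uR \/ u = uI) ->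
  pi^-1 * I (fun s => (u x - u s) ^+ 2 / (x - s) ^+ 2) <= 2 * (CA - 1).
Proof.
move=> hu; have [iq Iq] := wu_sqq x.
rewrite mulrC ler_pdivrMr ?pi_gt0// -mulrA (mulrC _ pi) mulrA.
apply: le_trans Iq; apply: le_RintegralR => //; first exact: integrable_quotient.
by move=> s; case: hu => ->; rewrite sqqE ?lerDl ?lerDr divr_ge0 ?sqr_ge0.
Qed.

Lemma wu_Poisson (x b : R) : 0 < b ->
  PI uR x b = Re (F (x +i* (- b)) t) /\ PI uI x b = Im (F (x +i* (- b)) t).
Proof.
move=> b0; have [M hM] := wu_F_bounded hW.
have [_ cdx _ _] := wu_F_C1 hW.
apply: (Poisson_representation (F := F^~ t) (M := M)) => //.
- by move=> w; exact: (ww_holo (wu_system hW) tT).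
- exact: cont_slice tT cdx.
- by move=> w Pw; exact: (hM (w, t)).
- exact: cont_slice tT (wu_F_cont hW).
Qed.

Lemma wu_pressure_pvar (x b : R) : 0 < b ->
  Pr (x +i* (- b)) t = b + 2^-1 * (pvar uR x b + pvar uI x b).
Proof.
move=> b0; have [hR hI] := wu_Poisson x b0.
have Pz : P_ (x +i* (- b)) by rewrite /lower_half_plane/= oppr_lt0.
rewrite (wu_pressure hW Pz tT) /poisson_conv /= cabs_sq -hR -hI /pvar opprK.
have -> : (fun s => poisson (- b) (x - s) * cabs (comph (dt T0 z) (hinv h) s t) ^+ 2) =
    (fun s => pk x b s * uR s ^+ 2 + pk x b s * uI s ^+ 2).
  apply/funext => s; rewrite -cabs_conj; have [_ ->] := wu_Z_trace hW s tT.
  rewrite cabs_sq /trace -mulrDr /poisson /pk /cauchyw opprK sqrrN (addrC (b ^+ 2)).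
  by rewrite invfM mulrA.
have i2 (u : R -> R) : measurable_fun [set: R] u -> (forall s, `|u s| <= CM) ->
    integrableR (fun s => pk x b s * u s ^+ 2).
  move=> mu_ uM; apply: (@integrable_pkM R (fun s => u s ^+ 2) x b (CM ^+ 2) b0).
    exact: measurable_funX.
  by move=> s; rewrite normrX lerXn2r ?nnegrE// (le_trans _ (uM s)).
rewrite (RintegralRD (i2 _ measR bndR) (i2 _ measI bndI)).
by rewrite -/(PI (fun s => uR s ^+ 2) x b) -/(PI (fun s => uI s ^+ 2) x b); ring.
Qed.

(** Since y' = - b, the term - i d_y' is i d_b. The summand 1 is the derivative of the hydrostatic
    term b. *)
Lemma wu_gradm (x b : R) : 0 < b -> gradm ((toC Pr)^~ t) (x +i* (- b)) =
  (2^-1 * (I (fun s => kx x b s * (uR s - PI uR x b) ^+ 2) +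
           I (fun s => kx x b s * (uI s - PI uI x b) ^+ 2))) +i*
  (1 + 2^-1 * (I (fun s => kb x b s * (uR s - PI uR x b) ^+ 2) +
               I (fun s => kb x b s * (uI s - PI uI x b) ^+ 2))).
Proof.
move=> b0; set X := 2^-1 * _; set Y := 1 + _.
pose p x' b' : R := b' + 2^-1 * (pvar uR x' b' + pvar uI x' b').
have hx : is_derive x (1 : R) (p^~ b) X.
  have d1 := is_derive_pvar_x x b0 measR bndR.
  have d2 := is_derive_pvar_x x b0 measI bndI.
  rewrite /X -[X in is_derive _ _ _ X]add0r.
  exact: is_derive_half_sum (is_derive_cst _ _ _) d1 d2.
have hb : is_derive b (1 : R) (p x) Y.
  have d1 := is_derive_pvar_b x b0 measR bndR.
  have d2 := is_derive_pvar_b x b0 measI bndI.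
  exact: is_derive_half_sum (is_derive_id _ _) d1 d2.
have dxE : dx ((toC Pr)^~ t) (x +i* (- b)) = X%:C.
  apply: has_deriv_deriv_onT; apply/has_deriv_ReIm; split => /=; last exact: is_derive_cst.
  rewrite -[X]mul1r; apply: (is_derive_affine (x := x) b0 _ _ hx); first by rewrite normr1.
  move=> s _; rewrite (_ : _ + s%:C = (x + s) +i* (- b)); last by apply: complex_eq => /=; ring.
  by rewrite mul1r wu_pressure_pvar.
have dyE : dy ((toC Pr)^~ t) (x +i* (- b)) = (- Y)%:C.
  apply: has_deriv_deriv_onT; apply/has_deriv_ReIm; split => /=; last exact: is_derive_cst.
  rewrite -[- Y]mulN1r; apply: (is_derive_affine (x := b) b0 _ _ hb); first by rewrite normrN1.
  move=> s; rewrite ltr_norml => /andP[s1 s2].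
  rewrite (_ : _ + 'i%C * s%:C = x +i* (- (b - s))); last by apply: complex_eq => /=; ring.
  by rewrite mulN1r wu_pressure_pvar// subr_gt0.
by rewrite /gradm dxE dyE; apply: complex_eq => /=; ring.
Qed.

(** Each of the four kernel integrals is at most 2 (CA - 1) in modulus. Half the sum of two of them
    is again at most that, for the real and the imaginary part alike, and the hydrostatic term adds
    1. *)
Lemma wu_gradm_le (w : C) : P_ w -> cabs (gradm ((toC Pr)^~ t) w) <= 1 + 4 * (CA - 1).
Proof.
have arith (p q r v B : R) : `|p| <= 2 * B -> `|q| <= 2 * B -> `|r| <= 2 * B -> `|v| <= 2 * B ->
    `|2^-1 * (p + q)| + `|1 + 2^-1 * (r + v)| <= 1 + 4 * B.
  have e2 : `|2^-1 : R| = 2^-1 by rewrite gtr0_norm.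
  have t1 := ler_normD p q; have t2 := ler_normD r v.
  have := ler_normD 1 (2^-1 * (r + v)); rewrite normr1 !normrM e2; lra.
case: w => x y; rewrite /lower_half_plane/= => y0.
have b0 : 0 < - y by rewrite oppr_gt0.
rewrite -[y]opprK wu_gradm//; apply: le_trans (cabs_le_ReIm _) _ => /=.
have key (k u : R -> R) : continuous k -> (forall s, `|k s| <= pi^-1 * cauchyw x (- y) s) ->
    (u = uR \/ u = uI) ->
    `|I (fun s => k s * (u s - PI u x (- y)) ^+ 2)| <= 2 * (CA - 1).
  move=> ck kD hu; apply: le_trans (quotient_le x hu).
  apply: (@kernel_pvar_le R k u x (- y) CM) => //; last exact: integrable_quotient.
    by case: hu => ->.
  by case: hu => -> s; [exact: bndR|exact: bndI].
have kx1 := @continuous_kx R x _ b0; have kb1 := @continuous_kb R x _ b0.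
have kx2 s := kx_le x s b0; have kb2 s := kb_le x s b0.
exact: arith (key _ uR kx1 kx2 (or_introl erefl)) (key _ uI kx1 kx2 (or_intror erefl))
  (key _ uR kb1 kb2 (or_introl erefl)) (key _ uI kb1 kb2 (or_intror erefl)).
Qed.

(** Away from s = a, [kx] tends to 0 and [kb] to 1 / (pi (a - s)^2). So the real part disappears,
    and the imaginary part tends to 1 plus the integral of [sqq f a] over 2 pi, which is A_1. *)
Lemma wu_gradm_cvg (a : R) : W a%:C != 0 ->
  gradm ((toC Pr)^~ t) w @[w --> within P_ (nbhs (a%:C : C))]
    --> 'i%C * (A1 (conj_trace F) a t)%:C.
Proof.
move=> /wu_f_limit_lipschitz[rho [L [rho0 lip]]].
(* Halved because [cvg_kernel_pvar] asks for the Lipschitz bound on twice its radius. *)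
have r0 : 0 < rho / 2 by rewrite divr_gt0.
have lipR s s' : `|s - a| <= 2 * (rho / 2) -> `|s' - a| <= 2 * (rho / 2) ->
    `|uR s - uR s'| <= L * `|s - s'|.
  rewrite mulrCA divff// mulr1 => h1 h2; apply: le_trans (lip s s' h1 h2).
  by rewrite -!uRE -ReC_N -ReC_D norm_Re_le.
have lipI s s' : `|s - a| <= 2 * (rho / 2) -> `|s' - a| <= 2 * (rho / 2) ->
    `|uI s - uI s'| <= L * `|s - s'|.
  rewrite mulrCA divff// mulr1 => h1 h2; apply: le_trans (lip s s' h1 h2).
  rewrite -normrN opprD opprK -uIE (_ : uI s' = - Im (f s')); last by rewrite uIE opprK.
  by rewrite -ImC_N -ImC_D norm_Im_le.
apply: (cvg_within_seq r0) => w_ Pw wr wn.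
have [xcv ycv] := cvg_within_Re wn.
set x_ := fun n => Re (w_ n); set b_ := fun n => - Im (w_ n).
have b0 n : 0 < b_ n by rewrite oppr_gt0; exact: Pw.
have bcv : b_ @ \oo --> 0 by rewrite -oppr0; exact: cvgN.
have xr n : `|x_ n - a| <= rho / 2.
  apply: le_trans (ltW (wr n)); apply: le_trans (norm_Re_le _).
  by rewrite ReC_D ReC_N.
have wE n : w_ n = x_ n +i* (- b_ n) by rewrite /x_ /b_ opprK; case: (w_ n).
have -> : (fun n => gradm ((toC Pr)^~ t) (w_ n)) = (fun n =>
  (2^-1 * (I (fun s => kx (x_ n) (b_ n) s * (uR s - PI uR (x_ n) (b_ n)) ^+ 2) +
           I (fun s => kx (x_ n) (b_ n) s * (uI s - PI uI (x_ n) (b_ n)) ^+ 2))) +i*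
  (1 + 2^-1 * (I (fun s => kb (x_ n) (b_ n) s * (uR s - PI uR (x_ n) (b_ n)) ^+ 2) +
               I (fun s => kb (x_ n) (b_ n) s * (uI s - PI uI (x_ n) (b_ n)) ^+ 2)))).
  by apply/funext => n; rewrite {1}wE wu_gradm.
have b2 : (fun n => b_ n ^+ 2) @ \oo --> (0 : R).
  by rewrite -[X in _ --> X](expr0n _ 2); exact: cvg_sqr.
have wcv s : s != a -> cauchyw (x_ n) (b_ n) s @[n --> \oo] --> ((a - s) ^+ 2)^-1.
  move=> sa; rewrite /cauchyw; apply: cvgV.
    by rewrite expf_eq0/= subr_eq0 eq_sym.
  rewrite -[X in _ --> X]add0r; apply: cvgD.
    exact: b2.
  by apply: cvg_sqr; apply: cvgB => //; exact: cvg_cst.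
have kxcv s : s != a -> kx (x_ n) (b_ n) s @[n --> \oo] --> (0 : R).
  move=> sa; rewrite /kx.
  rewrite [X in _ --> X](_ : _ = 2 * 0 * (s - a) / pi * ((a - s) ^+ 2)^-1 ^+ 2); last by ring.
  apply: cvgM; last by apply: cvg_sqr; exact: wcv.
  apply: cvgM; last exact: cvg_cst.
  apply: cvgM; first by apply: cvgM; [exact: cvg_cst|].
  by apply: cvgB => //; exact: cvg_cst.
have kbcv s : s != a -> kb (x_ n) (b_ n) s @[n --> \oo] --> pi^-1 * ((a - s) ^+ 2)^-1.
  move=> sa; rewrite /kb.
  have as0 : (a - s) ^+ 2 != 0 by rewrite expf_eq0/= subr_eq0 eq_sym.
  rewrite [X in _ --> X](_ : _ = ((a - s) ^+ 2 - 0) / pi * ((a - s) ^+ 2)^-1 ^+ 2); last first.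
    rewrite subr0 expr2 [in RHS](mulrC _ pi^-1) -mulrA (mulrA ((a - s) ^+ 2)).
    by rewrite divff// mul1r.
  apply: cvgM; last by apply: cvg_sqr; exact: wcv.
  apply: cvgM; last exact: cvg_cst.
  apply: cvgB; last exact: b2.
  by apply: cvg_sqr; apply: cvgB => //; exact: cvg_cst.
have mk : measurable_fun [set: R] (fun s => pi^-1 * ((a - s) ^+ 2)^-1).
  apply: measurable_funM => //; apply: measurable_funVr; apply: measurable_funX.
  exact: measurable_funB.
have limx (u : R -> R) : measurable_fun [set: R] u -> (forall s, `|u s| <= CM) ->
    (forall s s', `|s - a| <= 2 * (rho / 2) -> `|s' - a| <= 2 * (rho / 2) ->
      `|u s - u s'| <= L * `|s - s'|) ->
    (fun n => I (fun s => kx (x_ n) (b_ n) s * (u s - PI u (x_ n) (b_ n)) ^+ 2)) @ \oo -->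
    I (fun s => 0 * (u s - u a) ^+ 2).
  move=> mu_ uM uL.
  apply: (@cvg_kernel_pvar R (fun n => kx (x_ n) (b_ n)) _ u x_ b_ a CM L (rho / 2)) => //.
  - by move=> n; exact: continuous_kx.
  - by move=> n s; exact: kx_le.
  - by move=> n; exact: Rintegral_kx.
have limb (u : R -> R) : measurable_fun [set: R] u -> (forall s, `|u s| <= CM) ->
    (forall s s', `|s - a| <= 2 * (rho / 2) -> `|s' - a| <= 2 * (rho / 2) ->
      `|u s - u s'| <= L * `|s - s'|) ->
    (fun n => I (fun s => kb (x_ n) (b_ n) s * (u s - PI u (x_ n) (b_ n)) ^+ 2)) @ \oo -->
    I (fun s => (pi^-1 * ((a - s) ^+ 2)^-1) * (u s - u a) ^+ 2).
  move=> mu_ uM uL.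
  apply: (@cvg_kernel_pvar R (fun n => kb (x_ n) (b_ n)) _ u x_ b_ a CM L (rho / 2)) => //.
  - by move=> n; exact: continuous_kb.
  - by move=> n s; exact: kb_le.
  - by move=> n; exact: Rintegral_kb.
have zero (u : R -> R) : I (fun s => 0 * (u s - u a) ^+ 2) = 0.
  by under eq_Rintegral do rewrite mul0r; rewrite Rintegral_cst// mul0r.
have quot (u : R -> R) : (fun s => pi^-1 * ((a - s) ^+ 2)^-1 * (u s - u a) ^+ 2) =
    (fun s => pi^-1 * ((u a - u s) ^+ 2 / (a - s) ^+ 2)).
  by apply/funext => s; rewrite -mulrA (mulrC _ ((u s - u a) ^+ 2)) -(sqrrN (u a - _)) opprB.
apply/cvgC_ReIm; split => /=.
  rewrite (_ : 0 * _ - 1 * 0 = 2^-1 * (0 + 0)); last by ring.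
  apply: cvgM; first exact: cvg_cst.
  apply: cvgD; first by rewrite -(zero uR); exact: limx.
  by rewrite -(zero uI); exact: limx.
have -> : 0 * 0 + 1 * A1 (conj_trace F) a t = 1 + 2^-1 *
  (I (fun s => pi^-1 * ((a - s) ^+ 2)^-1 * (uR s - uR a) ^+ 2) +
   I (fun s => pi^-1 * ((a - s) ^+ 2)^-1 * (uI s - uI a) ^+ 2)).
  have iR := @integrable_quotient uR a (or_introl erefl).
  have iI := @integrable_quotient uI a (or_intror erefl).
  rewrite (quot uR) (quot uI) !RintegralRZ// -mulrDr -RintegralRD//.
  rewrite /A1 -/(sqq f a) mul0r add0r mul1r mulrA -invfM; congr (1 + _ * _).
  by apply: eq_Rintegral => s _; exact: sqqE.
apply: cvgD; first exact: cvg_cst.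
apply: cvgM; first exact: cvg_cst.
by apply: cvgD; exact: limb.
Qed.

Lemma wu_W_within (a : R) :
  (dz (Psi^~ t) w)^-1 @[w --> within P_ (nbhs (a%:C : C))] --> W a%:C.
Proof.
have /cont_onP cW := wu_W_cont.
apply/cvgC_lt => e e0; have [|d d0 dh] := cW a%:C _ e e0.
  by rewrite /closed_lower_half_plane/=.
apply/nbhsC_P; exists d => // w wa Pw; rewrite cabsB -(extE (fun w => (dz (Psi^~ t) w)^-1) Pw).
by apply: dh => //; exact: ltW.
Qed.

(** At a singular point the gradient need not have a limit; its boundedness suffices, because the
    other factor tends to 0. *)
Lemma wu_product_cvg (a : R) :
  (dz (Psi^~ t) w)^-1 * gradm ((toC Pr)^~ t) w @[w --> within P_ (nbhs (a%:C : C))]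
    --> 'i%C - conjc (Ztt a t).
Proof.
have [W0|W0] := eqVneq (W a%:C) 0.
  rewrite (wu_Ztt_singular W0) subrr; apply/cvgC_lt => e e0.
  have CG : 0 < `|1 + 4 * (CA - 1)| + 1 by rewrite ltr_wpDl.
  have e1 : 0 < e / (`|1 + 4 * (CA - 1)| + 1) by rewrite divr_gt0.
  have /cvgC_lt/(_ _ e1)/nbhsC_P[d d0 dh] := wu_W_within (a := a).
  apply/nbhsC_P; exists d => // w wa Pw.
  have := dh w wa Pw; rewrite W0 !sub0r !cabsN cabsM ltr_pdivlMr//.
  apply: le_lt_trans; apply: ler_wpM2l; first exact: cabs_ge0.
  apply: le_trans (wu_gradm_le Pw) _; apply: le_trans (ler_norm _) _.
  by rewrite lerDl.
have FW : Filter (within P_ (nbhs (a%:C : C))) by exact: _.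
have := cvgC_M FW (wu_W_within (a := a)) (wu_gradm_cvg W0).
by rewrite -(opprB (conjc _)) (wu_Ztt_regular W0) opprK [in X in X -> _]mulrCA (mulrC (W _)).
Qed.

Lemma wu_product_cont :
  cont_on P_ (fun w => (dz (Psi^~ t) w)^-1 * gradm ((toC Pr)^~ t) w).
Proof.
have [_ cdx cdy _] := wu_Pr_C1 hW.
have {}cdx := cont_slice tT cdx; have {}cdy := cont_slice tT cdy.
have cW : cont_on P_ (fun w => (dz (Psi^~ t) w)^-1).
  apply/cont_onP => w Pw e e0; have /cont_onP cW := wu_W_cont.
  have [d d0 dh] := cW w (ltW Pw) e e0; exists d => // w' Pw' ww.
  rewrite -(extE (fun w => (dz (Psi^~ t) w)^-1) Pw) -(extE (fun w => (dz (Psi^~ t) w)^-1) Pw').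
  by apply: dh => //; exact: ltW.
move=> w; apply: cvgC_M; first exact: cW.
apply: cvgB; first exact: cdx.
apply: cvgC_M; last exact: cdy.
exact: cvg_cst.
Qed.

End WuSolution.

Theorem theorem3p4 (R : realType) (K : @wu_constants R) (T0 : R)
    (F Psi : R[i] -> R -> R[i]) (Pr : R[i] -> R -> R)
    (Fe Psie : R -> R[i] -> R -> R[i]) (Pre : R -> R[i] -> R -> R)
    (he : R -> R -> R -> R) (eps : nat -> R)
    (h : R -> R -> R) (z : R -> R -> R[i]) (t : R) :
  0 < T0 ->
  wu_solution K T0 F Psi Pr Fe Psie Pre he eps h z ->
  t \in `[0, T0] ->
  let Ztt := comph (dt T0 (dt T0 z)) (hinv h) in
  cont_on closed_lower_half_plane
    (ext (fun w => (dz (Psi^~ t) w)^-1 * gradm ((toC Pr)^~ t) w)) /\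
  (forall a : R,
     conjc (Ztt a t) - 'i%C
     = ext (fun w => - ((dz (Psi^~ t) w)^-1 * gradm ((toC Pr)^~ t) w)) a%:C) /\
  (forall a : R, singular_set Psi t a -> conjc (Ztt a t) = 'i%C).
Proof.
move=> _ hW tT Ztt; have cv := wu_product_cvg hW tT; split; [|split].
- exact: ext_cont (wu_product_cont hW tT) cv.
(* The limit i - conj Ztt of the product is the negative of the left-hand side, which accounts for
   the minus sign under [ext]. *)
- move=> a; apply/esym/ext_real; rewrite -opprB; exact: cvgN.
- by move=> a Sa; exact: (wu_Ztt_singular hW tT Sa).
Qed.
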